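(* Let $q\ge1$ and let $F=I_q(f)$, where $f\in L^2_s(\mu^q)$ is nonzero, $f\ge0$, and $f$ satisfies the technical assumptions (i)–(iii) listed in the context; set $\sigma^2=E[F^2]=q!\|f\|^2_{L^2(\mu^q)}>0$, $\sigma>0$. Let $$B_3(F;\sigma)=\frac1\sigma\Big\{\max_1\|f\star_r^l f\|_{L^2(\mu^{2q-r-l})}+\|f\|^2_{L^4(\mu^q)}\Big\},$$ where $\max_1$ ranges over all pairs $(r,l)$ with $r\in\{1,\dots,q\}$ and $1\le l\le r\wedge(q-1)$ if $q>1$, and is $0$ if $q=1$. Then there exist constants $0<c_1=c_1(q)<C_1=C_1(q)<\infty$, depending only on $q$, such that $$c_1\,\sigma\,B_3(F;\sigma)\le\sqrt{E[F^4]-3\sigma^4}\le C_1\,\sigma\,B_3(F;\sigma).$$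
   Context: $(Z,\mathscr Z,\mu)$ is a Borel space with its Borel $\sigma$-field and a $\sigma$-finite measure $\mu$ without atoms. $\eta$ is a Poisson measure on $Z$ with control $\mu$: $\eta(B)$ is Poisson with mean $\mu(B)$ whenever $\mu(B)<\infty$, and $\eta(B),\eta(C)$ are independent for disjoint $B,C$; $\hat\eta=\eta-\mu$. $L^2_s(\mu^q)$ is the space of $\mu^q$-a.e. symmetric functions in $L^2(\mu^q)$, and $I_q(f)$ is the multiple Wiener–Itô integral of order $q$ of $f\in L^2_s(\mu^q)$ with respect to $\hat\eta$, normalized so that $E[I_q(f)I_m(g)]=q!\langle f,g\rangle_{L^2(\mu^q)}\mathbf 1_{q=m}$. Contractions: for $f$ and $g$ symmetric functions of $p$ and $q$ variables, $0\le l\le r\le p\wedge q$, $$f\star_r^l g(\gamma_1,\dots,\gamma_{r-l},t_1,\dots,t_{p-r},s_1,\dots,s_{q-r})=\int_{Z^l}f(z_1,\dots,z_l,\gamma_1,\dots,\gamma_{r-l},t_1,\dots,t_{p-r})\,g(z_1,\dots,z_l,\gamma_1,\dots,\gamma_{r-l},s_1,\dots,s_{q-r})\,\mu^l(dz_1,\dots,dz_l),$$ with no integration when $l=0$. Technical assumptions on $f$: (i) for every $r=1,\dots,q$, the kernel $f\star_q^{q-r}f$ is in $L^2(\mu^r)$; (ii) if $q\ge2$, then for every $r=1,\dots,q$ and $l=1,\dots,r$, the contraction $|f|\star_r^l|f|(z_1,\dots,z_{2q-r-l})$ is well defined and finite at every $(z_1,\dots,z_{2q-r-l})\in Z^{2q-r-l}$;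 (iii) if $q\ge2$, then for every integer $m$ with $1\le m\le 2q-2$ and every $(r,l)$ (with $0\le l\le r\le q-1$) such that $m=2q-2-r-l$, $$\int_Z\Big[\int_{Z^m}(f(z,\cdot)\star_r^l f(z,\cdot))^2\,d\mu^m\Big]^{1/2}\mu(dz)<\infty,$$ where $f(z,\cdot)$ is the function of $q-1$ variables obtained by fixing one argument equal to $z$. *)

(* Defs.v *)
From HB Require Import structures.
From mathcomp Require Import all_boot all_order all_algebra perm.
From mathcomp Require Import all_classical all_reals all_analysis.
From mathcomp Require Import measurable_realfun.

Set Implicit Arguments.
Unset Strict Implicit.
Unset Printing Implicit Defensive.
Import Order.TTheory GRing.Theory Num.Theory.
Import numFieldNormedType.Exports.

Local Open Scope classical_set_scope.
Local Open Scope ring_scope.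
Local Open Scope ereal_scope.

Section control_space.
Context {R : realType} {d : measure_display} {Z : measurableType d}.

(* Z is measurably isomorphic to a Borel subset of [0, 1]; taking A := setT
   shows that the range of phi is itself Borel. *)
Definition borel_space : Prop := exists phi : Z -> R,
  [/\ measurable_fun [set: Z] phi,
      injective phi,
      range phi `<=` `[0%R, 1%R] &
      forall A : set Z, measurable A -> measurable (phi @` A)].

Definition atomless (mu : {measure set Z -> \bar R}) : Prop :=
  forall A, measurable A -> 0 < mu A ->
    exists B, [/\ measurable B, B `<=` A, 0 < mu B & mu B < mu A].

End control_space.
Arguments borel_space R {d} Z.

Section tuple_measure.
Context {R : realType} {d : measure_display} {Z : measurableType d}.

Definition cons_pair n (x : Z * n.-tuple Z) : n.+1.-tuple Z :=
  [the n.+1.-tuple Z of x.1 :: x.2].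

Lemma measurable_cons_pair n : measurable_fun setT (@cons_pair n).
Proof. exact: measurable_cons. Qed.

Section cons_measure.
Context (mu : {sigma_finite_measure set Z -> \bar R}) (n : nat)
        (nu : {sigma_finite_measure set (n.-tuple Z) -> \bar R}).

Definition cons_measure : set (n.+1.-tuple Z) -> \bar R :=
  pushforward (mu \x nu) (@cons_pair n).

Let cons0 : cons_measure set0 = 0.
Proof. by rewrite /cons_measure /pushforward preimage_set0 measure0. Qed.

Let cons_ge0 A : 0 <= cons_measure A.
Proof. by rewrite /cons_measure /pushforward; exact: measure_ge0. Qed.

Let cons_sigma_additive : semi_sigma_additive cons_measure.
Proof.
move=> F mF tF mUF; rewrite /cons_measure /pushforward preimage_bigcup.
apply: measure_semi_sigma_additive.
- by move=> i; rewrite -[X in measurable X]setTI; apply: measurable_cons_pair.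
- apply/trivIsetP => /= i j _ _ ij; rewrite -preimage_setI.
  by move/trivIsetP : tF => -> //; rewrite preimage_set0.
- by rewrite -preimage_bigcup -[X in measurable X]setTI;
    apply: measurable_cons_pair.
Qed.

HB.instance Definition _ := isMeasure.Build _ _ _ cons_measure
  cons0 cons_ge0 cons_sigma_additive.

Let cons_sigma_finite : sigma_finite setT cons_measure.
Proof.
have /sigma_finiteP[F [TF ndF Foo]] := sigma_finiteT mu.
have /sigma_finiteP[G [TG ndG Goo]] := sigma_finiteT nu.
exists (fun i => [set x : n.+1.-tuple Z |
                   F i (thead x) /\ G i [tuple of behead x]]).
  rewrite predeqE => x; split=> // _.
  have [k _ Fk] : (\bigcup_k F k) (thead x) by rewrite -TF.
  have [l _ Gl] : (\bigcup_l G l) [tuple of behead x] by rewrite -TG.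
  exists (maxn k l) => //; split.
    by move: Fk; apply/subsetPset/ndF/leq_maxl.
  by move: Gl; apply/subsetPset/ndG/leq_maxr.
move=> i; have [mF Fy] := Foo i; have [mG Gy] := Goo i; split.
  apply: (@measurableI _ _ ((@tnth _ Z ^~ ord0) @^-1` F i)
                      ((fun x : n.+1.-tuple Z => [tuple of behead x]) @^-1` G i)).
    by rewrite -[X in measurable X]setTI; exact: measurable_tnth.
  by rewrite -[X in measurable X]setTI; exact: measurable_behead.
rewrite /cons_measure /pushforward [X in product_measure1 _ _ X](_ : _ = F i `*` G i).
  by rewrite product_measure1E// lte_mul_pinfty// ge0_fin_numE.
have bK (z : Z) (t : n.-tuple Z) : [tuple of behead [the n.+1.-tuple Z of z :: t]] = t.
  exact: val_inj.
by apply/seteqP; split => -[z t] /=; rewrite /cons_pair bK.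
Qed.

HB.instance Definition _ := Measure_isSigmaFinite.Build _ _ _ cons_measure
  cons_sigma_finite.

End cons_measure.

(* The product measure mu^n. For n = 0 it is the unit mass at the empty tuple,
   so that an integral over Z^0 is an evaluation. *)
Fixpoint tuple_measure (mu : {sigma_finite_measure set Z -> \bar R}) (n : nat)
    : {sigma_finite_measure set (n.-tuple Z) -> \bar R} :=
  match n with
  | 0%N => \d_([tuple] : 0.-tuple Z)
  | n'.+1 => cons_measure mu (tuple_measure mu n')
  end.

Lemma tuple_measure_box (mu : {sigma_finite_measure set Z -> \bar R}) n
    (A : 'I_n -> set Z) : (forall i, measurable (A i)) ->
  tuple_measure mu n [set x | forall i, A i (tnth x i)] = \prod_(i < n) mu (A i).
Proof.
elim: n A => [|n IH] A mA /=.
  rewrite big_ord0 (_ : [set x | _] = setT) ?diracT//.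
  by apply/seteqP; split => x // _ [].
rewrite big_ord_recl -(IH (fun i => A (lift ord0 i)))//.
rewrite /cons_measure /pushforward -product_measure1E//; last first.
  rewrite (_ : [set _ | _] =
    \bigcap_(i in [set: 'I_n]) ((@tnth n Z)^~ i @^-1` A (lift ord0 i))).
    apply: fin_bigcap_measurable => // i _.
    by rewrite -[X in measurable X]setTI; exact: measurable_tnth.
  by apply/seteqP; split => [x /= Ax i _|x /= Ax i]; [exact: Ax|exact: Ax].
congr product_measure1; apply/seteqP; split => -[z t] /=.
- move=> Azt; split; first exact: (Azt ord0).
  by move=> i; have := Azt (lift ord0 i); rewrite tnthS.
- move=> [A0 At] i; case: (unliftP ord0 i) => [j|] ->; last by [].
  by rewrite tnthS.
Qed.

End tuple_measure.

Section poisson_measure.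
Context {R : realType} {d d' : measure_display}.
Context {Z : measurableType d} {Omega : measurableType d'}.
Variable P : probability Omega R.

(* The second argument of poisson_prob plays no role. The library's poisson_pmf
   is not used directly, because it is not a probability for rate 0. *)
Definition poisson_law (X : Omega -> \bar R) (rate : R) : Prop :=
  forall U : set (\bar R), measurable U ->
    P (X @^-1` U) = poisson_prob rate 0 [set n : nat | U n%:R%:E].

Definition independent_ervs (X Y : Omega -> \bar R) : Prop :=
  forall U V : set (\bar R), measurable U -> measurable V ->
    P ((X @^-1` U) `&` (Y @^-1` V)) = P (X @^-1` U) * P (Y @^-1` V).

Definition is_poisson_measure (mu : {measure set Z -> \bar R})
    (eta : R.-ker Omega ~> Z) : Prop :=
  (forall B, measurable B -> mu B < +oo ->
     poisson_law (fun w => eta w B) (fine (mu B))) /\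
  (forall B C, measurable B -> measurable C -> B `&` C = set0 ->
     independent_ervs (fun w => eta w B) (fun w => eta w C)).

End poisson_measure.

Section multiple_integral.
Context {R : realType} {d d' : measure_display}.
Context {Z : measurableType d} {Omega : measurableType d'}.
Variable mu : {sigma_finite_measure set Z -> \bar R}.

(* Elementary integrands: linear combinations of indicators of boxes
   A_{i_1} x ... x A_{i_q}, the A_i being disjoint and of finite measure, which
   vanish on all diagonals. *)
Record elementary (q : nat) := Elementary {
  el_size : nat;
  el_set : 'I_el_size -> set Z;
  el_coef : {ffun 'I_q -> 'I_el_size} -> R;
  el_measurable : forall i, measurable (el_set i);
  el_finite : forall i, mu (el_set i) < +oo;
  el_disjoint : trivIset setT el_set;
  el_diagonal : forall i : {ffun 'I_q -> 'I_el_size}, ~ injective i -> el_coef i = 0%R }.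

Arguments el_set {q} e i : rename.
Arguments el_coef {q} e i : rename.

Definition elementary_fun q (h : elementary q) (x : q.-tuple Z) : R :=
  (\sum_(i : {ffun 'I_q -> 'I_(el_size h)})
     el_coef h i * \prod_(j < q) \1_(el_set h (i j)) (tnth x j))%R.

Variables (P : probability Omega R) (eta : R.-ker Omega ~> Z).

Definition compensated (B : set Z) (w : Omega) : R :=
  (fine (eta w B) - fine (mu B))%R.

Definition elementary_integral q (h : elementary q) (w : Omega) : R :=
  (\sum_(i : {ffun 'I_q -> 'I_(el_size h)})
     el_coef h i * \prod_(j < q) compensated (el_set h (i j)) w)%R.

(* F is a version of I_q(f): the continuous extension to L^2(mu^q) of the
   integral of elementary functions. *)
Definition is_multiple_integral q (f : q.-tuple Z -> R) (F : Omega -> R) :=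
  F \in Lfun P 2%:E /\
  exists h : nat -> elementary q,
    'N[tuple_measure mu q]_2%:E[EFin \o (elementary_fun (h n) \- f)%R]
      @[n --> \oo] --> 0 /\
    'N[P]_2%:E[EFin \o (elementary_integral (h n) \- F)%R]
      @[n --> \oo] --> 0.

End multiple_integral.
Arguments el_set {R d Z mu q} e i : rename.
Arguments el_coef {R d Z mu q} e i : rename.

Section contraction.
Context {R : realType} {d : measure_display} {Z : measurableType d}.
Variable mu : {sigma_finite_measure set Z -> \bar R}.

(* f at the list s of its p arguments; only used when s has length p. *)
Definition eval_seq p (f : p.-tuple Z -> R) (s : seq Z) : R :=
  if insub s is Some t then f t else 0%R.

Lemma eval_seq_tuple p (f : p.-tuple Z -> R) (t : p.-tuple Z) :
  eval_seq f t = f t.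
Proof. by rewrite /eval_seq valK. Qed.

(* f *_r^l g for l <= r <= minn p q. The variables are
   x = (gamma_1, .., gamma_(r-l), t_1, .., t_(p-r), s_1, .., s_(q-r)), so that
   (gamma, t) = take (p - l) x, gamma = take (r - l) x and
   s = drop (p - l) x. The value is an extended real, so that finiteness has to
   be stated. *)
Definition star_contraction p q (f : p.-tuple Z -> R) (g : q.-tuple Z -> R)
    (r l : nat) (x : (p + q - r - l).-tuple Z) : \bar R :=
  \int[tuple_measure mu l]_z
    (eval_seq f (z ++ take (p - l) x) *
     eval_seq g (z ++ take (r - l) x ++ drop (p - l) x))%:E.

Arguments star_contraction {p q} f g r l x.

Definition L2_norm n (h : n.-tuple Z -> \bar R) : \bar R :=
  'N[tuple_measure mu n]_2%:E[h].

Definition section1 q (f : q.-tuple Z -> R) (z : Z) : q.-1.-tuple Z -> R :=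
  fun x => eval_seq f (z :: x).

Definition symmetric_ae q (f : q.-tuple Z -> R) : Prop :=
  forall s : 'S_q, {ae tuple_measure mu q,
    forall x, f [tuple tnth x (s i) | i < q] = f x}.

Definition assumption_i q (f : q.-tuple Z -> R) : Prop :=
  forall r, (1 <= r <= q)%N ->
    measurable_fun setT (star_contraction f f q (q - r)) /\
    L2_norm (star_contraction f f q (q - r)) < +oo.

Definition assumption_ii q (f : q.-tuple Z -> R) : Prop :=
  (2 <= q)%N -> forall r l, (1 <= r <= q)%N -> (1 <= l <= r)%N ->
    forall x, star_contraction (Num.norm \o f) (Num.norm \o f) r l x
      \is a fin_num.

Definition assumption_iii q (f : q.-tuple Z -> R) : Prop :=
  (2 <= q)%N -> forall m r l, (1 <= m <= 2 * q - 2)%N -> (l <= r <= q.-1)%N ->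
    m = (2 * q - 2 - r - l)%N ->
    \int[mu]_z L2_norm
      (star_contraction (section1 f z) (section1 f z) r l) < +oo.

Definition B3 q (f : q.-tuple Z -> R) (sigma : R) : \bar R :=
  (sigma^-1)%:E *
  (\big[maxe/0]_(1 <= r < q.+1)
     \big[maxe/0]_(1 <= l < (minn r q.-1).+1)
       L2_norm (star_contraction f f r l) +
   'N[tuple_measure mu q]_4%:E[EFin \o f] ^+ 2).

End contraction.
Arguments star_contraction {R d Z} mu {p q} f g r l x.

(* Main.v *)
Require Import Defs.
From HB Require Import structures.
From mathcomp Require Import all_boot all_order all_algebra perm.
From mathcomp Require Import all_classical all_reals all_analysis.
From mathcomp Require Import measurable_realfun.
From mathcomp Require Import ring lra zify.

(* The fourth moment of [I_q f] is computed exactly. For a simple kernel on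
   disjoint cells, [I_q] is a polynomial in the centered Poisson counts of the
   cells; these are independent (the cells being atomless, they can be cut so
   finely that a count is the number of occupied pieces, and the void
   probabilities factorize), and their moments are sums over the partitions
   without singletons. Reading off [E[I_q(f)^4]] gives a sum of nonnegative
   integrals indexed by words whose letters are the subsets of [{0,1,2,3}] with
   at least two elements: a letter [S] is an integration variable shared by the
   copies of [f] listed in [S]. For [f >= 0] this identity survives the passage
   to the limit in L^2: truncating the integral bounds its fourth moment from
   above, and Young's inequality [4 x g^3 <= x^4 + 3 g^4] from below.

   The words made only of two complementary pairs of letters give
   [3 sigma^4]; the remaining ones contain every
   [||f *_r^l f||^2] and [||f||_4^4], and are dominated by these by
   Cauchy-Schwarz. All terms being nonnegative, both bounds follow. *)

Set Implicit Arguments.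
Unset Strict Implicit.
Unset Printing Implicit Defensive.
Import Order.TTheory GRing.Theory Num.Theory.
Import numFieldNormedType.Exports.

Local Open Scope classical_set_scope.
Local Open Scope ring_scope.
Local Open Scope ereal_scope.

(** * Iterated integrals *)

Section iterated_integral.
Context {R : realType} {d : measure_display} {Z : measurableType d}.
Variable mu : {sigma_finite_measure set Z -> \bar R}.

(** The kernel is only in L^2, so [E[F^4]] may be infinite and L^2 approximation of [F] says nothing
    about it. The moment identity is therefore stated in [[0, +oo]], and [3 sigma^4] is subtracted
    only at the very end, being finite. Clipping a kernel, in height and to a set of finite measure,
    makes the moment sum Lipschitz in L^1, and nonnegativity makes the clipped sums increase to the
    full one. At a fixed clipping level, however, the clip of [f] need not be near [f], and its
    integral need not be near [F]: the lower bound pairs one factor close to [F] with the cube of a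
    clipped one. This is why the moment sum is defined for four different kernels. Moreover [f] is
    symmetric and nonnegative only almost everywhere, while words permute arguments pointwise: a
    pointwise representative replaces [f], and its contractions have to be shown equal to those of
    [f] almost everywhere. The lower constant comes from the smallest weight [1/(2q)!] of a word,
    the upper one from counting words. *)

Fixpoint iterint n (h : seq Z -> \bar R) : \bar R :=
  if n is n'.+1 then \int[mu]_z iterint n' (fun s => h (z :: s)) else h [::].

(** Kernels live on sequences because the rows read off a word have lengths that depend on the word;
    measurability is asked on each length separately, so that no casts between tuple types are
    needed. *)
Definition seq_measurable (h : seq Z -> \bar R) :=
  forall n, measurable_fun [set: n.-tuple Z] (fun x => h (tval x)).

(** The parameter space [T] collects the variables already consumed by a recursion on the
    sequence. *)
Definition pseq_measurable d' (T : measurableType d') (h : T -> seq Z -> \bar R) :=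
  forall n, measurable_fun [set: T * n.-tuple Z] (fun p => h p.1 (tval p.2)).

Lemma pseq_measurable_comp d1 d2 (T : measurableType d1) (T' : measurableType d2)
    (h : T -> seq Z -> \bar R) (phi : T' -> T) :
  measurable_fun setT phi -> pseq_measurable h ->
  pseq_measurable (fun x => h (phi x)).
Proof.
move=> mphi mh n.
pose g := fun p : T' * n.-tuple Z => (phi p.1, p.2).
have mg : measurable_fun setT g.
  apply: measurable_fun_pair; last exact: measurable_snd.
  by apply: measurableT_comp => //; exact: measurable_fst.
exact: (measurableT_comp (mh n) mg).
Qed.

Lemma seq_measurable_pair d1 (T : measurableType d1) (h : seq Z -> \bar R) :
  seq_measurable h -> pseq_measurable (fun (_ : T) => h).
Proof. by move=> mh n; exact: (measurableT_comp (mh n) measurable_snd). Qed.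

Lemma pseq_measurable_section d1 (T : measurableType d1)
    (h : T -> seq Z -> \bar R) x : pseq_measurable h -> seq_measurable (h x).
Proof.
move=> mh n.
have m2 : measurable_fun [set: n.-tuple Z] (fun y => (x, y)).
  exact: measurable_fun_pair.
exact: (measurableT_comp (mh n) m2).
Qed.

Lemma pseq_measurable_cons d1 (T : measurableType d1) (h : T -> seq Z -> \bar R) :
  pseq_measurable h -> pseq_measurable (fun (p : T * Z) s => h p.1 (p.2 :: s)).
Proof.
move=> mh n.
pose g := fun p : (T * Z) * n.-tuple Z => (p.1.1, [the n.+1.-tuple Z of p.1.2 :: p.2]).
have mg : measurable_fun setT g.
  apply: measurable_fun_pair.
    by apply: measurableT_comp; [exact: measurable_fst|exact: measurable_fst].
  apply: measurable_cons; last exact: measurable_snd.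
  by apply: measurableT_comp; [exact: measurable_snd|exact: measurable_fst].
exact: (measurableT_comp (mh n.+1) mg).
Qed.

Lemma seq_measurable_cons (h : seq Z -> \bar R) :
  seq_measurable h -> pseq_measurable (fun z s => h (z :: s)).
Proof.
move=> mh n.
exact: (measurableT_comp (mh n.+1) (@measurable_cons_pair _ Z n)).
Qed.

(** Converse of [pseq_measurable_cons]; together they allow inductions on a word in which the head
    variable moves into the parameter. *)
Lemma pseq_measurable_uncons d1 (T : measurableType d1) (h : T -> seq Z -> \bar R) :
  measurable_fun setT (fun x => h x [::]) ->
  pseq_measurable (fun (p : T * Z) s => h p.1 (p.2 :: s)) -> pseq_measurable h.
Proof.
move=> m0 mS [|n].
  rewrite (_ : (fun _ => _) = (fun x => h x [::]) \o fst); last first.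
    by apply/funext => -[x t] /=; rewrite tuple0.
  by apply: measurableT_comp => //; exact: measurable_fst.
pose g := fun p : T * n.+1.-tuple Z => ((p.1, tnth p.2 ord0), [tuple of behead p.2]).
have mg : measurable_fun setT g.
  apply: measurable_fun_pair.
    apply: measurable_fun_pair; first exact: measurable_fst.
    exact: (measurableT_comp (@measurable_tnth _ _ _ ord0) measurable_snd).
  exact: (measurableT_comp (@measurable_behead _ _ _) measurable_snd).
rewrite (_ : (fun _ => _) =
  (fun p : (T * Z) * n.-tuple Z => h p.1.1 (p.1.2 :: tval p.2)) \o g).
  exact: (measurableT_comp (mS n) mg).
by apply/funext => -[x t]; rewrite /g /=; case/tupleP: t => z t /=.
Qed.

Lemma pseq_measurable_catr k (h : seq Z -> \bar R) : seq_measurable h ->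
  pseq_measurable (fun (x : k.-tuple Z) s => h (x ++ s)).
Proof.
move=> mh n.
pose g := fun p : k.-tuple Z * n.-tuple Z => [tuple of p.1 ++ p.2].
have mg : measurable_fun setT g.
  apply/measurable_fun_tnthP => i; rewrite /g.
  case: (split_ordP i) => j ->.
    rewrite (_ : _ \o _ = (fun p : k.-tuple Z * n.-tuple Z => tnth p.1 j)).
      exact: (measurableT_comp (@measurable_tnth _ _ _ j) measurable_fst).
    by apply/funext => p /=; rewrite tnth_lshift.
  rewrite (_ : _ \o _ = (fun p : k.-tuple Z * n.-tuple Z => tnth p.2 j)).
    exact: (measurableT_comp (@measurable_tnth _ _ _ j) measurable_snd).
  by apply/funext => p /=; rewrite tnth_rshift.
exact: (measurableT_comp (mh _) mg).
Qed.

Lemma iterint_ge0 n h : (forall s, 0 <= h s) -> 0 <= iterint n h.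
Proof.
elim: n h => [|n IH] h h0 //=.
by apply: integral_ge0 => z _; apply: IH.
Qed.

Lemma eq_iterint n h h' : (forall s, size s = n -> h s = h' s) ->
  iterint n h = iterint n h'.
Proof.
elim: n h h' => [|n IH] h h' hh' /=; first exact: hh'.
by apply: eq_integral => z _; apply: IH => s sn; apply: hh'; rewrite /= sn.
Qed.

Lemma iterint_cat m n h :
  iterint (m + n) h = iterint m (fun s => iterint n (fun t => h (s ++ t))).
Proof.
by elim: m h => [|m IH] h //=; apply: eq_integral => z _; rewrite IH.
Qed.

(** The induction must vary the parameter space: the head variable joins the parameter, and Tonelli
    then integrates it out. *)
Lemma measurable_iterint d1 (T : measurableType d1) n (h : T -> seq Z -> \bar R) :
  (forall x s, 0 <= h x s) -> pseq_measurable h ->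
  measurable_fun setT (fun x => iterint n (h x)).
Proof.
elim: n d1 T h => [|n IH] d1 T h h0 mh /=.
  have m2 : measurable_fun [set: T] (fun x => (x, [tuple] : 0.-tuple Z)).
    exact: measurable_fun_pair.
  exact: (measurableT_comp (mh 0%N) m2).
have := IH _ _ _ _ (pseq_measurable_cons mh).
move=> /(_ (fun _ _ => h0 _ _)) mI.
apply: (measurable_fun_fubini_tonelli_F (m2 := mu) _ mI) => x.
by apply: iterint_ge0 => s; exact: h0.
Qed.

Lemma measurable_iterint_sect n (h : seq Z -> \bar R) :
  (forall s, 0 <= h s) -> seq_measurable h ->
  measurable_fun setT (fun z => iterint n (fun s => h (z :: s))).
Proof.
move=> h0 mh; apply: (measurable_iterint _ (h := fun z s => h (z :: s))) => //.
exact: seq_measurable_cons.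
Qed.

Lemma seq_measurable_iterint_cat n (h : seq Z -> \bar R) :
  (forall s, 0 <= h s) -> seq_measurable h ->
  seq_measurable (fun x => iterint n (fun s => h (x ++ s))).
Proof.
move=> h0 mh k; apply: (measurable_iterint _ (h := fun (x : k.-tuple Z) s => h (x ++ s))) => //.
exact: pseq_measurable_catr.
Qed.

Lemma le_iterint n h h' : (forall s, 0 <= h s) -> seq_measurable h ->
  seq_measurable h' -> (forall s, h s <= h' s) -> iterint n h <= iterint n h'.
Proof.
move=> h0 mh mh' hh'; have h'0 s : 0 <= h' s by exact: le_trans (hh' s).
elim: n h h' h0 mh h'0 mh' hh' => [|n IH] h h' h0 mh h'0 mh' hh' //=.
apply: ge0_le_integral => //.
- by move=> z _; exact: iterint_ge0.
- exact: measurable_iterint_sect.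
- exact: measurable_iterint_sect.
move=> z _; apply: IH => //.
- exact: (pseq_measurable_section _ (seq_measurable_cons mh)).
- exact: (pseq_measurable_section _ (seq_measurable_cons mh')).
Qed.

Lemma iterintZl n h (k : \bar R) : (forall s, 0 <= h s) -> seq_measurable h ->
  0 <= k -> iterint n (fun s => k * h s) = k * iterint n h.
Proof.
move=> h0 mh k0; elim: n h h0 mh => [|n IH] h h0 mh //=.
under eq_integral.
  move=> z _; rewrite IH //; last first.
    exact: (pseq_measurable_section _ (seq_measurable_cons mh)).
  over.
rewrite ge0_integralZl//; first exact: measurable_iterint_sect.
by move=> z _; exact: iterint_ge0.
Qed.

Lemma iterintD n h h' : (forall s, 0 <= h s) -> seq_measurable h ->
  (forall s, 0 <= h' s) -> seq_measurable h' ->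
  iterint n (fun s => h s + h' s) = iterint n h + iterint n h'.
Proof.
elim: n h h' => [|n IH] h h' h0 mh h'0 mh' //=.
under eq_integral.
  move=> z _; rewrite IH //.
  - over.
  - exact: (pseq_measurable_section _ (seq_measurable_cons mh)).
  - exact: (pseq_measurable_section _ (seq_measurable_cons mh')).
rewrite ge0_integralD//.
- by move=> z _; exact: iterint_ge0.
- exact: measurable_iterint_sect.
- by move=> z _; exact: iterint_ge0.
- exact: measurable_iterint_sect.
Qed.

Lemma iterint_swap n (h : Z -> seq Z -> \bar R) : pseq_measurable h ->
  (forall z s, 0 <= h z s) ->
  \int[mu]_z iterint n (h z) = iterint n (fun s => \int[mu]_z h z s).
Proof.
elim: n h => [|n IH] h mh h0 //=.
pose k (p : Z * Z) := iterint n (fun s => h p.1 (p.2 :: s)).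
have mk : measurable_fun setT k.
  by apply: (measurable_iterint _ (h := fun p s => h p.1 (p.2 :: s))) => //;
    exact: pseq_measurable_cons.
rewrite (@fubini_tonelli _ _ _ _ R mu mu k mk); last first.
  by move=> p; exact: iterint_ge0.
apply: eq_integral => y _.
rewrite -IH// /k /=.
apply: (pseq_measurable_comp (h := fun p s => h p.1 (p.2 :: s)) (phi := fun z => (z, y))).
  exact: measurable_fun_pair.
exact: pseq_measurable_cons.
Qed.

(** The measure on [n.+1]-tuples is a pushforward along cons, so one step of the recursion is a
    change of variables followed by Tonelli. *)
Lemma integral_tuple_measure n (h : seq Z -> \bar R) : (forall s, 0 <= h s) ->
  seq_measurable h -> \int[tuple_measure mu n]_x h (tval x) = iterint n h.
Proof.
elim: n h => [|n IH] h h0 mh /=.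
  rewrite integral_dirac//; first by rewrite diracT mul1e.
  exact: (mh 0%N).
pose hh (x : n.+1.-tuple Z) := h (tval x).
have mhh : measurable_fun setT hh := mh n.+1.
have mc := @measurable_cons_pair _ Z n.
transitivity (\int[mu \x tuple_measure mu n]_x (hh \o @cons_pair _ Z n) x).
  rewrite -(preimage_setT (@cons_pair _ Z n)).
  rewrite -(ge0_integral_pushforward mc _ measurableT mhh); last by move=> x _; exact: h0.
  by apply: eq_measure_integral => A mA _.
rewrite (fubini_tonelli1 _ (measurableT_comp mhh mc)); last by move=> x; exact: h0.
apply: eq_integral => z _; rewrite /fubini_F /=.
apply: (IH (fun s => h (z :: s))) => //.
exact: (pseq_measurable_section _ (seq_measurable_cons mh)).
Qed.

End iterated_integral.

(** * Words of letters and their integrals *)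

Notation letter := {set 'I_4}.

Section rows.
Variable T : Type.

(** A pair [(S, z)] is a variable [z] shared by the copies of the kernel listed in [S]; row [i] is
    then the argument list of copy [i]. *)
Definition row_of (i : 'I_4) (v : seq (letter * T)) : seq T :=
  [seq p.2 | p : letter * T <- v & i \in p.1].

Lemma row_of_cons i S z v :
  row_of i ((S, z) :: v) = if i \in S then z :: row_of i v else row_of i v.
Proof. by rewrite /row_of /=; case: ifP. Qed.

Lemma row_of_cat i v1 v2 : row_of i (v1 ++ v2) = row_of i v1 ++ row_of i v2.
Proof. by rewrite /row_of filter_cat map_cat. Qed.

Lemma row_of_nseq i S x : row_of i (zip (nseq (size x) S) x) = if i \in S then x else [::].
Proof.
elim: x => [|z x IH] /=; first by rewrite if_same.
by rewrite row_of_cons IH; case: (i \in S).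
Qed.

Lemma size_row_of i w x : size x = size w ->
  size (row_of i (zip w x)) = count (fun S : letter => i \in S) w.
Proof.
elim: w x => [|S w IH] [|z x] //= [] sx.
by rewrite row_of_cons; case: (i \in S) => /=; rewrite IH.
Qed.


End rows.

Lemma perm_row_of (T : eqType) i (v v' : seq (letter * T)) :
  perm_eq v v' -> perm_eq (row_of i v) (row_of i v').
Proof. by move=> vv'; apply: perm_map; exact: perm_filter. Qed.

Lemma map_row_of (T T' : Type) (f : T -> T') i w x :
  map f (row_of i (zip w x)) = row_of i (zip w (map f x)).
Proof.
elim: w x => [|S w IH] [|z x] //=.
by rewrite !row_of_cons; case: ifP => _ /=; rewrite IH.
Qed.

Section words.
Context {R : realType} {d : measure_display} {Z : measurableType d}.
Variable mu : {sigma_finite_measure set Z -> \bar R}.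

Lemma pseq_measurable_row d1 (T : measurableType d1) (h : T -> seq Z -> \bar R) i w :
  pseq_measurable h -> pseq_measurable (fun x s => h x (row_of i (zip w s))).
Proof.
have mnil d2 (T2 : measurableType d2) (h2 : T2 -> seq Z -> \bar R) :
    pseq_measurable h2 -> measurable_fun setT (fun x => h2 x [::]).
  move=> mh2.
  have m2 : measurable_fun [set: T2] (fun x => (x, [tuple] : 0.-tuple Z)).
    exact: measurable_fun_pair.
  exact: (measurableT_comp (mh2 0%N) m2).
elim: w d1 T h => [|S w IH] d1 T h mh.
  apply: pseq_measurable_uncons => /=; first exact: mnil.
  move=> n; apply: (measurableT_comp (f := fun x => h x [::])); first exact: mnil.
  by apply: measurableT_comp; exact: measurable_fst.
apply: pseq_measurable_uncons => /=; first exact: mnil.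
have [iS|iS] := boolP (i \in S).
  rewrite (_ : (fun _ => _) =
    (fun p s => (fun (p : T * Z) s => h p.1 (p.2 :: s)) p (row_of i (zip w s)))).
    exact: (IH _ _ _ (pseq_measurable_cons mh)).
  by apply/funext => p; apply/funext => s; rewrite row_of_cons iS.
rewrite (_ : (fun _ => _) =
    (fun p s => (fun (p : T * Z) s => h p.1 s) p (row_of i (zip w s)))).
  exact: (IH _ _ _ (pseq_measurable_comp measurable_fst mh)).
by apply/funext => p; apply/funext => s; rewrite row_of_cons (negbTE iS).
Qed.

Lemma seq_measurable_row (h : seq Z -> \bar R) i w :
  seq_measurable h -> seq_measurable (fun s => h (row_of i (zip w s))).
Proof.
move=> mh; have mh' := pseq_measurable_row i w (seq_measurable_pair (T := unit) mh).
exact: (pseq_measurable_section tt mh').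
Qed.

Definition wordint (G : seq (letter * Z) -> \bar R) (w : seq letter) : \bar R :=
  iterint mu (size w) (fun x => G (zip w x)).

Definition word_measurable (G : seq (letter * Z) -> \bar R) :=
  forall w, seq_measurable (fun x => G (zip w x)).

Lemma word_measurable_cons G S : word_measurable G ->
  forall w, pseq_measurable (fun z x => G ((S, z) :: zip w x)).
Proof. by move=> mG w; exact: (seq_measurable_cons (mG (S :: w))). Qed.

Lemma wordint_cons G S w :
  wordint G (S :: w) = \int[mu]_z wordint (fun v => G ((S, z) :: v)) w.
Proof. by []. Qed.

(** Tonelli exchanges [S] with the letters of [p] one at a time; the symmetry of [G] absorbs the
    change in the order of the labelled points. *)
Lemma wordint_front G p q S :
  (forall v v', perm_eq v v' -> G v = G v') -> (forall v, 0 <= G v) ->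
  word_measurable G ->
  wordint G (p ++ S :: q) = wordint G (S :: p ++ q).
Proof.
elim: p G => [//|S' p IH] G Gp G0 mG.
rewrite cat_cons wordint_cons.
under eq_integral.
  move=> z _; rewrite IH //.
  - over.
  - by move=> v v' vv'; apply: Gp; rewrite perm_cons.
  - by move=> w; exact: (pseq_measurable_section _ (word_measurable_cons S' mG w)).
rewrite [in RHS]wordint_cons.
pose k (p : Z * Z) := fun x => G ((S', p.1) :: (S, p.2) :: x).
have mk n w : measurable_fun [set: (Z * Z) * n.-tuple Z] (fun y => k y.1 (zip w y.2)).
  exact: (pseq_measurable_cons (seq_measurable_cons (mG (S' :: S :: w))) ) n.
pose k' pq := wordint (k pq) (p ++ q).
have mk' : measurable_fun setT k'.
  apply: (measurable_iterint _ _ (h := fun y s => k y (zip (p ++ q) s))).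
    by move=> y s; exact: G0.
  by move=> n; exact: mk.
rewrite (@fubini_tonelli _ _ _ _ R mu mu k' mk'); last first.
  by move=> x; apply: iterint_ge0 => s; exact: G0.
apply: eq_integral => y _; rewrite cat_cons wordint_cons.
apply: eq_integral => z _; congr wordint; apply/funext => v; apply: Gp.
by apply/seq.permP => a /=; rewrite addnCA.
Qed.

Lemma wordint_perm G w w' :
  (forall v v', perm_eq v v' -> G v = G v') -> (forall v, 0 <= G v) ->
  word_measurable G -> perm_eq w w' -> wordint G w = wordint G w'.
Proof.
elim: w w' G => [|S w IH] w' G Gp G0 mG ww'.
  by move: ww'; rewrite perm_sym => /perm_nilP ->.
have : S \in w' by rewrite -(perm_mem ww') mem_head.
move=> /splitPr w'E; case: w'E ww' => p q ww'.
rewrite wordint_front// !wordint_cons; apply: eq_integral => z _.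
apply: IH.
- by move=> v v' vv'; apply: Gp; rewrite perm_cons.
- by move=> v; exact: G0.
- by move=> u; exact: (pseq_measurable_section _ (word_measurable_cons S mG u)).
- by move: ww'; rewrite perm_sym -cat1s perm_catCA perm_cons perm_sym.
Qed.

Implicit Types (g : 'I_4 -> seq Z -> R) (F : seq Z -> R).

(** The four copies may carry different kernels, because mixed moments [E[h g^3]] are needed in the
    passage to the limit. *)
Definition wordprod g (v : seq (letter * Z)) : \bar R :=
  (\prod_(i < 4) g i (row_of i v))%:E.

Definition Jword g w := wordint (wordprod g) w.

Lemma wordprod_ge0 g v : (forall i s, 0 <= g i s)%R -> 0 <= wordprod g v.
Proof. by move=> g0; rewrite lee_fin; apply: prodr_ge0 => i _. Qed.

Lemma wordprod_measurable g : (forall i, seq_measurable (EFin \o g i)) ->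
  word_measurable (wordprod g).
Proof.
move=> mg w n; apply/measurable_EFinP.
apply: measurable_prod => i _.
apply/measurable_EFinP.
exact: (seq_measurable_row i w (mg i) (n := n)).
Qed.

Lemma Jword_ge0 g w : (forall i s, 0 <= g i s)%R -> 0 <= Jword g w.
Proof. by move=> g0; apply: iterint_ge0 => s; exact: wordprod_ge0. Qed.

Lemma Jword_perm g w w' : (forall i s, 0 <= g i s)%R ->
  (forall i, seq_measurable (EFin \o g i)) ->
  (forall i s s', perm_eq s s' -> g i s = g i s') ->
  perm_eq w w' -> Jword g w = Jword g w'.
Proof.
move=> g0 mg gp ww'; apply: wordint_perm => //.
- move=> v v' vv'; rewrite /wordprod; congr (_%:E).
  by apply: eq_bigr => i _; apply: gp; exact: perm_row_of.
- by move=> v; exact: wordprod_ge0.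
- exact: wordprod_measurable.
Qed.

(** This is what permits sums over all words, without a side condition on the lengths of the four
    rows. *)
Lemma Jword0 g q w i : (forall s, size s <> q -> g i s = 0%R) ->
  count (fun S : letter => i \in S) w != q -> Jword g w = 0.
Proof.
move=> g0 cq; rewrite /Jword /wordint.
rewrite (@eq_iterint _ _ _ mu _ _ (fun=> 0)); last first.
  move=> s ss; rewrite /wordprod (bigD1 i)//= g0 ?mul0r//.
  by rewrite size_row_of//; exact/eqP.
elim: (size w) => [//|n IH] /=.
by under eq_integral do rewrite IH; rewrite integral0.
Qed.

(** Copy [j] of the new word behaves like copy [phi j] of the old one. Permutations relabel the
    copies; non-injective [phi] duplicate a pair of copies. *)
Definition preletter (phi : 'I_4 -> 'I_4) (S : letter) : letter :=
  [set j | phi j \in S].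

Lemma row_of_preletter (T : Type) (phi : 'I_4 -> 'I_4) w (x : seq T) i :
  row_of i (zip (map (preletter phi) w) x) = row_of (phi i) (zip w x).
Proof.
elim: w x => [|S w IH] [|z x] //=.
by rewrite !row_of_cons inE IH.
Qed.

Lemma Jword_preletter F (sigma : {perm 'I_4}) w :
  Jword (fun=> F) (map (preletter sigma) w) = Jword (fun=> F) w.
Proof.
rewrite /Jword /wordint size_map; apply: eq_iterint => x _.
rewrite /wordprod; congr (_%:E).
rewrite [RHS](reindex_inj (@perm_inj _ sigma)) /=.
by apply: eq_bigr => i _; rewrite row_of_preletter.
Qed.

Definition thick_word (w : seq letter) : bool := all (fun S : letter => (2 <= #|S|)%N) w.

(* Grouping the partitions of the 4q arguments by the word of their blocks,
   listed in all N! orders, the product formula for [E[I_q(g_0)...I_q(g_3)]]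
   becomes this sum. *)
Definition fourth_moment_sum q g : \bar R :=
  (q`!%:R ^+ 4)%:E * \sum_(N < (2 * q).+1) (N`!%:R^-1)%:E *
    \sum_(w : N.-tuple letter | thick_word w) Jword g w.

End words.

(** * The fourth moment sum: decomposition and bounds *)

(** Cauchy-Schwarz is applied in this additive form, which needs no roots and remains valid for
    infinite values. *)
Lemma mul2e_le_sqr {R : realType} (a b : \bar R) : 0 <= a -> 0 <= b ->
  2%:E * (a * b) <= a * a + b * b.
Proof.
move: a b => [a| |] [b| |] // a0 b0.
- rewrite -!EFinM -EFinD lee_fin.
  have : (0 <= (a - b) ^+ 2)%R by exact: sqr_ge0.
  by rewrite sqrrB; nra.
- by rewrite [X in _ <= _ + X]mulyy addey ?leey// -ltNye -EFinM ltNyr.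
- by rewrite [X in _ <= X + _]mulyy addye ?leey// -ltNye -EFinM ltNyr.
- by rewrite !mulyy addye ?leey.
Qed.

Section row_words.
Context {R : realType} {d : measure_display} {Z : measurableType d}.
Variable mu : {sigma_finite_measure set Z -> \bar R}.

Definition o0 : 'I_4 := @Ordinal 4 0 isT.
Definition o1 : 'I_4 := @Ordinal 4 1 isT.
Definition o2 : 'I_4 := @Ordinal 4 2 isT.
Definition o3 : 'I_4 := @Ordinal 4 3 isT.

Lemma big4 (T : Type) (idx : T) (op : Monoid.law idx) (x : 'I_4 -> T) :
  \big[op/idx]_(i < 4) x i = op (op (op (x o0) (x o1)) (x o2)) (x o3).
Proof.
rewrite !big_ord_recr big_ord0 Monoid.mul1m /=.
by do !congr (op _ _); congr x; exact: val_inj.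
Qed.

Lemma ord4P (Q : 'I_4 -> Prop) : Q o0 -> Q o1 -> Q o2 -> Q o3 -> forall i, Q i.
Proof.
move=> Q0 Q1 Q2 Q3 [[|[|[|[|i]]]] // Hi].
- by rewrite (_ : Ordinal Hi = o0)//; exact: val_inj.
- by rewrite (_ : Ordinal Hi = o1)//; exact: val_inj.
- by rewrite (_ : Ordinal Hi = o2)//; exact: val_inj.
- by rewrite (_ : Ordinal Hi = o3)//; exact: val_inj.
Qed.

Lemma card_letter (S : letter) :
  #|S| = ((o0 \in S) + (o1 \in S) + (o2 \in S) + (o3 \in S))%N.
Proof. by rewrite -sum1_card big_mkcond big4; case: (o0 \in S); case: (o1 \in S); case: (o2 \in S); case: (o3 \in S). Qed.

Lemma letterP (S S' : letter) : (o0 \in S) = (o0 \in S') -> (o1 \in S) = (o1 \in S') ->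
  (o2 \in S) = (o2 \in S') -> (o3 \in S) = (o3 \in S') -> S = S'.
Proof. by move=> h0 h1 h2 h3; apply/setP; apply: ord4P. Qed.

Notation S01 := [set o0; o1]%SET.
Notation S23 := [set o2; o3]%SET.
Notation S02 := [set o0; o2]%SET.
Notation S13 := [set o1; o3]%SET.
Notation S03 := [set o0; o3]%SET.
Notation S12 := [set o1; o2]%SET.

Notation Sall := [set: 'I_4]%SET.

Variables (q : nat) (F : seq Z -> R).
Hypothesis F0 : forall s, (0 <= F s)%R.
Hypothesis mF : seq_measurable (EFin \o F).
Hypothesis FP : forall s s', perm_eq s s' -> F s = F s'.
Hypothesis Fq : forall s, size s <> q -> F s = 0%R.

Notation J := (Jword mu (fun=> F)).

(** With the variables [x] of [rest] frozen, the last [l] variables, which copies [i] and [j] share,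
    are integrated out: a contraction, with the integrated arguments in last position. *)
Definition half_int i j rest l S x :=
  iterint mu l (fun y =>
    (F (row_of i (zip (rest ++ nseq l S) (x ++ y))) *
     F (row_of j (zip (rest ++ nseq l S) (x ++ y))))%:E).

Lemma half_int_ge0 i j rest l S x : 0 <= half_int i j rest l S x.
Proof. by apply: iterint_ge0 => s; rewrite lee_fin mulr_ge0. Qed.

Lemma half_int_measurable i j rest l S : seq_measurable (half_int i j rest l S).
Proof.
apply: (seq_measurable_iterint_cat mu l (h := fun s =>
  (F (row_of i (zip (rest ++ nseq l S) s)) *
     F (row_of j (zip (rest ++ nseq l S) s)))%:E)).
  by move=> s; rewrite lee_fin mulr_ge0.
move=> n; apply/measurable_EFinP/measurable_funM; apply/measurable_EFinP.
  exact: (seq_measurable_row i _ mF).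
exact: (seq_measurable_row j _ mF).
Qed.

Lemma half_intE i j rest l (S : letter) x : size x = size rest -> i \in S -> j \in S ->
  half_int i j rest l S x =
  iterint mu l (fun y => (F (row_of i (zip rest x) ++ y) *
                          F (row_of j (zip rest x) ++ y))%:E).
Proof.
move=> sx iS jS; apply: eq_iterint => y sy.
by rewrite zip_cat// -sy !row_of_cat !row_of_nseq iS jS.
Qed.

(** The letter [S01] is read by copies 0 and 1 only and [S23] by copies 2 and 3 only, so once the
    variables of [rest] are fixed the integrand factorizes. *)
Lemma Jword_split rest l l' :
  J (rest ++ nseq l S01 ++ nseq l' S23) =
  iterint mu (size rest) (fun x => half_int o0 o1 rest l S01 x * half_int o2 o3 rest l' S23 x).
Proof.
rewrite /Jword /wordint !size_cat !size_nseq iterint_cat.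
apply: eq_iterint => x sx; rewrite iterint_cat.
rewrite !half_intE//; try by rewrite !inE.
set B := iterint mu l' _.
transitivity (iterint mu l (fun y => B * (F (row_of o0 (zip rest x) ++ y) *
     F (row_of o1 (zip rest x) ++ y))%:E)).
  apply: eq_iterint => y sy.
  rewrite muleC -iterintZl.
  - apply: eq_iterint => z sz; rewrite /wordprod -EFinM; congr (_%:E).
    rewrite big4 /= zip_cat// zip_cat; last by rewrite size_nseq.
    rewrite -sy -sz !row_of_cat !row_of_nseq !inE /= !cats0.
    by rewrite !mulrA.
  - by move=> s; rewrite lee_fin mulr_ge0.
  - move=> n; apply/measurable_EFinP/measurable_funM; apply/measurable_EFinP.
      exact: (pseq_measurable_section (in_tuple (row_of o2 (zip rest x))) (pseq_measurable_catr mF)).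
    exact: (pseq_measurable_section (in_tuple (row_of o3 (zip rest x))) (pseq_measurable_catr mF)).
  - by rewrite lee_fin mulr_ge0.
rewrite iterintZl; first by rewrite muleC.
- by move=> s; rewrite lee_fin mulr_ge0.
- move=> n; apply/measurable_EFinP/measurable_funM; apply/measurable_EFinP.
    exact: (pseq_measurable_section (in_tuple (row_of o0 (zip rest x))) (pseq_measurable_catr mF)).
  exact: (pseq_measurable_section (in_tuple (row_of o1 (zip rest x))) (pseq_measurable_catr mF)).
- by apply: iterint_ge0 => s; rewrite lee_fin mulr_ge0.
Qed.


(** The word of a squared half: copies 0 and 2 both act as the original copy 0, copies 1 and 3 as
    the original copy 1. [dblB] does the same with the original copies 2 and 3. *)
Definition dblA := preletter (fun j => if odd j then o1 else o0).
Definition dblB := preletter (fun j => if odd j then o3 else o2).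

(* The word of the squared norm of [F *_r^l F]: copies 0, 1 form the first
   contraction and copies 2, 3 the second one. *)
Definition canrest r l : seq letter :=
  nseq (r - l) Sall ++ nseq (q - r) S02 ++ nseq (q - r) S13.
Definition canword r l : seq letter := canrest r l ++ nseq l S01 ++ nseq l S23.

Lemma J_perm w w' : perm_eq w w' -> J w = J w'.
Proof. by move=> ww'; apply: Jword_perm. Qed.

Lemma perm_eq_count3 (T : eqType) (a b c : T) w : uniq [:: a; b; c] ->
  all (mem [:: a; b; c]) w ->
  perm_eq w (nseq (count_mem a w) a ++ nseq (count_mem b w) b ++ nseq (count_mem c w) c).
Proof.
rewrite /= !inE negb_or andbT => /andP[/andP[ab ac] bc] wP.
apply/seq.permP => p; rewrite !count_cat !count_nseq.
elim: w wP => [|x w IH] /=; first by rewrite !muln0.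
rewrite !inE => /andP[/or3P[] /eqP-> /IH ->].
- by rewrite !eqxx (negbTE ab) (negbTE ac); lia.
- by rewrite !eqxx (eq_sym b a) (negbTE ab) (negbTE bc); lia.
- by rewrite !eqxx (eq_sym c a) (eq_sym c b) (negbTE bc) (negbTE ac); lia.
Qed.

Lemma perm_eq_extract2 (T : eqType) (a b : T) w : a != b ->
  perm_eq w ([seq x <- w | (x != a) && (x != b)] ++ nseq (count_mem a w) a ++
             nseq (count_mem b w) b).
Proof.
move=> ab; apply/seq.permP => p; rewrite !count_cat !count_nseq.
elim: w => [|x w IH] /=; first by rewrite !muln0.
rewrite IH; have [->|xa] := eqVneq x a; first by rewrite (negbTE ab) /=; lia.
by have [->|xb] := eqVneq x b; rewrite /=; lia.
Qed.

(** Doubling turns a letter containing both [i] and [j] into the full letter, one containing only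
    [i] into [{0, 2}] and one containing only [j] into [{1, 3}]. The row lengths then fix how often
    each occurs. *)
Lemma canrest_perm (h : 'I_4 -> 'I_4) (i j : 'I_4) (w : seq letter) l :
  (forall S, S \in w -> (i \in S) || (j \in S)) ->
  h = (fun k => if odd k then j else i) ->
  (count (fun S : letter => (i \in S)) w + l)%N = q ->
  (count (fun S : letter => (j \in S)) w + l)%N = q ->
  perm_eq (map (preletter h) w)
    (canrest (count (fun S : letter => (i \in S) && (j \in S)) w + l) l).
Proof.
move=> wP hE ci cj; rewrite /canrest addnK.
have mem_pre (S : letter) :
  [/\ (o0 \in preletter h S) = (i \in S), (o1 \in preletter h S) = (j \in S),
   (o2 \in preletter h S) = (i \in S) & (o3 \in preletter h S) = (j \in S)].
  by rewrite !inE hE.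
have cntE (S0 : letter) (P : pred letter) :
    (forall S, S \in w -> (preletter h S == S0) = P S) ->
    count_mem S0 (map (preletter h) w) = count P w.
  by move=> H; rewrite count_map; apply: eq_in_count => S Sw /=; exact: H.
have c1 : count_mem Sall (map (preletter h) w) =
    count (fun S : letter => (i \in S) && (j \in S)) w.
  apply: cntE => S Sw; have [h0 h1 h2 h3] := mem_pre S.
  apply/eqP/andP => [E|[iS jS]]; first by rewrite -h0 -h1 E !inE.
  by apply: letterP; rewrite ?h0 ?h1 ?h2 ?h3 ?iS ?jS inE.
have c2 : count_mem S02 (map (preletter h) w) =
    count (fun S : letter => (i \in S) && (j \notin S)) w.
  apply: cntE => S Sw; have [h0 h1 h2 h3] := mem_pre S.
  apply/eqP/andP => [E|[iS /negbTE jS]]; first by rewrite -h0 -h1 E !inE.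
  by apply: letterP; rewrite ?h0 ?h1 ?h2 ?h3 ?iS ?jS !inE.
have c3 : count_mem S13 (map (preletter h) w) =
    count (fun S : letter => (i \notin S) && (j \in S)) w.
  apply: cntE => S Sw; have [h0 h1 h2 h3] := mem_pre S.
  apply/eqP/andP => [E|[/negbTE iS jS]]; first by rewrite -h0 -h1 E !inE.
  by apply: letterP; rewrite ?h0 ?h1 ?h2 ?h3 ?iS ?jS !inE.
have e1 : count (fun S : letter => i \in S) w =
  (count (fun S : letter => (i \in S) && (j \in S)) w +
   count (fun S : letter => (i \in S) && (j \notin S)) w)%N.
  by elim: (w) => //= S w' ->; case: (i \in S); case: (j \in S) => /=; lia.
have e2 : count (fun S : letter => j \in S) w =
  (count (fun S : letter => (i \in S) && (j \in S)) w +
   count (fun S : letter => (i \notin S) && (j \in S)) w)%N.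
  by elim: (w) => //= S w' ->; case: (i \in S); case: (j \in S) => /=; lia.
have n01 : (Sall : letter) != S02.
  by apply/eqP => /setP/(_ o1); rewrite !inE.
have n02 : (Sall : letter) != S13.
  by apply/eqP => /setP/(_ o0); rewrite !inE.
have n12 : S02 != S13.
  by apply/eqP => /setP/(_ o0); rewrite !inE.
apply: perm_trans (perm_eq_count3 (a := Sall) (b := S02) (c := S13) _ _) _.
- by rewrite /= !inE negb_or n01 n02 n12.
- apply/allP => _ /mapP[S Sw ->]; have [h0 h1 h2 h3] := mem_pre S.
  rewrite /= !inE; have := wP _ Sw.
  case iS: (i \in S); case jS: (j \in S) => //= _.
  + by apply/or3P/Or31/eqP/letterP; rewrite ?h0 ?h1 ?h2 ?h3 ?iS ?jS inE.
  + by apply/or3P/Or32/eqP/letterP; rewrite ?h0 ?h1 ?h2 ?h3 ?iS ?jS !inE.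
  + by apply/or3P/Or33/eqP/letterP; rewrite ?h0 ?h1 ?h2 ?h3 ?iS ?jS !inE.
rewrite c1 c2 c3.
set x1 := count (fun S : letter => (i \in S) && (j \in S)) w in e1 e2 *.
set x2 := count (fun S : letter => (i \in S) && (j \notin S)) w in e1 *.
set x3 := count (fun S : letter => (i \notin S) && (j \in S)) w in e2 *.
have -> : (q - (x1 + l) = x2)%N by lia.
by have -> : x3 = x2 by lia.
Qed.

Lemma Jword_dbl (h : 'I_4 -> 'I_4) rest l :
  h o2 = h o0 -> h o3 = h o1 ->
  J (map (preletter h) rest ++ nseq l S01 ++ nseq l S23) =
  iterint mu (size rest) (fun x =>
    half_int o0 o1 (map (preletter h) rest) l S01 x *
    half_int o0 o1 (map (preletter h) rest) l S01 x).
Proof.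
move=> h2 h3; rewrite Jword_split size_map; apply: eq_iterint => x sx.
congr (_ * _); rewrite !half_intE ?size_map// ?inE//.
by apply: eq_iterint => y sy; rewrite !row_of_preletter h2 h3.
Qed.

Lemma half_int_pre (h : 'I_4 -> 'I_4) i j (S : letter) rest l x : size x = size rest ->
  h o0 = i -> h o1 = j -> i \in S -> j \in S ->
  half_int o0 o1 (map (preletter h) rest) l S01 x = half_int i j rest l S x.
Proof.
move=> sx hi hj iS jS; rewrite !half_intE ?size_map// ?inE//.
by apply: eq_iterint => y sy; rewrite !row_of_preletter hi hj.
Qed.

(** With [A] and [B] the half integrals of copies 0, 1 and of copies 2, 3, the integrand is [A B],
    and [2 A B <= A^2 + B^2]. The integrals of [A^2] and [B^2] are again words, obtained by
    doubling, and these are canonical. *)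
Lemma J_split_bound (w : seq letter) (M : \bar R) :
  (forall S, S \in w -> (2 <= #|S|)%N) ->
  (forall i, count (fun S : letter => i \in S) w = q) ->
  J (canword (count (fun S : letter => (o0 \in S) && (o1 \in S)) w) (count_mem S01 w)) <= M ->
  J (canword (count (fun S : letter => (o2 \in S) && (o3 \in S)) w) (count_mem S23 w)) <= M ->
  J w <= M.
Proof.
move=> w2 wq JA JB.
have n0123 : S01 != S23 by apply/eqP => /setP/(_ o0); rewrite !inE.
set rest := [seq x <- w | (x != S01) && (x != S23)].
set l := count_mem S01 w; set l' := count_mem S23 w.
have wE : perm_eq w (rest ++ nseq l S01 ++ nseq l' S23) by exact: perm_eq_extract2.
(* A thick letter missing one of the pairs would be the other pair, and both pairs have been
   extracted. *)
have restP S : S \in rest -> [&& (o0 \in S) || (o1 \in S) & (o2 \in S) || (o3 \in S)].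
  rewrite mem_filter => /andP[/andP[S1 S2] /w2]; rewrite card_letter.
  case s0: (o0 \in S); case s1: (o1 \in S); case s2: (o2 \in S); case s3: (o3 \in S) => //= _.
    by move/eqP: S1; case; apply: letterP; rewrite ?s0 ?s1 ?s2 ?s3 !inE.
  by move/eqP: S2; case; apply: letterP; rewrite ?s0 ?s1 ?s2 ?s3 !inE.
have cw (P : pred letter) : count P w = (count P rest + (P S01 * l + P S23 * l'))%N.
  by rewrite (seq.permP wE) !count_cat !count_nseq.
have cA : perm_eq (map dblA rest ++ nseq l S01 ++ nseq l S23)
    (canword (count (fun S : letter => (o0 \in S) && (o1 \in S)) w) l).
  rewrite /canword perm_cat2r.
  have q0 := cw (fun S : letter => o0 \in S); have q1 := cw (fun S : letter => o1 \in S).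
  move: q0 q1; rewrite !wq !inE /= mul0n addn0 mul1n => q0 q1.
  rewrite cw !inE /= mul1n mul0n addn0.
  apply: canrest_perm => //; try by apply/esym.
  by move=> S /restP/andP[].
have cB : perm_eq (map dblB rest ++ nseq l' S01 ++ nseq l' S23)
    (canword (count (fun S : letter => (o2 \in S) && (o3 \in S)) w) l').
  rewrite /canword perm_cat2r.
  have q0 := cw (fun S : letter => o2 \in S); have q1 := cw (fun S : letter => o3 \in S).
  move: q0 q1; rewrite !wq !inE /= mul0n add0n mul1n => q0 q1.
  rewrite cw !inE /= mul1n mul0n add0n.
  apply: canrest_perm => //; try by apply/esym.
  by move=> S /restP/andP[].
rewrite -(J_perm cA) in JA; rewrite -(J_perm cB) in JB.
rewrite -(lee_pmul2l (x := 2%:E))//.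
have M2 : 2%:E * M = M + M.
  by rewrite -[2%R]/(1 + 1)%R EFinD ge0_muleDl// mul1e.
rewrite M2; apply: le_trans (leeD JA JB).
rewrite (J_perm wE) Jword_split -iterintZl//; last first.
- move=> n; apply: emeasurable_funM.
    exact: (half_int_measurable o0 o1 rest l S01 (n := n)).
  exact: (half_int_measurable o2 o3 rest l' S23 (n := n)).
- by move=> s; apply: mule_ge0; exact: half_int_ge0.
rewrite !Jword_dbl// -iterintD; last first.
- move=> n; apply: emeasurable_funM;
    exact: (half_int_measurable o0 o1 _ l' S01 (n := n)).
- by move=> s; apply: mule_ge0; exact: half_int_ge0.
- move=> n; apply: emeasurable_funM;
    exact: (half_int_measurable o0 o1 _ l S01 (n := n)).
- by move=> s; apply: mule_ge0; exact: half_int_ge0.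
rewrite [leRHS](@eq_iterint _ _ _ mu _ _ (fun x =>
  half_int o0 o1 rest l S01 x * half_int o0 o1 rest l S01 x +
  half_int o2 o3 rest l' S23 x * half_int o2 o3 rest l' S23 x)); last first.
  move=> x sx; congr (_ * _ + _ * _).
  all: try by apply: half_int_pre; rewrite ?inE.
have mh i j S k : seq_measurable (half_int i j rest k S) by exact: half_int_measurable.
apply: le_iterint.
- by move=> s; rewrite !mule_ge0// half_int_ge0.
- move=> n; apply: emeasurable_funM => //; apply: emeasurable_funM; exact: (mh _ _ _ _ n).
- by move=> n; apply: emeasurable_funD; apply: emeasurable_funM; exact: (mh _ _ _ _ n).
- by move=> s; apply: mul2e_le_sqr; exact: half_int_ge0.
Qed.

(** Only [l = 0] is new. Exchanging copies 1 and 2 expresses that [f *_r^0 f] and [f *_q^(q-r) f]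
    have the same norm, and [q - r] is an admissible [l] when [0 < r < q]; for [r = q] the word is
    the full one. *)
Lemma J_canword_bound (M : \bar R) r l :
  (forall r l, (1 <= l)%N -> (l <= r <= q)%N -> (l < q)%N -> J (canword r l) <= M) ->
  J (nseq q Sall) <= M -> (0 < r)%N -> (l <= r <= q)%N -> (l < q)%N ->
  J (canword r l) <= M.
Proof.
move=> HM Hq r0 lr lq; have [l1|] := ltnP 0 l; first exact: HM.
rewrite leqn0 => /eqP l0; rewrite {}l0 in lr lq *.
move: lr; rewrite leq0n /= leq_eqVlt => /predU1P[rq|rq].
  by rewrite rq /canword /canrest subnn subn0 /= !cats0.
have t0 : tperm o1 o2 o0 = o0 by rewrite tpermD.
have t3 : tperm o1 o2 o3 = o3 by rewrite tpermD.
have p1 : preletter (tperm o1 o2) Sall = Sall.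
  by apply/setP => i; rewrite !inE.
have p2 : preletter (tperm o1 o2) S01 = S02.
  by apply: letterP; rewrite !inE ?t0 ?t3 ?tpermL ?tpermR.
have p3 : preletter (tperm o1 o2) S23 = S13.
  by apply: letterP; rewrite !inE ?t0 ?t3 ?tpermL ?tpermR.
have -> : canword r 0 = map (preletter (tperm o1 o2)) (canword q (q - r)).
  rewrite /canword /canrest !map_cat !map_nseq p1 p2 p3.
  have n0 (T : Type) (x : T) : nseq 0 x = [::] by [].
  by rewrite subnn subn0 subKn ?(ltnW rq)// !n0 !cats0.
rewrite Jword_preletter.
by apply: HM; rewrite ?subn_gt0//; lia.
Qed.

Definition over (S S' : letter) := fun T : letter => (T == S) || (T == S').

(** The [q] occurrences of [S] already exhaust the rows of the copies in [S], so every other letter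
    avoids [S]. *)
Lemma all_over i j (S S' : letter) (w : seq letter) : i \in S -> j \in S -> count_mem S w = q ->
  (forall i, count (fun S : letter => i \in S) w = q) ->
  (forall T, T \in w -> i \notin T -> j \notin T -> T = S') ->
  all (over S S') w.
Proof.
move=> iS jS wS wq wS'; apply/allP => T Tw; rewrite /over.
have [//|TS /=] := eqVneq T S.
have cnt k : k \in S -> k \notin T.
  move=> kS; apply/negP => kT.
  have : (count_mem S w + count (fun U => (U != S) && (k \in U)) w =
          count (fun S : letter => k \in S) w)%N.
    elim: (w) => //= U u IH; have [->|US] /= := eqVneq U S; first by rewrite kS; lia.
    by rewrite -IH; lia.
  rewrite wS wq => /eqP; rewrite -[X in _ == X]addn0 eqn_add2l => /eqP c0.
  have : has (fun U => (U != S) && (k \in U)) w.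
    by apply/hasP; exists T => //=; rewrite TS kT.
  by rewrite has_count c0.
by apply/eqP/wS' => //; exact: cnt.
Qed.


(** Inclusion-exclusion for the trace of a letter on one pair of copies: a thick letter has an empty
    trace only if it is the opposite pair. *)
Lemma letter_bits (S : letter) : (2 <= #|S|)%N ->
  (((o0 \in S) + (o1 \in S) + (S == S23))%N = (1 + ((o0 \in S) && (o1 \in S)))%N) /\
  (((o2 \in S) + (o3 \in S) + (S == S01))%N = (1 + ((o2 \in S) && (o3 \in S)))%N).
Proof.
rewrite card_letter => S2.
have -> : (S == S23) = [&& o0 \notin S, o1 \notin S, o2 \in S & o3 \in S].
  apply/eqP/and4P => [->|[/negbTE h0 /negbTE h1 h2 h3]]; first by rewrite !inE.
  by apply: letterP; rewrite ?h0 ?h1 ?h2 ?h3 !inE.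
have -> : (S == S01) = [&& o0 \in S, o1 \in S, o2 \notin S & o3 \notin S].
  apply/eqP/and4P => [->|[h0 h1 /negbTE h2 /negbTE h3]]; first by rewrite !inE.
  by apply: letterP; rewrite ?h0 ?h1 ?h2 ?h3 !inE.
by move: S2; case: (o0 \in S); case: (o1 \in S); case: (o2 \in S); case: (o3 \in S).
Qed.

(** Write [r], [l] for the number of letters containing, respectively equal to, the pair [{0, 1}],
    and [r'], [l'] for those of [{2, 3}]. The two equations give [r + l = r' + l']: both
    contractions leave the same number of free variables. *)
Lemma count_pairs (w : seq letter) :
  (forall S, S \in w -> (2 <= #|S|)%N) ->
  (forall i, count (fun S : letter => i \in S) w = q) ->
  (q + q + count_mem S23 w =
     size w + count (fun S : letter => (o0 \in S) && (o1 \in S)) w)%N /\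
  (q + q + count_mem S01 w =
     size w + count (fun S : letter => (o2 \in S) && (o3 \in S)) w)%N.
Proof.
move=> w2 wq.
have : (count (fun S : letter => o0 \in S) w + count (fun S : letter => o1 \in S) w +
     count_mem S23 w = size w + count (fun S : letter => (o0 \in S) && (o1 \in S)) w)%N /\
  (count (fun S : letter => o2 \in S) w + count (fun S : letter => o3 \in S) w +
     count_mem S01 w = size w + count (fun S : letter => (o2 \in S) && (o3 \in S)) w)%N.
  clear -w2; elim: w w2 => //= S w IH w2.
  have /IH[IH1 IH2] : forall T, T \in w -> (2 <= #|T|)%N.
    by move=> T Tw; apply: w2; rewrite inE Tw orbT.
  have [e1 e2] := letter_bits (w2 S (mem_head _ _)).
  split; [move: e1 IH1|move: e2 IH2]; clear.
    by case: (o0 \in S); case: (o1 \in S); case: (S == S23) => /=; lia.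
  by case: (o2 \in S); case: (o3 \in S); case: (S == S01) => /=; lia.
by rewrite !wq.
Qed.

Lemma count_pairs0 (w : seq letter) :
  (forall S, S \in w -> (2 <= #|S|)%N) ->
  (forall i, count (fun S : letter => i \in S) w = q) ->
  count (fun S : letter => (o0 \in S) && (o1 \in S)) w = 0%N ->
  count (fun S : letter => (o2 \in S) && (o3 \in S)) w = 0%N.
Proof.
move=> w2 wq c0; have [] := count_pairs w2 wq; rewrite c0.
have : (count_mem S01 w <= count (fun S : letter => (o0 \in S) && (o1 \in S)) w)%N.
  by apply: sub_count => S /eqP->; rewrite !inE.
by rewrite c0; lia.
Qed.

(** By [r + l = r' + l'], with [l' <= r' <= q], the conditions [0 < r] and [l < q] pass to the half
    of copies 2 and 3, so both contractions are admissible. *)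
Lemma J_bound_split (M : \bar R) (w : seq letter) :
  (forall r l, (1 <= l)%N -> (l <= r <= q)%N -> (l < q)%N -> J (canword r l) <= M) ->
  J (nseq q Sall) <= M ->
  (forall S, S \in w -> (2 <= #|S|)%N) ->
  (forall i, count (fun S : letter => i \in S) w = q) ->
  (0 < count (fun S : letter => (o0 \in S) && (o1 \in S)) w)%N ->
  (count_mem S01 w < q)%N -> J w <= M.
Proof.
move=> HM Hq w2 wq r0 lq.
set r := count _ w in r0; set l := count_mem S01 w in lq.
pose r' := count (fun S : letter => (o2 \in S) && (o3 \in S)) w.
pose l' := count_mem S23 w.
have le_lr : (l <= r)%N by apply: sub_count => S /eqP->; rewrite !inE.
have le_lr' : (l' <= r')%N by apply: sub_count => S /eqP->; rewrite !inE.
have le_rq : (r <= q)%N by rewrite -(wq o0); apply: sub_count => S /andP[].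
have le_rq' : (r' <= q)%N by rewrite -(wq o2); apply: sub_count => S /andP[].
have [E1 E2] := count_pairs w2 wq.
rewrite -/l -/l' -/r -/r' in E1 E2.
apply: J_split_bound => //.
  by apply: J_canword_bound => //; rewrite -/r -/l; lia.
by apply: J_canword_bound => //; rewrite -/r' -/l'; lia.
Qed.

(** Splitting the copies as 01|23 fails only if the word is the corresponding pairing or if no
    letter joins 0 and 1. In the latter case 02|13 is tried; if this fails in the same way, the word
    is forced to be the third pairing. *)
Lemma J_bound (M : \bar R) (w : seq letter) :
  (forall r l, (1 <= l)%N -> (l <= r <= q)%N -> (l < q)%N -> J (canword r l) <= M) ->
  J (nseq q Sall) <= M -> 0 <= M ->
  (forall S, S \in w -> (2 <= #|S|)%N) ->
  [|| all (over S01 S23) w, all (over S02 S13) w | all (over S03 S12) w] \/ J w <= M.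
Proof.
move=> HM Hq M0 w2.
have [/forallP wq|/forallPn[i wi]] := boolP [forall i, count (fun S : letter => i \in S) w == q]; last first.
  by right; rewrite (Jword0 _ (q := q) (i := i)).
have {}wq i : count (fun S : letter => i \in S) w = q by exact/eqP.
have cle (S : letter) i : i \in S -> (count_mem S w <= q)%N.
  by move=> iS; rewrite -(wq i); apply: sub_count => T /eqP->.
have [lq|lq] := ltnP (count_mem S01 w) q; last first.
  left; apply/orP; left; apply: (@all_over o0 o1); rewrite ?inE//.
    by apply/eqP; rewrite eqn_leq lq (cle _ o0)// !inE.
  move=> T Tw /negbTE h0 /negbTE h1; have := w2 T Tw; rewrite card_letter h0 h1.
  by case h2: (o2 \in T); case h3: (o3 \in T) => // _; apply: letterP; rewrite ?h0 ?h1 ?h2 ?h3 !inE.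
have [r0|r0] := posnP (count (fun S : letter => (o0 \in S) && (o1 \in S)) w); last first.
  by right; exact: J_bound_split.
pose t := tperm o1 o2.
have t0 : t o0 = o0 by rewrite /t tpermD.
have t3 : t o3 = o3 by rewrite /t tpermD.
have t1 : t o1 = o2 by rewrite /t tpermL.
have t2 : t o2 = o1 by rewrite /t tpermR.
have tE (S : letter) : (preletter t S == S01) = (S == S02).
  apply/eqP/eqP => [E|->].
    have b i : (i \in preletter t S) = (i \in S01) by rewrite E.
    have := b o0; have := b o1; have := b o2; have := b o3.
    by rewrite !inE t0 t1 t2 t3 => h3 h1 h2 h0; apply: letterP; rewrite ?h0 ?h1 ?h2 ?h3 !inE.
  by apply: letterP; rewrite !inE ?t0 ?t1 ?t2 ?t3.
have [l2q|l2q] := ltnP (count_mem S02 w) q; last first.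
  left; apply/orP; right; apply/orP; left; apply: (@all_over o0 o2); rewrite ?inE//.
    by apply/eqP; rewrite eqn_leq l2q (cle _ o0)// !inE.
  move=> T Tw /negbTE h0 /negbTE h1; have := w2 T Tw; rewrite card_letter h0 h1.
  by case h2: (o1 \in T); case h3: (o3 \in T) => // _; apply: letterP; rewrite ?h0 ?h1 ?h2 ?h3 !inE.
have tw2 (S : letter) : S \in map (preletter t) w -> (2 <= #|S|)%N.
  move=> /mapP[T Tw ->]; rewrite card_letter !inE t0 t1 t2 t3.
  have := w2 T Tw; rewrite card_letter.
  by case: (o0 \in T); case: (o1 \in T); case: (o2 \in T); case: (o3 \in T).
have twq (i : 'I_4) : count (fun S : letter => i \in S) (map (preletter t) w) = q.
  by rewrite count_map -(wq (t i)); apply: eq_count => S; rewrite /= inE.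
have [r20|r20] := posnP (count (fun S : letter => (o0 \in S) && (o2 \in S)) w); last first.
  right; rewrite -(Jword_preletter mu F t); apply: J_bound_split => //.
  - rewrite count_map (@eq_count _ _ (fun S : letter => (o0 \in S) && (o2 \in S)))//.
    by move=> S /=; rewrite !inE t0 t1.
  - by rewrite count_map (@eq_count _ _ (pred1 S02)).
have r0' := count_pairs0 w2 wq r0.
have r20' : count (fun S : letter => (o1 \in S) && (o3 \in S)) w = 0%N.
  transitivity (count (fun S : letter => (o2 \in S) && (o3 \in S)) (map (preletter t) w)).
    by rewrite count_map; apply: eq_count => S; rewrite /= !inE t2 t3.
  apply: count_pairs0 => //; rewrite -[RHS]r20 count_map.
  by apply: eq_count => S; rewrite /= !inE t0 t1.
(* No letter joins 0-1, 2-3, 0-2 or 1-3, so a thick letter can only be [{0, 3}] or [{1, 2}]. *)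
left; apply/orP; right; apply/orP; right; apply/allP => S Sw.
have no (P : pred letter) : count P w = 0%N -> ~~ P S.
  by move=> c0; apply/negP => h; have : has P w; [apply/hasP; exists S|rewrite has_count c0].
move: (no _ r0) (no _ r0') (no _ r20) (no _ r20') (w2 S Sw); rewrite card_letter /over.
case h0: (o0 \in S); case h1: (o1 \in S); case h2: (o2 \in S); case h3: (o3 \in S) => // _ _ _ _ _.
  by apply/orP; left; apply/eqP/letterP; rewrite ?h0 ?h1 ?h2 ?h3 !inE.
by apply/orP; right; apply/eqP/letterP; rewrite ?h0 ?h1 ?h2 ?h3 !inE.
Qed.

Lemma ge0_natmulE (c : \bar R) (n : nat) : 0 <= c -> (c *+ n)%R = n%:R%:E * c.
Proof.
move=> c0; elim: n => [|n IH]; first by rewrite mulr0n mul0e.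
by rewrite mulrS IH -[n.+1%:R]nat1r EFinD ge0_muleDl// mul1e.
Qed.

(** A word over two letters is the set of positions of the first one. *)
Lemma card_over_tuples (S S' : letter) n : S != S' ->
  #|[set w : (2 * n).-tuple letter | all (over S S') w && (count_mem S w == n)]%SET| = 'C(2 * n, n).
Proof.
move=> SS'; rewrite -[in RHS](card_ord (2 * n)) -card_draws.
pose f (A : {set 'I_(2 * n)}) := [tuple if i \in A then S else S' | i < 2 * n].
have f_inj : injective f.
  move=> A B /(congr1 (fun t : (2 * n).-tuple letter => tnth t)) fAB.
  apply/setP => i; have := congr1 (fun g => g i) fAB; rewrite !tnth_mktuple.
  case: (i \in A); case: (i \in B) => // /eqP; first by rewrite (negbTE SS').
  by rewrite eq_sym (negbTE SS').
have cf A : count_mem S (f A) = #|A|.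
  rewrite count_map -sum1_count big_enum_cond -sum1_card; apply: eq_bigl => i /=.
  by case: (i \in A); rewrite ?eqxx // eq_sym (negbTE SS').
rewrite -(card_imset _ f_inj); apply: eq_card => w; rewrite !inE.
apply/andP/imsetP => [[/allP wo wc]|[A]]; last first.
  rewrite inE => /eqP An ->; rewrite cf An eqxx; split => //.
  by apply/allP => T /mapP[i _ ->]; rewrite /over; case: ifP; rewrite eqxx ?orbT.
have wf : w = f [set i | tnth w i == S]%SET.
  apply: eq_from_tnth => i; rewrite tnth_mktuple inE.
  have /wo : tnth w i \in w by exact: mem_tnth.
  by rewrite /over; case: eqP => [->//|_ /= /eqP].
by exists [set i | tnth w i == S]%SET => //; rewrite inE -cf -wf.
Qed.

(** Copy [i] counts the letters [S] and copy [k] the letters [S']; both rows must have length [q],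
    which forces [N = 2 q] and [q] letters of each kind. *)
Lemma sum_over_words i k (S S' : letter) N :
  i \in S -> i \notin S' -> k \notin S -> k \in S' ->
  \sum_(w : N.-tuple letter | all (over S S') w) J w =
  if N == (2 * q)%N then ('C(2 * q, q))%:R%:E * J (nseq q S ++ nseq q S') else 0.
Proof.
move=> iS iS' kS kS'.
have SS' : S != S' by apply: contraNneq iS' => <-.
have cnt (w : seq letter) : all (over S S') w ->
    count (fun S : letter => i \in S) w = count_mem S w /\
    count (fun S : letter => k \in S) w = (size w - count_mem S w)%N /\ (count_mem S w <= size w)%N.
  elim: w => //= T w IH /andP[/orP[]/eqP-> /IH[h1 [h2 h3]]].
    by rewrite iS (negbTE kS) eqxx h1 h2; lia.
  by rewrite (negbTE iS') kS' (eq_sym S') (negbTE SS') h1 h2; lia.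
have J0 (w : seq letter) : all (over S S') w -> (count_mem S w != q) || (size w != 2 * q)%N -> J w = 0.
  move=> /cnt[h1 [h2 h3]] h.
  have [cq|cq] := eqVneq (count_mem S w) q; last by rewrite (@Jword0 _ _ _ _ _ q _ i) ?h1.
  by rewrite (@Jword0 _ _ _ _ _ q _ k)// h2; move: h; rewrite cq eqxx /=; move: h3; lia.
case: ifP => [/eqP ->|Nq]; last first.
  by rewrite big1// => w wo; rewrite J0// size_tuple Nq orbT.
rewrite (bigID (fun w : (2 * q).-tuple letter => count_mem S w == q))/= [X in _ + X]big1 ?adde0; last first.
  by move=> w /andP[wo wc]; rewrite J0// wc.
rewrite (eq_bigr (fun=> J (nseq q S ++ nseq q S'))); last first.
  move=> w /andP[wo /eqP wc]; apply: J_perm.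
  apply: (perm_trans (perm_eq_extract2 w SS')).
  rewrite wc (_ : [seq x <- w | (x != S) && (x != S')] = [::]); last first.
    apply/eqP; rewrite -size_eq0 size_filter -leqn0 leqNgt -has_count; apply/hasPn => T Tw.
    by move: (allP wo _ Tw); rewrite /over -negb_or negbK.
  have -> : count_mem S' w = q => //.
  have : (count_mem S w + count_mem S' w = size w)%N.
    elim: (tval w) wo => //= T u IH /andP[/orP[]/eqP-> /IH].
      by rewrite eqxx (negbTE SS'); lia.
    by rewrite eqxx (eq_sym S') (negbTE SS'); lia.
  by rewrite wc size_tuple; lia.
rewrite sumr_const ge0_natmulE ?Jword_ge0// -(card_over_tuples q SS'); congr (_%:R%:E * _).
by apply: eq_card => w; rewrite !inE.
Qed.

Definition square_int : \bar R := iterint mu q (fun s => (F s * F s)%:E).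

Lemma J_pairing : J (nseq q S01 ++ nseq q S23) = square_int * square_int.
Proof.
rewrite (Jword_split [::] q q) /= !half_intE ?inE//.
Qed.

Lemma J_pairing02 : J (nseq q S02 ++ nseq q S13) = square_int * square_int.
Proof.
have t0 : tperm o1 o2 o0 = o0 by rewrite tpermD.
have t3 : tperm o1 o2 o3 = o3 by rewrite tpermD.
rewrite -J_pairing -[RHS](Jword_preletter mu F (tperm o1 o2)) map_cat !map_nseq.
have -> : preletter (tperm o1 o2) S01 = S02.
  by apply: letterP; rewrite !inE ?t0 ?t3 ?tpermL ?tpermR.
by have -> : preletter (tperm o1 o2) S23 = S13;
  first by apply: letterP; rewrite !inE ?t0 ?t3 ?tpermL ?tpermR.
Qed.

Lemma J_pairing03 : J (nseq q S03 ++ nseq q S12) = square_int * square_int.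
Proof.
have t0 : tperm o1 o3 o0 = o0 by rewrite tpermD.
have t2 : tperm o1 o3 o2 = o2 by rewrite tpermD.
rewrite -J_pairing -[RHS](Jword_preletter mu F (tperm o1 o3)) map_cat !map_nseq.
have -> : preletter (tperm o1 o3) S01 = S03.
  by apply: letterP; rewrite !inE ?t0 ?t2 ?tpermL ?tpermR.
by have -> : preletter (tperm o1 o3) S23 = S12;
  first by apply: letterP; rewrite !inE ?t0 ?t2 ?tpermL ?tpermR.
Qed.

Definition paired (w : seq letter) :=
  [|| all (over S01 S23) w, all (over S02 S13) w | all (over S03 S12) w].

(** For the symmetric representative of the kernel of [F] this is the fourth cumulant [E[F^4] - 3
    sigma^4]. *)
Definition excess : \bar R :=
  (q`!%:R ^+ 4)%:E * \sum_(N < (2 * q).+1) (N`!%:R^-1)%:E *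
    \sum_(w : N.-tuple letter | thick_word w && ~~ paired w) J w.

Lemma J_ge0 w : 0 <= J w.
Proof. by apply: Jword_ge0. Qed.

Lemma excess_ge0 : 0 <= excess.
Proof.
apply: mule_ge0; first by rewrite lee_fin exprn_ge0.
apply: sume_ge0 => N _; apply: mule_ge0; first by rewrite lee_fin invr_ge0.
by apply: sume_ge0 => w _; exact: J_ge0.
Qed.

(** The weight [1/(2q)!] cancels against the number of words: [q!^4 'C(2q, q) / (2q)! = q!^2]. Each
    of the three pairings thus contributes [(q! ||f||^2)^2 = sigma^4]. *)
Lemma sum_pairings i k (S S' : letter) :
  i \in S -> i \notin S' -> k \notin S -> k \in S' ->
  J (nseq q S ++ nseq q S') = square_int * square_int ->
  (q`!%:R ^+ 4)%:E * \sum_(N < (2 * q).+1) (N`!%:R^-1)%:E *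
    \sum_(w : N.-tuple letter | all (over S S') w) J w =
  (q`!%:R ^+ 2)%:E * (square_int * square_int).
Proof.
move=> iS iS' kS kS' JE.
have h N : \sum_(w : N.-tuple letter | all (over S S') w) J w =
  if N == (2 * q)%N then ('C(2 * q, q))%:R%:E * (square_int * square_int) else 0.
  by rewrite -JE; exact: (sum_over_words N iS iS' kS kS').
under eq_bigr do rewrite h.
rewrite big_ord_recr /= eqxx big1 ?add0e; last first.
  by move=> N _; rewrite ltn_eqF ?mule0.
rewrite !muleA -!EFinM; congr (_%:E * _ * _).
have f0 n : (n`!%:R != 0 :> R)%R by rewrite pnatr_eq0 -lt0n fact_gt0.
have /(congr1 (fun n => n%:R : R)) : ('C(2 * q, q) * (q`! * (2 * q - q)`!) = (2 * q)`!)%N.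
  by apply: bin_fact; lia.
rewrite (_ : (2 * q - q = q)%N); last by lia.
rewrite !natrM => <-.
have c0 : ('C(2 * q, q)%:R != 0 :> R)%R by rewrite pnatr_eq0 -lt0n bin_gt0; lia.
by field; rewrite c0 f0.
Qed.

Lemma fourth_moment_decomposition : (0 < q)%N ->
  fourth_moment_sum mu q (fun=> F) =
  (3 * q`!%:R ^+ 2)%:E * (square_int * square_int) + excess.
Proof.
move=> q0.
have A1 := sum_pairings (i := o0) (k := o2) (S := S01) (S' := S23) _ _ _ _ J_pairing.
have A2 := sum_pairings (i := o0) (k := o1) (S := S02) (S' := S13) _ _ _ _ J_pairing02.
have A3 := sum_pairings (i := o0) (k := o1) (S := S03) (S' := S12) _ _ _ _ J_pairing03.
have sq0 : 0 <= square_int by apply: iterint_ge0 => s; rewrite lee_fin mulr_ge0.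
have sqsq0 : 0 <= square_int * square_int by exact: mule_ge0.
have -> : (3 * q`!%:R ^+ 2)%:E * (square_int * square_int) =
    (q`!%:R ^+ 2)%:E * (square_int * square_int) + ((q`!%:R ^+ 2)%:E * (square_int * square_int)
    + (q`!%:R ^+ 2)%:E * (square_int * square_int)).
  have c0 : 0 <= (q`!%:R ^+ 2 : R)%:E by rewrite lee_fin exprn_ge0.
  rewrite (_ : 3 * _ = q`!%:R ^+ 2 + (q`!%:R ^+ 2 + q`!%:R ^+ 2))%R; last by ring.
  by rewrite EFinD ge0_muleDl ?adde_ge0// EFinD ge0_muleDl.
rewrite -{1}A1 ?inE// -{1}A2 ?inE// -A3 ?inE// /excess /fourth_moment_sum.
have sge0 N (Q : pred (N.-tuple letter)) : 0 <= \sum_(w | Q w) J w.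
  by apply: sume_ge0 => w _; exact: J_ge0.
have Nge0 (N : nat) : 0 <= (N`!%:R^-1 : R)%:E by rewrite lee_fin invr_ge0.
have ssge0 (Q : forall N, pred (N.-tuple letter)) : 0 <= \sum_(N < (2 * q).+1) (N`!%:R^-1)%:E *
    \sum_(w : N.-tuple letter | Q N w) J w.
  by apply: sume_ge0 => N _; exact: mule_ge0.
have mD (x y : \bar R) : 0 <= x -> 0 <= y ->
    (q`!%:R ^+ 4)%:E * x + (q`!%:R ^+ 4)%:E * y = (q`!%:R ^+ 4)%:E * (x + y).
  by move=> x0 y0; rewrite ge0_muleDr.
rewrite mD; [|exact: (ssge0 (fun N w => all (over S02 S13) w))|exact: (ssge0 (fun N w => all (over S03 S12) w))].
rewrite -big_split /=.
rewrite mD; [|exact: (ssge0 (fun N w => all (over S01 S23) w))|]; last first.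
  by apply: sume_ge0 => N _; apply: adde_ge0; (apply: mule_ge0; [exact: Nge0|exact: sge0]).
rewrite -big_split /=.
rewrite mD; [| |exact: (ssge0 (fun N w => thick_word w && ~~ paired w))]; last first.
  by apply: sume_ge0 => N _; do ?apply: adde_ge0; (apply: mule_ge0; [exact: Nge0|exact: sge0]).
rewrite -big_split /=; congr (_ * _); apply: eq_bigr => N _.
have mND (x y : \bar R) : 0 <= x -> 0 <= y ->
    (N`!%:R^-1)%:E * x + (N`!%:R^-1)%:E * y = (N`!%:R^-1)%:E * (x + y).
  by move=> x0 y0; rewrite ge0_muleDr.
rewrite mND; [|exact: sge0|exact: sge0].
rewrite mND; [|exact: sge0|by apply: adde_ge0; exact: sge0].
rewrite mND; [|by do ?apply: adde_ge0; exact: sge0|exact: sge0].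
have mk (Q : pred (N.-tuple letter)) :
  (\sum_(w | Q w) J w = \sum_w if Q w then J w else 0)%R by exact: big_mkcond.
congr (_ * _); rewrite (mk (fun w => thick_word w)) (mk (fun w => all (over S01 S23) w)).
rewrite (mk (fun w => all (over S02 S13) w)) (mk (fun w => all (over S03 S12) w)).
rewrite (mk (fun w => thick_word w && ~~ paired w)) -!big_split /=.
apply: eq_bigr => w _.
(* The empty word belongs to all three pairings at once; its integral vanishes because [0 < q]. On
   nonempty words the first letter separates the pairings. *)
case: (posnP N) => [N0|Npos].
  have -> : J w = 0.
    rewrite (@Jword0 _ _ _ _ _ q _ o0)// (_ : tval w = [::]) /=; first by rewrite eq_sym -lt0n.
    by apply: size0nil; rewrite size_tuple.
  by rewrite !if_same !adde0.
case wE : (tval w) => [|T u].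
  by move: Npos; rewrite -(size_tuple w) wE.
rewrite -wE /paired.
have c2 (x y : 'I_4) : x != y -> #|[set x; y]%SET| = 2%N by move=> xy; rewrite cards2 xy.
have thk (S S' : letter) : #|S| = 2%N -> #|S'| = 2%N -> all (over S S') w -> thick_word w.
  by move=> S2 S'2; apply: sub_all => U /orP[]/eqP->; rewrite ?S2 ?S'2.
have t1 := thk S01 S23 (c2 o0 o1 isT) (c2 o2 o3 isT).
have t2 := thk S02 S13 (c2 o0 o2 isT) (c2 o1 o3 isT).
have t3 := thk S03 S12 (c2 o0 o3 isT) (c2 o1 o2 isT).
have ne (S S' : letter) (i : 'I_4) : (i \in S) != (i \in S') -> (S == S') = false.
  by move=> h; apply/negbTE; apply: contraNneq h => ->.
have hd (S S' : letter) : all (over S S') w -> T = S \/ T = S'.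
  by rewrite wE /= => /andP[/orP[]/eqP-> _]; [left|right].
have d12 : all (over S01 S23) w -> all (over S02 S13) w = false.
  move=> h; apply/negP => /hd[] TE; move: (hd _ _ h) => []; rewrite TE => /eqP.
  - by rewrite (ne _ _ o1)// !inE.
  - by rewrite (ne _ _ o0)// !inE.
  - by rewrite (ne _ _ o0)// !inE.
  - by rewrite (ne _ _ o1)// !inE.
have d13 : all (over S01 S23) w -> all (over S03 S12) w = false.
  move=> h; apply/negP => /hd[] TE; move: (hd _ _ h) => []; rewrite TE => /eqP.
  - by rewrite (ne _ _ o1)// !inE.
  - by rewrite (ne _ _ o0)// !inE.
  - by rewrite (ne _ _ o0)// !inE.
  - by rewrite (ne _ _ o1)// !inE.
have d23 : all (over S02 S13) w -> all (over S03 S12) w = false.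
  move=> h; apply/negP => /hd[] TE; move: (hd _ _ h) => []; rewrite TE => /eqP.
  - by rewrite (ne _ _ o2)// !inE.
  - by rewrite (ne _ _ o0)// !inE.
  - by rewrite (ne _ _ o0)// !inE.
  - by rewrite (ne _ _ o2)// !inE.
have [h1|h1] := boolP (all (over S01 S23) w).
  by rewrite d12// d13// (t1 h1) /= !adde0.
have [h2|h2] := boolP (all (over S02 S13) w).
  by rewrite d23// (t2 h2) /= add0e !adde0.
have [h3|h3] := boolP (all (over S03 S12) w).
  by rewrite (t3 h3) /= !add0e adde0.
by rewrite !add0e andbT.
Qed.

(** A crude bound for the total weight of the words in [excess]: every word of length at most [2 q]
    is counted. *)
Definition word_count : R := (q`!%:R ^+ 4 * \sum_(N < (2 * q).+1) N`!%:R^-1 * #|{: N.-tuple letter}|%:R)%R.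

Lemma excess_le (M : \bar R) :
  (forall r l, (1 <= l)%N -> (l <= r <= q)%N -> (l < q)%N -> J (canword r l) <= M) ->
  J (nseq q Sall) <= M -> 0 <= M -> excess <= word_count%:E * M.
Proof.
move=> HM Hq M0; rewrite /excess /word_count [X in _ <= X * _]EFinM -[leRHS]muleA lee_wpmul2l//.
rewrite -sumEFin ge0_sume_distrl; last first.
  by move=> N _; rewrite lee_fin mulr_ge0// invr_ge0.
apply: lee_sum => N _; rewrite [X in _ <= X * _]EFinM -[leRHS]muleA lee_wpmul2l// ?lee_fin ?invr_ge0//.
apply: (@le_trans _ _ (\sum_(w : N.-tuple letter | thick_word w && ~~ paired w) M)).
  apply: lee_sum => w /andP[/allP w2 nw].
  by have [] := @J_bound M w HM Hq M0 w2 => //; rewrite -/(paired w) (negbTE nw).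
rewrite sumr_const ge0_natmulE// lee_wpmul2r// lee_fin ler_nat.
exact: max_card.
Qed.

(** All terms being nonnegative, a single one may be kept; [1/(2q)!] is the smallest weight that
    occurs. *)
Lemma le_excess (w : seq letter) : thick_word w -> ~~ paired w -> (size w <= 2 * q)%N ->
  (q`!%:R ^+ 4 / (2 * q)`!%:R)%:E * J w <= excess.
Proof.
move=> w2 nw sw; rewrite [X in X * _ <= _]EFinM -[leLHS]muleA lee_wpmul2l ?lee_fin ?exprn_ge0//.
have sw' : (size w < (2 * q).+1)%N by [].
rewrite (bigD1 (Ordinal sw'))//= -[leLHS]adde0; apply: leeD; last first.
  apply: sume_ge0 => N _; apply: mule_ge0; first by rewrite lee_fin invr_ge0.
  by apply: sume_ge0 => u _; exact: J_ge0.
apply: (@le_trans _ _ ((size w)`!%:R^-1%:E * J w)).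
  apply: lee_wpmul2r; first exact: J_ge0.
  by rewrite lee_fin lef_pV2 ?posrE ?ltr0n ?fact_gt0// ler_nat leq_fact.
apply: lee_wpmul2l; first by rewrite lee_fin invr_ge0.
rewrite (bigD1 (in_tuple w))/=; last by rewrite w2 nw.
by rewrite leeDl//; apply: sume_ge0 => u _; exact: J_ge0.
Qed.

Lemma neq_letter (S S' : letter) (i : 'I_4) : (i \in S) != (i \in S') -> (S == S') = false.
Proof. by move=> h; apply/negbTE; apply: contraNneq h => ->. Qed.

Lemma canword_le_excess r l : (1 <= l)%N -> (l <= r <= q)%N -> (l < q)%N ->
  (q`!%:R ^+ 4 / (2 * q)`!%:R)%:E * J (canword r l) <= excess.
Proof.
move=> l1 /andP[lr rq] lq; apply: le_excess; last first.
- by rewrite /canword /canrest !size_cat !size_nseq; lia.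
- have m01 : S01 \in canword r l.
    by rewrite /canword !mem_cat !mem_nseq l1 eqxx !orbT.
  (* As [l < q], either [l < r] or [r < q]: besides [S01] the word contains a letter that excludes
     the pairing 01|23. *)
  have mx : (Sall \in canword r l) || (S02 \in canword r l).
    have [h|h] : (0 < r - l)%N \/ (0 < q - r)%N by lia.
      by rewrite /canword /canrest !mem_cat !mem_nseq h eqxx.
    by apply/orP; right; rewrite /canword /canrest !mem_cat !mem_nseq h eqxx !orbT.
  apply/negP => /or3P[] /allP h.
  + move: mx => /orP[/h|/h]; rewrite /over.
      by rewrite (neq_letter (i := o2)) ?inE// (neq_letter (i := o0)) ?inE.
    by rewrite (neq_letter (i := o2)) ?inE// (neq_letter (i := o0)) ?inE.
  + move: (h _ m01); rewrite /over.
    by rewrite (neq_letter (i := o1)) ?inE// (neq_letter (i := o0)) ?inE.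
  + move: (h _ m01); rewrite /over.
    by rewrite (neq_letter (i := o1)) ?inE// (neq_letter (i := o0)) ?inE.
- rewrite /thick_word /canword /canrest !all_cat !all_nseq !card_letter !inE /=.
  by rewrite !orbT.
Qed.

Lemma full_le_excess : (0 < q)%N ->
  (q`!%:R ^+ 4 / (2 * q)`!%:R)%:E * J (nseq q Sall) <= excess.
Proof.
move=> q0; apply: le_excess; last by rewrite size_nseq; lia.
- by rewrite /thick_word all_nseq card_letter !inE orbT.
- rewrite /paired !all_nseq (gtn_eqF q0) /= /over.
  rewrite !(neq_letter (S := Sall) (S' := S01) (i := o2)) ?inE//.
  rewrite !(neq_letter (S := Sall) (S' := S23) (i := o0)) ?inE//.
  rewrite !(neq_letter (S := Sall) (S' := S02) (i := o1)) ?inE//.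
  rewrite !(neq_letter (S := Sall) (S' := S13) (i := o0)) ?inE//.
  rewrite !(neq_letter (S := Sall) (S' := S03) (i := o1)) ?inE//.
  by rewrite !(neq_letter (S := Sall) (S' := S12) (i := o0)) ?inE.
Qed.

End row_words.

(** * Contractions as half words *)

Section ereal_powers.
Context {R : realType}.

Lemma ge0_poweR_nat (x : \bar R) n : 0 <= x -> (0 < n)%N -> x `^ n%:R = x ^+ n.
Proof.
move: x => [r| |]// r0 n0.
  by rewrite poweR_EFin powR_mulrn// EFin_expe.
rewrite poweRyr ?pnatr_eq0 -?lt0n//.
by case: n n0 => // n _; elim: n => [|n IH]; rewrite expeS ?expe0 ?mule1// -IH mulyy.
Qed.

Context {d : measure_display} {T : measurableType d}.
Variable m : {measure set T -> \bar R}.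

Lemma Lnorm2E (h : T -> \bar R) : 'N[m]_2%:E[h] = sqrte (\int[m]_x (`|h x| * `|h x|)).
Proof.
rewrite Lnorm.unlock poweR12_sqrt; last by apply: integral_ge0 => x _; exact: poweR_ge0.
congr sqrte; apply: eq_integral => x _.
by rewrite (ge0_poweR_nat (n := 2)).
Qed.

Lemma Lnorm4_sqr (f : T -> R) :
  'N[m]_4%:E[EFin \o f] ^+ 2 = sqrte (\int[m]_x (f x ^+ 4)%:E).
Proof.
rewrite Lnorm.unlock.
have -> : \int[m]_x (`|(EFin \o f) x| `^ 4) = \int[m]_x (f x ^+ 4)%:E.
  apply: eq_integral => x _; have -> : `|(EFin \o f) x| = (`|f x|%R)%:E by [].
  rewrite (ge0_poweR_nat (n := 4))// -EFin_expe.
  by rewrite -normrX ger0_norm// exprn_even_ge0.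
have : 0 <= \int[m]_x (f x ^+ 4)%:E.
  by apply: integral_ge0 => x _; rewrite lee_fin exprn_even_ge0.
move: (\int[m]_x _) => [r| |]// r0.
  rewrite poweR_EFin -EFin_expe /=; congr (_%:E).
  apply/eqP; rewrite -(@eqrXn2 _ 2)// ?sqrtr_ge0// ?exprn_ge0 ?powR_ge0//.
  rewrite sqr_sqrtr// -exprM -powR_mulrn ?powR_ge0// -powRrM mulVf// powRr1//.
by rewrite poweRyr ?invr_eq0// /= expe2 mulyy.
Qed.

End ereal_powers.

Section contraction_link.
Context {R : realType} {d : measure_display} {Z : measurableType d}.
Variable mu : {sigma_finite_measure set Z -> \bar R}.

Notation S01 := [set o0; o1]%SET.
Notation S23 := [set o2; o3]%SET.
Notation S02 := [set o0; o2]%SET.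
Notation S13 := [set o1; o3]%SET.
Notation Sall := [set: 'I_4]%SET.

Lemma iterint0 n : iterint mu n (fun=> 0) = 0.
Proof. by elim: n => //= n IH; under eq_integral do rewrite IH; rewrite integral0. Qed.

Lemma row_of_split (T : Type) i (w : seq letter) (x y : seq T) :
  size y = count (fun S : letter => i \in S) w ->
  size x = count (fun S : letter => i \notin S) w ->
  row_of i (zip (seq.filter (fun S : letter => i \notin S) w) x ++ zip (seq.filter (fun S : letter => i \in S) w) y) = y.
Proof.
move=> sy sx; rewrite row_of_cat.
have -> : row_of i (zip (seq.filter (fun S : letter => i \notin S) w) x) = [::].
  apply/nilP; rewrite /nilp size_row_of ?size_filter// count_filter.
  by rewrite (@eq_count _ _ pred0) ?count_pred0// => S /=; rewrite andbN.
have : size y = size (seq.filter (fun S : letter => i \in S) w) by rewrite size_filter.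
have : all (fun S : letter => i \in S) (seq.filter (fun S : letter => i \in S) w) by exact: seq.filter_all.
elim: (seq.filter (fun S : letter => i \in S) w) (y) => [|S u IH] [|z t] //= /andP[iS iu] [st].
by rewrite row_of_cons iS; have /= -> := IH t iu st.
Qed.

(** Letters seen by copy [i] are integrated innermost, so that row [i] is exactly the inner
    variable: a property of a kernel of [q] variables can then be used inside a word by Tonelli. *)
Lemma wordint_split (G : seq (letter * Z) -> \bar R) i w :
  (forall v v', perm_eq v v' -> G v = G v') -> (forall v, 0 <= G v) -> word_measurable G ->
  wordint mu G w = iterint mu (count (fun S : letter => i \notin S) w) (fun x =>
    iterint mu (count (fun S : letter => i \in S) w) (fun y =>
      G (zip (seq.filter (fun S : letter => i \notin S) w) x ++ zip (seq.filter (fun S : letter => i \in S) w) y))).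
Proof.
move=> GP G0 mG.
have wE : perm_eq w ((seq.filter (fun S : letter => i \notin S) w) ++ (seq.filter (fun S : letter => i \in S) w)).
  rewrite perm_sym (_ : (seq.filter (fun S : letter => i \in S) w) = seq.filter (fun S : letter => ~~ (i \notin S)) w).
    exact/permPl/perm_filterC.
  by apply: eq_filter => S; rewrite negbK.
rewrite (wordint_perm mu _ _ _ wE)// /wordint size_cat iterint_cat !size_filter.
apply: eq_iterint => x sx; apply: eq_iterint => y sy.
by rewrite zip_cat// size_filter.
Qed.

(** A null set stays null when pulled back along a row, since a row is a projection onto part of the
    variables. *)
Lemma wordint_row0 (D : seq Z -> \bar R) q i w :
  (forall s, 0 <= D s) -> seq_measurable D ->
  (forall s s', perm_eq s s' -> D s = D s') -> iterint mu q D = 0 ->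
  count (fun S : letter => i \in S) w = q ->
  wordint mu (fun v => D (row_of i v)) w = 0.
Proof.
move=> D0 mD Dp Dq wq; rewrite (wordint_split i)//; last 2 first.
- by move=> v v' vv'; apply: Dp; exact: perm_row_of.
- by move=> u; exact: seq_measurable_row.
rewrite (@eq_iterint _ _ _ mu _ _ (fun=> 0)) ?iterint0// => x sx.
rewrite -Dq -wq; apply: eq_iterint => y sy; congr D; exact: row_of_split.
Qed.

Variables (q : nat) (f : q.-tuple Z -> R) (F D : seq Z -> R).
Hypothesis mf : measurable_fun setT f.
Hypothesis F0 : forall s, (0 <= F s)%R.
Hypothesis mF : seq_measurable (EFin \o F).
Hypothesis FP : forall s s', perm_eq s s' -> F s = F s'.
Hypothesis D0 : forall s, (0 <= D s)%R.
Hypothesis mD : seq_measurable (EFin \o D).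
Hypothesis DP : forall s s', perm_eq s s' -> D s = D s'.
Hypothesis Dnull : iterint mu q (EFin \o D) = 0.
Hypothesis fF : forall x : q.-tuple Z, D x = 0%R -> f x = F x.

Lemma eval_seq_measurable (g : q.-tuple Z -> R) : measurable_fun setT g ->
  seq_measurable (EFin \o eval_seq g).
Proof.
move=> mg n; apply/measurable_EFinP; have [nq|nq] := eqVneq n q.
  subst n; rewrite (_ : (fun _ => _) = g)//.
  by apply/funext => x; rewrite /= eval_seq_tuple.
rewrite (_ : (fun _ => _) = cst 0%R)//.
apply/funext => x /=; rewrite /eval_seq insubN//.
by rewrite size_tuple.
Qed.

Lemma eval_seq_eq s : size s = q -> D s = 0%R -> eval_seq f s = F s.
Proof.
move=> sq Ds; pose t : q.-tuple Z := tcast sq (in_tuple s).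
have tE : tval t = s by rewrite val_tcast.
by rewrite -tE eval_seq_tuple fF// tE.
Qed.

Section fixed_indices.
Variables (r l : nat).
Hypothesis lr : (l <= r)%N.
Hypothesis rq : (r <= q)%N.

Let n := (q + q - r - l)%N.
Let w : seq letter := nseq l S01 ++ canrest q r l.

Lemma size_canrest : size (canrest q r l) = n.
Proof. by rewrite /canrest !size_cat !size_nseq /n; lia. Qed.

(** Dictionary with the layout of [star_contraction]: even copies read [(gamma, t)], odd copies read
    [(gamma, s)]. *)
Lemma row_canrest (T : Type) (x : seq T) i : size x = n ->
  row_of i (zip (canrest q r l) x) =
  if odd i then take (r - l) x ++ drop (q - l) x else take (q - l) x.
Proof.
move=> sx.
have xE : x = take (r - l) x ++ take (q - r) (drop (r - l) x) ++ drop (q - l) x.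
  rewrite -{1}(cat_take_drop (r - l) x) -{1}(cat_take_drop (q - r) (drop (r - l) x)).
  by rewrite drop_drop (_ : q - r + (r - l) = q - l)%N//; lia.
have s1 : size (take (r - l) x) = (r - l)%N by rewrite size_takel// sx /n; lia.
have s2 : size (take (q - r) (drop (r - l) x)) = (q - r)%N.
  by rewrite size_takel// size_drop sx /n; lia.
have s3 : size (drop (q - l) x) = (q - r)%N by rewrite size_drop sx /n; lia.
have tE : take (q - l) x = take (r - l) x ++ take (q - r) (drop (r - l) x).
  by rewrite -takeD; congr take; lia.
rewrite tE; have -> : canrest q r l = nseq (size (take (r - l) x)) Sall ++
    nseq (size (take (q - r) (drop (r - l) x))) S02 ++ nseq (size (drop (q - l) x)) S13.
  by rewrite s1 s2 s3.
rewrite {4}xE; move: (take (r - l) x) (take (q - r) _) (drop (q - l) x) => x1 x2 x3.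
rewrite zip_cat ?size_nseq// zip_cat ?size_nseq// !row_of_cat !row_of_nseq.
by move: i; apply: ord4P; rewrite !inE /= ?cats0.
Qed.

Lemma row_w (T : Type) (z x : seq T) (i : 'I_4) : size z = l -> size x = n -> (i < 2)%N ->
  row_of i (zip w (z ++ x)) =
  z ++ (if odd i then take (r - l) x ++ drop (q - l) x else take (q - l) x).
Proof.
move=> sz sx i2; rewrite /w zip_cat ?size_nseq// row_of_cat row_canrest// -{1}sz row_of_nseq.
by move: i i2; apply: ord4P; rewrite ?inE.
Qed.

Let h (s : seq Z) : R := (eval_seq f (row_of o0 (zip w s)) * eval_seq f (row_of o1 (zip w s)))%R.

Lemma star_contractionE (x : n.-tuple Z) :
  star_contraction mu f f r l x = \int[tuple_measure mu l]_z (h (z ++ x))%:E.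
Proof.
rewrite /star_contraction; apply: eq_integral => z _; rewrite /h EFinM.
by rewrite !row_w ?size_tuple// -EFinM.
Qed.

Let mh : seq_measurable (EFin \o h).
Proof.
move=> k; apply/measurable_EFinP; apply: measurable_funM; apply/measurable_EFinP.
  exact: (seq_measurable_row o0 w (eval_seq_measurable mf)).
exact: (seq_measurable_row o1 w (eval_seq_measurable mf)).
Qed.

(** The integrand may be negative on a null set, so Tonelli is applied to its positive and negative
    parts separately. *)
Lemma measurable_star : measurable_fun setT (star_contraction mu f f r l).
Proof.
have mp := pseq_measurable_catr (k := l) mh (n := n).
rewrite (_ : star_contraction _ _ _ _ _ = (fun x : n.-tuple Z =>
   (fubini_G (tuple_measure mu l) ((fun p : l.-tuple Z * n.-tuple Z => (h (p.1 ++ p.2))%:E)^\+)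
    \- fubini_G (tuple_measure mu l) ((fun p : l.-tuple Z * n.-tuple Z => (h (p.1 ++ p.2))%:E)^\-)) x)); last first.
  by apply/funext => x; rewrite star_contractionE integralE; congr (_ - _);
    apply: eq_integral => z _; rewrite ?funeposE ?funenegE.
apply: emeasurable_funB.
  by apply: measurable_fun_fubini_tonelli_G; [exact: measurable_funepos|move=> p; exact: funepos_ge0].
by apply: measurable_fun_fubini_tonelli_G; [exact: measurable_funeneg|move=> p; exact: funeneg_ge0].
Qed.

(** The exceptional set of [f = F] is carried by a function [D >= 0] of integral zero, which can be
    evaluated on rows. The sum [G] over both rows has integral zero, so for almost every [x] it
    vanishes for almost every [z], and there both factors agree. *)
Let star_ae : {ae tuple_measure mu n, forall x, star_contraction mu f f r l x =
   half_int mu F o0 o1 (canrest q r l) l S01 (tval x)}.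
Proof.
pose G s := ((D (row_of o0 (zip (canrest q r l ++ nseq l S01) s)))%:E +
             (D (row_of o1 (zip (canrest q r l ++ nseq l S01) s)))%:E).
have mrow i w' : seq_measurable (fun s => (D (row_of i (zip w' s)))%:E).
  exact: (seq_measurable_row i w' mD).
have mG : seq_measurable G by move=> k; apply: emeasurable_funD; exact: mrow.
have G0 s : 0 <= G s by rewrite /G adde_ge0 ?lee_fin.
have rowcount (i : 'I_4) : (i < 2)%N -> count (fun S : letter => i \in S) (canrest q r l ++ nseq l S01) = q.
  rewrite /canrest !count_cat !count_nseq; move: i; apply: ord4P => //=; rewrite !inE /= => _; lia.
have Gnull : iterint mu (n + l) G = 0.
  have wnull (i : 'I_4) : (i < 2)%N ->
    wordint mu (fun v => (D (row_of i v))%:E) (canrest q r l ++ nseq l S01) = 0.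
    move=> i2; apply: (wordint_row0 (D := EFin \o D) (q := q)) => //.
    - by move=> s s' ss'; rewrite /= (DP ss').
    - exact: rowcount.
  have := wnull o0 isT; have := wnull o1 isT; rewrite /wordint size_cat size_nseq size_canrest => h1 h0.
  by rewrite iterintD ?h0 ?h1 ?adde0//; move=> s; rewrite lee_fin.
have inner : {ae tuple_measure mu n, forall x, iterint mu l (fun z => G (tval x ++ z)) = 0}.
  have mI : seq_measurable (fun x => iterint mu l (fun z => G (x ++ z))) by exact: seq_measurable_iterint_cat.
  have I0 s : 0 <= iterint mu l (fun z => G (s ++ z)) by apply: iterint_ge0.
  have := Gnull; rewrite iterint_cat -integral_tuple_measure// => int0.
  have : \int[tuple_measure mu n]_x `|iterint mu l (fun z => G (tval x ++ z))| = 0.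
    by rewrite -[RHS]int0; apply: eq_integral => x _; rewrite gee0_abs.
  move=> /(ae_eq_integral_abs _ measurableT (mI n)).
  by apply: filterS => x /(_ Logic.I).
apply: filterS inner => x.
have mGx : seq_measurable (fun z => G (tval x ++ z)).
  exact: (pseq_measurable_section x (pseq_measurable_catr mG)).
rewrite -integral_tuple_measure// => int0.
have : \int[tuple_measure mu l]_z `|G (tval x ++ tval z)| = 0.
  by rewrite -[RHS]int0; apply: eq_integral => z _; rewrite gee0_abs.
move=> /(ae_eq_integral_abs _ measurableT (mGx l)) Gz.
rewrite star_contractionE half_intE ?size_tuple ?size_canrest ?inE//.
set X0 := row_of o0 _ in Gz *; set X1 := row_of o1 _ in Gz *.
have mFF : seq_measurable (fun y => (F (X0 ++ y) * F (X1 ++ y))%:E).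
  move=> k; apply/measurable_EFinP; apply: measurable_funM; apply/measurable_EFinP.
    exact: (pseq_measurable_section (in_tuple X0) (pseq_measurable_catr mF)).
  exact: (pseq_measurable_section (in_tuple X1) (pseq_measurable_catr mF)).
rewrite -integral_tuple_measure//; last by move=> s; rewrite lee_fin mulr_ge0.
apply: ae_eq_integral => //.
- have m2 : measurable_fun [set: l.-tuple Z] (fun z => (z, x)).
    exact: measurable_fun_pair.
  exact: (measurableT_comp (pseq_measurable_catr mh (n := n)) m2).
- exact: (mFF l).
apply: filterS Gz => z /(_ Logic.I) /= Gz _; congr (_%:E).
have sx : size x = n by rewrite size_tuple.
have sz : size z = l by rewrite size_tuple.
have rowE (i : 'I_4) : (i < 2)%N ->
    row_of i (zip (canrest q r l ++ nseq l S01) (x ++ z)) = row_of i (zip (canrest q r l) x) ++ z.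
  move=> i2; rewrite zip_cat ?size_canrest// row_of_cat.
  have -> : row_of i (zip (nseq l S01) z) = if i \in S01 then tval z else [::].
    by have := row_of_nseq i S01 (tval z); rewrite sz.
  by move: i i2; apply: ord4P; rewrite ?inE.
move: Gz; rewrite /G !rowE// -EFinD => -[] /eqP.
rewrite paddr_eq0// => /andP[/eqP h0 /eqP h1].
rewrite /h !row_w//.
have r0 := row_canrest o0 sx; have r1 := row_canrest o1 sx.
rewrite -r0 -r1 in h0 h1 *; rewrite -/X0 -/X1 in h0 h1 *.
have s0 : size (z ++ X0) = q.
  by rewrite /X0 r0 size_cat /= size_takel ?sx ?size_tuple /n; lia.
have s1 : size (z ++ X1) = q.
  by rewrite /X1 r1 /= !size_cat size_takel ?size_drop ?sx ?size_tuple /n; lia.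
(* The contraction puts the integrated variables first and [half_int] puts them last; the symmetry
   of [F] and [D] reconciles the two. *)
have pc (X : seq Z) : perm_eq (X ++ tval z) (tval z ++ X) by rewrite perm_catC.
have e0 : D (tval z ++ X0) = 0%R by rewrite -(DP (pc X0)).
have e1 : D (tval z ++ X1) = 0%R by rewrite -(DP (pc X1)).
by rewrite (eval_seq_eq s0 e0) (eval_seq_eq s1 e1) (FP (pc X0)) (FP (pc X1)).
Unshelve. by move: lr rq; clear; lia.
Qed.

Lemma L2_norm_star :
  L2_norm mu (star_contraction mu f f r l) = sqrte (Jword mu (fun=> F) (canword q r l)).
Proof.
rewrite /L2_norm Lnorm2E; congr sqrte.
set hf := half_int mu F o0 o1 (canrest q r l) l S01.
have mhf : seq_measurable hf by exact: half_int_measurable.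
transitivity (\int[tuple_measure mu n]_x (hf (tval x) * hf (tval x))).
  apply: ae_eq_integral => //.
  - by apply: emeasurable_funM; apply: measurableT_comp => //; exact: measurable_star.
  - by apply: emeasurable_funM; exact: (mhf n).
  apply: filterS star_ae => x xE _; rewrite xE gee0_abs//.
  exact: half_int_ge0.
rewrite (@integral_tuple_measure _ _ _ mu n (fun s => hf s * hf s)); last 2 first.
- by move=> s; rewrite mule_ge0// half_int_ge0.
- by move=> k; apply: emeasurable_funM; exact: (mhf k).
rewrite /canword Jword_split//.
rewrite size_canrest; apply: eq_iterint => s ss; congr (_ * _).
rewrite /hf !half_intE ?size_canrest ?inE//.
by apply: eq_iterint => y _; rewrite !row_canrest.
Qed.

End fixed_indices.
End contraction_link.

(** * Poisson counts: moments and joint independence *)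

Section fine_partition.
Context {R : realType} {d : measure_display} {Z : measurableType d}.
Variable mu : {sigma_finite_measure set Z -> \bar R}.
Hypothesis Zborel : borel_space R Z.
Hypothesis mu_atomless : atomless mu.

(** A part of positive measure of a one-point set is the whole set and cannot have smaller
    measure. *)
Lemma atomless_subsingleton A : measurable A -> is_subset1 A -> mu A = 0.
Proof.
move=> mA A1; apply/eqP; rewrite eq_le measure_ge0 andbT leNgt; apply/negP => A0.
have [B [mB BA B0 BltA]] := mu_atomless mA A0.
have [z Bz] : B !=set0.
  by apply/set0P/eqP => B00; move: B0; rewrite B00 measure0 ltxx.
suff AB : A `<=` B.
  by move: BltA; rewrite (_ : B = A) ?ltxx//; exact/seteqP.
by move=> y Ay; rewrite (A1 y z)//; exact: BA.
Qed.

(** Through the embedding into [[0, 1]], points are null, so by continuity from above each [t] has a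
    ball whose trace on [B] has measure at most [eps]. Compactness leaves finitely many balls, which
    are then made disjoint. *)
Lemma fine_partition (B : set Z) (eps : R) : measurable B -> mu B < +oo ->
  (0 < eps)%R -> exists n (D : nat -> set Z),
  [/\ forall j, measurable (D j), trivIset setT D,
      forall j, (n <= j)%N -> D j = set0, \bigcup_j D j = B &
      forall j, mu (D j) <= eps%:E].
Proof.
move=> mB Boo eps0; have [phi [mphi phi_inj phi01 _]] := Zborel.
have mpre (U : set R) : measurable U -> measurable (B `&` phi @^-1` U).
  by move=> mU; apply: measurableI => //; rewrite -[X in measurable X]setTI; exact: mphi.
have small (t : R) : exists r : R, (0 < r)%R /\ mu (B `&` phi @^-1` ball t r) <= eps%:E.
  pose E n := B `&` phi @^-1` ball t n.+1%:R^-1%R.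
  have mE n : measurable (E n) by apply: mpre; exact: measurable_ball.
  have capE : \bigcap_n E n = B `&` phi @^-1` [set t].
    apply/seteqP; split=> z /=; last first.
      by move=> [Bz zt] n _; split => //=; rewrite zt; exact: ballxx.
    move=> Ez; split; first by have [] := Ez 0%N I.
    apply/eqP; rewrite -subr_eq0 -normr_le0; apply/ler_addgt0Pl => e e0.
    rewrite addr0; have [n ne] : exists n, (n.+1%:R^-1 < e)%R.
      by have [n] := ltr_add_invr (y := 0%R) (x := e) e0; rewrite add0r; exists n.
    have [_] := Ez n I; rewrite -ball_normE /= distrC => /ltW /le_trans -> //.
    exact: ltW.
  have cap0 : mu (\bigcap_n E n) = 0.
    apply: atomless_subsingleton.
      by rewrite capE; apply: mpre.
    by rewrite capE => x y [_ /= xt] [_ /= yt]; apply: phi_inj; rewrite ?inE// xt.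
  have : (mu \o E) x @[x --> \oo] --> 0.
    rewrite -cap0; apply: nonincreasing_cvg_mu => //.
    - by apply: le_lt_trans Boo; apply: le_measure; rewrite ?inE// => x [].
    - exact: bigcap_measurable.
    - move=> n m nm; apply/subsetPset => z [Bz Ez]; split => //.
      apply: le_ball Ez; rewrite lef_pV2 ?posrE//.
      by rewrite ler_nat.
  move=> /fine_cvgP[fE].
  move=> /cvgr0Pnorm_lt/(_ eps eps0) [n _ nE].
  case: fE => m _ mE'.
  exists (maxn n m).+1%:R^-1%R; split => //.
  have := nE (maxn n m) (leq_maxl _ _) => /= /ltW /(le_trans (ler_norm _)) h.
  by rewrite -[leLHS]fineK ?lee_fin//; exact: (mE' (maxn n m) (leq_maxr _ _)).
pose r t := projT1 (cid (small t)).
have r0 t : (0 < r t)%R by rewrite /r; case: cid => ? [].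
have rmu t : mu (B `&` phi @^-1` ball t (r t)) <= eps%:E by rewrite /r; case: cid => ? [].
have := @segment_compact R 0%R 1%R; rewrite compact_cover => /(_ R setT (fun t => ball t (r t))).
case.
- by move=> t _; exact: ball_open.
- by move=> t _; exists t => //; exact: ballxx.
move=> D' _ cover.
pose s := finmap.enum_fset D'.
pose C k := if (k < size s)%N then B `&` phi @^-1` ball (nth 0%R s k) (r (nth 0%R s k)) else set0.
have mC k : measurable (C k).
  by rewrite /C; case: ifP => // _; apply: mpre; exact: measurable_ball.
have CB : \bigcup_k C k = B.
  apply/seteqP; split => z.
    by move=> [k _]; rewrite /C; case: ifP => // _ [].
  move=> Bz; have [t /= tD tz] := cover (phi z) (phi01 _ (imageT phi z)).
  have ts : t \in s by [].
  exists (index t s) => //; rewrite /C index_mem ts; split => //=.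
  by rewrite nth_index.
exists (size s), (seqDU C); split.
- exact: seqDU_measurable.
- exact: trivIset_seqDU.
- by move=> j js; rewrite /seqDU /C ltnNge js set0D.
- by rewrite -seqDU_bigcup_eq.
- move=> j; have [js|js] := ltnP j (size s).
    apply: le_trans (rmu (nth 0%R s j)); apply: le_measure; rewrite ?inE//.
    - exact: seqDU_measurable.
    - by apply: mpre; exact: measurable_ball.
    by move=> z []; rewrite /C js.
  by rewrite /seqDU /C ltnNge js set0D measure0 lee_fin ltW.
Qed.

End fine_partition.

Section poisson_moments.
Context {R : realType}.

Lemma exprD_le (a b : R) k : (0 <= a)%R -> (0 <= b)%R ->
  ((a + b) ^+ k <= 2 ^+ k * (a ^+ k + b ^+ k))%R.
Proof.
move=> a0 b0; apply: (@le_trans _ _ ((2 * Num.max a b) ^+ k)%R).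
  rewrite lerXn2r ?nnegrE// ?addr_ge0// ?mulr_ge0 ?le_max ?a0//.
  by rewrite mulr_natl mulr2n lerD// le_max lexx ?orbT.
rewrite exprMn ler_wpM2l ?exprn_ge0//.
by case: (leP a) => _; rewrite ?lerDl ?lerDr exprn_ge0.
Qed.

Lemma integral_on_nat (m : {measure set nat -> \bar R}) (h : nat -> \bar R) :
  (forall k, 0 <= h k) ->
  \int[m]_k h k = \sum_(0 <= k <oo) h k * m [set k].
Proof.
move=> h0.
have -> : [set: nat] = \bigcup_k [set k] by apply/seteqP; split => // x _; exists x.
rewrite ge0_integral_bigcup//; last by apply/trivIsetP => i j _ _ ij;
  apply/seteqP; split => // x [/= -> /eqP]; rewrite (negbTE ij).
apply: eq_eseriesr => k _.
rewrite (eq_integral (cst (h k))); last by move=> x; rewrite inE => /= ->.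
by rewrite integral_cst.
Qed.

(** The Poisson weights; since [0 ^+ 0 = 1], the rate zero gives the unit mass at zero. *)
Definition ppmf (lam : R) k : R := (lam ^+ k * k`!%:R^-1 * expR (- lam))%R.

Lemma ppmf_ge0 lam k : (0 <= lam)%R -> (0 <= ppmf lam k)%R.
Proof. by move=> l0; rewrite /ppmf !mulr_ge0// ?exprn_ge0// expR_ge0. Qed.

Lemma poisson_prob_set1 lam k : (0 <= lam)%R ->
  poisson_prob lam 0 [set k] = (ppmf lam k)%:E.
Proof.
rewrite le_eqVlt => /predU1P[<-|l0]; rewrite /poisson_prob.
  rewrite ltxx diracE /ppmf oppr0 expR0 mulr1.
  case: k => [|k]; first by rewrite mem_set// expr0 fact0 invr1 mulr1.
  by rewrite memNset// expr0n mul0r.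
by rewrite l0 esum_set1 ?lee_fin ?poisson_pmf_ge0// /poisson_pmf l0.
Qed.

Lemma ppmfS lam k : (k.+1%:R * ppmf lam k.+1 = lam * ppmf lam k)%R.
Proof.
rewrite /ppmf exprS factS natrM invfM.
have k0 : (k.+1%:R * k.+1%:R^-1 = 1 :> R)%R by rewrite mulfV.
transitivity ((k.+1%:R * k.+1%:R^-1) *
  (lam * (lam ^+ k * k`!%:R^-1 * expR (- lam))) : R)%R; first by ring.
by rewrite k0 mul1r.
Qed.

(** The Chen-Stein identity: [k p_k = lam p_(k-1)] shifts the index by one. *)
Lemma poisson_series_stein lam (h : nat -> \bar R) : (0 <= lam)%R ->
  (forall k, 0 <= h k) ->
  \sum_(0 <= k <oo) (k%:R%:E * h k) * (ppmf lam k)%:E =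
  lam%:E * \sum_(0 <= k <oo) h k.+1 * (ppmf lam k)%:E.
Proof.
move=> l0 h0; rewrite nneseries_recl//; last first.
  by move=> k _; rewrite !mule_ge0// lee_fin ?ppmf_ge0.
rewrite mul0e mul0e add0e -nneseriesZl; last first.
  by move=> k _; rewrite mule_ge0// lee_fin ppmf_ge0.
rewrite -(nneseries_addn 1); last first.
  by move=> k; rewrite !mule_ge0// lee_fin ?ppmf_ge0.
apply: eq_eseriesr => k _; rewrite addn1.
rewrite (muleC k.+1%:R%:E) -muleA -EFinM ppmfS EFinM.
by rewrite muleCA.
Qed.

Context {d d' : measure_display} {Z : measurableType d} {Omega : measurableType d'}.
Variables (P : probability Omega R) (mu : {sigma_finite_measure set Z -> \bar R})
  (eta : R.-ker Omega ~> Z).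
Hypothesis Peta : is_poisson_measure P mu eta.

Definition count_in (B : set Z) (w : Omega) : R := fine (eta w B).

Lemma count_in_ge0 B w : (0 <= count_in B w)%R.
Proof. exact: fine_ge0. Qed.

Lemma measurable_count_in B : measurable B -> measurable_fun setT (count_in B).
Proof.
move=> mB; apply: measurableT_comp; first exact: fine_measurable.
exact: measurable_kernel.
Qed.

Lemma integral_count_in B (h : \bar R -> \bar R) : measurable B -> mu B < +oo ->
  measurable_fun setT h -> (forall x, 0 <= h x) ->
  \int[P]_w h (eta w B) =
  \sum_(0 <= k <oo) h k%:R%:E * (ppmf (fine (mu B)) k)%:E.
Proof.
move=> mB Boo mh h0.
have mX : measurable_fun setT (fun w => eta w B) by exact: measurable_kernel.
pose lam := fine (mu B).
pose phi := fun n : nat => (n%:R%:E : \bar R).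
have mphi : measurable_fun setT phi by [].
transitivity (\int[poisson_prob lam 0]_n h (phi n)).
  rewrite -[LHS](_ : \int[P]_(x in (fun w => eta w B) @^-1` setT)
      (h \o (fun w => eta w B)) x = _); last by rewrite preimage_setT.
  rewrite -(ge0_integral_pushforward mX P measurableT mh)//.
  rewrite -[RHS](_ : \int[poisson_prob lam 0]_(x in phi @^-1` setT)
      (h \o phi) x = _); last by rewrite preimage_setT.
  rewrite -(ge0_integral_pushforward mphi _ measurableT mh)//.
  apply: eq_measure_integral => A mA _.
  by rewrite /= /pushforward (Peta.1 B mB Boo A mA).
rewrite integral_on_nat//; apply: eq_eseriesr => k _; congr (_ * _).
exact: (poisson_prob_set1 k (fine_ge0 (measure_ge0 mu B))).
Qed.

(** Both the finiteness of the moments of a count and the recursion for its centered moments come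
    from this identity. *)
Lemma stein B (h : R -> \bar R) : measurable B -> mu B < +oo ->
  measurable_fun setT h -> (forall x, 0 <= h x) ->
  \int[P]_w ((count_in B w)%:E * h (count_in B w)) =
  mu B * \int[P]_w h (count_in B w + 1)%R.
Proof.
move=> mB Boo mh h0.
have mf : measurable_fun [set: \bar R] (@fine R) by exact: fine_measurable.
(* The absolute value makes the integrand nonnegative on the whole of [\bar R], as the transfer to
   the Poisson law requires. *)
transitivity (\int[P]_w (fun x => (`|fine x|)%:E * h (fine x)) (eta w B)).
  by apply: eq_integral => w _; rewrite ger0_norm//; exact: count_in_ge0.
rewrite (integral_count_in (h := fun x => (`|fine x|)%:E * h (fine x)) mB Boo); last 2 first.
- apply: emeasurable_funM; last exact: measurableT_comp.
  by apply/measurable_EFinP; exact: measurableT_comp.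
- by move=> x; rewrite mule_ge0.
transitivity (mu B * \int[P]_w (fun x => h (fine x + 1)%R) (eta w B)); last by [].
rewrite (integral_count_in (h := fun x => h (fine x + 1)%R) mB Boo)//; last first.
  by apply: measurableT_comp => //; exact: measurable_funD.
rewrite /=.
under eq_eseriesr do rewrite ger0_norm//.
rewrite (poisson_series_stein (h := fun k => h k%:R%R)) ?fine_ge0// fineK; last first.
  by rewrite ge0_fin_numE.
congr (_ * _); apply: eq_eseriesr => k _.
by rewrite -natr1.
Qed.

Lemma integral_prob_cst (c : \bar R) : \int[P]_w c = c.
Proof.
transitivity (c * P setT); last by rewrite (_ : P setT = 1) ?mule1// probability_setT.
exact: integral_cst.
Qed.

(** A class closed under sums and products, on which integrability is automatic. *)
Definition all_moments (Y : Omega -> R) :=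
  measurable_fun setT Y /\ forall k, \int[P]_w (`|Y w| ^+ k)%:E < +oo.

Lemma all_moments_cst c : all_moments (cst c).
Proof.
by split => // k; rewrite /= integral_prob_cst ltry.
Qed.

Lemma all_moments_measurable_pow (Y : Omega -> R) k : measurable_fun [set: Omega] Y ->
  measurable_fun setT (fun w => (`|Y w| ^+ k)%:E).
Proof.
move=> mY; apply/measurable_EFinP; apply: measurable_funX.
exact: measurableT_comp.
Qed.

Lemma all_momentsD Y Y' : all_moments Y -> all_moments Y' ->
  all_moments (fun w => Y w + Y' w)%R.
Proof.
move=> [mY Yk] [mY' Y'k]; split; first exact: measurable_funD.
move=> k; apply: (@le_lt_trans _ _ (\int[P]_w ((2 ^+ k)%:E *
    ((`|Y w| ^+ k)%:E + (`|Y' w| ^+ k)%:E)))).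
  have mYY' := all_moments_measurable_pow k (measurable_funD mY mY').
  apply: ge0_le_integral => //; try by move=> w _; rewrite lee_fin exprn_ge0.
    apply: emeasurable_funM => //.
    exact: (emeasurable_funD (all_moments_measurable_pow _ mY) (all_moments_measurable_pow _ mY')).
  move=> w _; rewrite -EFinD -EFinM lee_fin.
  by apply: le_trans (exprD_le _ (normr_ge0 _) (normr_ge0 _));
    rewrite lerXn2r ?nnegrE ?addr_ge0// ler_normD.
rewrite ge0_integralZl_EFin ?exprn_ge0//; last 2 first.
  by move=> w _; rewrite adde_ge0// lee_fin exprn_ge0.
  exact: (emeasurable_funD (all_moments_measurable_pow _ mY) (all_moments_measurable_pow _ mY')).
rewrite ge0_integralD//; try exact: all_moments_measurable_pow.
apply: lte_mul_pinfty; rewrite ?lee_fin ?exprn_ge0//.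
exact: lte_add_pinfty.
Qed.

Lemma all_momentsM Y Y' : all_moments Y -> all_moments Y' ->
  all_moments (fun w => Y w * Y' w)%R.
Proof.
move=> [mY Yk] [mY' Y'k]; split; first exact: measurable_funM.
move=> k; apply: (@le_lt_trans _ _ (\int[P]_w
    ((`|Y w| ^+ (2 * k))%:E + (`|Y' w| ^+ (2 * k))%:E))).
  have mYY' := all_moments_measurable_pow k (measurable_funM mY mY').
  apply: ge0_le_integral => //; try by move=> w _; rewrite lee_fin exprn_ge0.
    exact: (emeasurable_funD (all_moments_measurable_pow _ mY) (all_moments_measurable_pow _ mY')).
  move=> w _; rewrite -EFinD lee_fin normrM exprMn !(mulnC 2%N) !exprM.
  set a := (`|Y w| ^+ k)%R; set b := (`|Y' w| ^+ k)%R.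
  have : (0 <= (a - b) ^+ 2)%R by exact: sqr_ge0.
  have : (0 <= a ^+ 2)%R by exact: sqr_ge0.
  have : (0 <= b ^+ 2)%R by exact: sqr_ge0.
  by rewrite sqrrB; lra.
rewrite ge0_integralD//; try exact: all_moments_measurable_pow.
exact: lte_add_pinfty.
Qed.

Lemma all_momentsX Y k : all_moments Y -> all_moments (fun w => Y w ^+ k)%R.
Proof.
move=> Ym; elim: k => [|k IH].
  by rewrite (_ : (fun _ => _) = cst 1%R)//; exact: all_moments_cst.
rewrite (_ : (fun _ => _) = (fun w => Y w * Y w ^+ k)%R); first exact: all_momentsM.
by apply/funext => w; rewrite exprS.
Qed.

Lemma all_moments_sum (I : Type) (s : seq I) (Q : pred I) (Y : I -> Omega -> R) :
  (forall i, Q i -> all_moments (Y i)) -> all_moments (fun w => \sum_(i <- s | Q i) Y i w)%R.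
Proof.
move=> Ym; elim: s => [|i s IH].
  by under eq_fun do rewrite big_nil; exact: all_moments_cst.
under eq_fun do rewrite big_cons.
by have [Qi|//] := boolP (Q i); apply: all_momentsD => //; exact: Ym.
Qed.

Lemma all_moments_prod (I : Type) (s : seq I) (Q : pred I) (Y : I -> Omega -> R) :
  (forall i, Q i -> all_moments (Y i)) -> all_moments (fun w => \prod_(i <- s | Q i) Y i w)%R.
Proof.
move=> Ym; elim: s => [|i s IH].
  by under eq_fun do rewrite big_nil; exact: all_moments_cst.
under eq_fun do rewrite big_cons.
by have [Qi|//] := boolP (Q i); apply: all_momentsM => //; exact: Ym.
Qed.

Lemma all_moments_integrable Y : all_moments Y -> P.-integrable setT (EFin \o Y).
Proof.
move=> [mY Yk]; apply/integrableP; split; first exact/measurable_EFinP.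
by have := Yk 1%N.
Qed.

Definition expect (Y : Omega -> R) : R := (\int[P]_w Y w)%R.

Lemma expectE Y : all_moments Y -> (expect Y)%:E = \int[P]_w (Y w)%:E.
Proof.
move=> Ym; rewrite /expect /Rintegral fineK//.
exact: integrable_fin_num (all_moments_integrable Ym).
Qed.

Lemma expectD Y Y' : all_moments Y -> all_moments Y' ->
  expect (fun w => Y w + Y' w)%R = (expect Y + expect Y')%R.
Proof. by move=> Ym Ym'; rewrite /expect RintegralD//; exact: all_moments_integrable. Qed.

Lemma expectZ c Y : all_moments Y -> expect (fun w => c * Y w)%R = (c * expect Y)%R.
Proof. by move=> Ym; rewrite /expect RintegralZl//; exact: all_moments_integrable. Qed.

Lemma expect_cst c : expect (cst c) = c.
Proof. by rewrite /expect /Rintegral /= integral_prob_cst. Qed.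

Lemma expect_sum (I : Type) (s : seq I) (Q : pred I) (Y : I -> Omega -> R) :
  (forall i, Q i -> all_moments (Y i)) ->
  expect (fun w => \sum_(i <- s | Q i) Y i w)%R = (\sum_(i <- s | Q i) expect (Y i))%R.
Proof.
move=> Ym; elim: s => [|i s IH].
  by under eq_fun do rewrite big_nil; rewrite expect_cst big_nil.
under eq_fun do rewrite big_cons.
rewrite big_cons; have [Qi|//] := boolP (Q i).
by rewrite expectD ?IH//; [exact: Ym|exact: all_moments_sum].
Qed.

Lemma expect_ge0 Y : (forall w, 0 <= Y w)%R -> (0 <= expect Y)%R.
Proof. by move=> Y0; exact: Rintegral_ge0. Qed.

(** Induction through the Chen-Stein identity: [E[N^(k+1)] = lam E[(N+1)^k]], and [(N+1)^k] is
    dominated by [2^k (N^k + 1)]. *)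
Lemma all_moments_count_in B : measurable B -> mu B < +oo -> all_moments (count_in B).
Proof.
move=> mB Boo; split; first exact: measurable_count_in.
move=> k; under eq_integral do rewrite ger0_norm ?count_in_ge0//.
have mX := measurable_count_in mB.
have mXk n : measurable_fun setT (fun w => (count_in B w ^+ n)%:E).
  by apply/measurable_EFinP; exact: measurable_funX.
elim: k => [|k IH].
  under eq_integral do rewrite expr0.
  by rewrite integral_prob_cst ltry.
under eq_integral do rewrite exprS EFinM.
have -> : \int[P]_w ((count_in B w)%:E * (count_in B w ^+ k)%:E) =
    \int[P]_w ((count_in B w)%:E * (`|count_in B w| ^+ k)%:E).
  by apply: eq_integral => w _; rewrite ger0_norm ?count_in_ge0.
rewrite (stein (h := fun x => (`|x| ^+ k)%:E))//; last first.
  by apply/measurable_EFinP; apply: measurable_funX; exact: normr_measurable.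
apply: lte_mul_pinfty => //; first by rewrite ge0_fin_numE.
apply: (@le_lt_trans _ _ (\int[P]_w ((2 ^+ k)%:E * ((count_in B w ^+ k)%:E + 1)))).
  apply: ge0_le_integral => //.
  - apply/measurable_EFinP; apply: measurable_funX; apply: measurableT_comp => //.
    exact: measurable_funD.
  - by apply: emeasurable_funM => //; exact: emeasurable_funD.
  move=> w _; rewrite -EFinD -EFinM lee_fin ger0_norm ?addr_ge0 ?count_in_ge0//.
  by have := exprD_le k (count_in_ge0 B w) (@ler01 R); rewrite expr1n.
rewrite ge0_integralZl_EFin ?exprn_ge0//; last 2 first.
- by move=> w _; rewrite adde_ge0// lee_fin exprn_ge0 ?count_in_ge0.
- exact: emeasurable_funD.
rewrite ge0_integralD//; last by move=> w _; rewrite lee_fin exprn_ge0 ?count_in_ge0.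
apply: lte_mul_pinfty; rewrite ?lee_fin ?exprn_ge0//.
apply: lte_add_pinfty => //.
by rewrite integral_prob_cst ltry.
Qed.

End poisson_moments.

(** * Joint independence of the counts of disjoint cells *)

Section independence.
Context {R : realType} {d d' : measure_display}.
Context {Z : measurableType d} {Omega : measurableType d'}.
Variables (P : probability Omega R) (mu : {sigma_finite_measure set Z -> \bar R})
  (eta : R.-ker Omega ~> Z).
Hypothesis Zborel : borel_space R Z.
Hypothesis mu_atomless : atomless mu.
Hypothesis Peta : is_poisson_measure P mu eta.

Local Notation E := (expect P).
Local Notation all_moments := (all_moments P).

(* Independence is assumed for pairs of sets only. For disjoint cells, however,
   all of them are void iff their union is, so the Poisson law of the union makes
   the void indicators of any finite family independent. *)
Definition void (B : set Z) (w : Omega) : R := \1_[set (0%E : \bar R)] (eta w B).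
Definition crowd (B : set Z) (w : Omega) : R := \1_(~` [set (0%E : \bar R); 1%E]) (eta w B).

Lemma measurable_crowd : measurable (~` [set (0%E : \bar R); 1%E]).
Proof.
by apply: measurableC; apply: measurableU; exact: emeasurable_set1.
Qed.

Lemma all_moments_indic (U : set (\bar R)) B : measurable B -> measurable U ->
  all_moments (fun w => \1_U (eta w B) : R).
Proof.
move=> mB mU.
have mX : measurable_fun setT (fun w => eta w B) by exact: measurable_kernel.
have m1 : measurable_fun setT (fun w => \1_U (eta w B) : R).
  exact: (measurableT_comp (measurable_indic mU) mX).
split => // k.
apply: (@le_lt_trans _ _ (\int[P]_w 1)); last by rewrite integral_prob_cst ltry.
have mm := all_moments_measurable_pow k m1.
apply: ge0_le_integral => //.
by move=> w _; rewrite lee_fin exprn_ile1// indicE; case: (_ \in _); rewrite ?normr1 ?normr0 ?ler01.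
Qed.

Lemma all_moments_void B : measurable B -> all_moments (void B).
Proof. by move=> mB; apply: all_moments_indic => //; exact: emeasurable_set1. Qed.

Lemma all_moments_crowd B : measurable B -> all_moments (crowd B).
Proof. by move=> mB; apply: all_moments_indic => //; exact: measurable_crowd. Qed.

Lemma expect_indic (U : set (\bar R)) B : measurable B -> mu B < +oo -> measurable U ->
  (E (fun w => \1_U (eta w B)))%:E =
  \sum_(0 <= k <oo) (\1_U (k%:R%:E : \bar R) : R)%:E * (ppmf (fine (mu B)) k)%:E.
Proof.
move=> mB Boo mU; rewrite expectE; last exact: all_moments_indic.
apply: (integral_count_in Peta (h := fun x => (\1_U x)%:E)) => //.
by apply/measurable_EFinP; exact: (measurable_indic mU).
Qed.

Lemma expect_void B : measurable B -> mu B < +oo ->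
  E (void B) = expR (- fine (mu B)).
Proof.
move=> mB Boo; apply: EFin_inj; rewrite (expect_indic mB Boo (emeasurable_set1 0)).
have l0 : (0 <= fine (mu B))%R by exact: fine_ge0.
rewrite nneseries_recl//; last by move=> k _; rewrite mule_ge0// lee_fin ppmf_ge0.
rewrite eseries0 ?adde0; last first.
  move=> k k1 _; rewrite indicE memNset ?mul0e//= => -[] /eqP.
  by rewrite pnatr_eq0; case: k k1.
by rewrite indicE mem_set// mul1e /ppmf expr0 fact0 invr1 !mul1r.
Qed.

Lemma sum_ppmf (lam : R) : (0 <= lam)%R -> \sum_(0 <= k <oo) (ppmf lam k)%:E = 1.
Proof.
move=> l0.
have <- : poisson_prob lam 0 [set: nat] = 1 by exact: probability_setT.
have := integral_on_nat (poisson_prob lam 0) (h := cst 1%E) (fun _ => lee01).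
rewrite integral_cst// mul1e => ->; apply: eq_eseriesr => k _.
by rewrite mul1e; exact/esym/(poisson_prob_set1 k l0).
Qed.

(** The Chen-Stein identity is used twice: the indicator of [N >= 2] is at most [N] times itself,
    which leaves [lam P(N >= 1)], and [P(N >= 1) <= E[N] = lam]. *)
Lemma expect_crowd B : measurable B -> mu B < +oo ->
  (E (crowd B) <= fine (mu B) ^+ 2)%R.
Proof.
move=> mB Boo; rewrite -lee_fin (expect_indic mB Boo measurable_crowd).
have l0 : (0 <= fine (mu B))%R by exact: fine_ge0.
set lam := fine _ in l0 *.
have c2 k : (\1_(~` [set 0%E; 1%E]) (k%:R%:E : \bar R) : R) = (1 < k)%N%:R.
  rewrite indicE; congr (_%:R); case: k => [|[|k]] /=.
  - by rewrite memNset//= => h; apply: h; left.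
  - by rewrite memNset//= => h; apply: h; right.
  - rewrite mem_set//= => -[] [] /eqP; first by rewrite pnatr_eq0.
    by rewrite (eqr_nat R _ 1).
apply: (@le_trans _ _ (\sum_(0 <= k <oo) (k%:R%:E * (1 < k)%N%:R%:E) * (ppmf lam k)%:E)).
  apply: lee_nneseries => [k _ _|k _]; first by rewrite mule_ge0// lee_fin ppmf_ge0.
  rewrite c2 lee_wpmul2r ?lee_fin ?ppmf_ge0//.
  by case: k => [|[|k]]; rewrite ?mulr0// ?mulr1 (ler_nat R 1).
rewrite (poisson_series_stein (h := fun k => (1 < k)%N%:R%:E))//.
rewrite expr2 EFinM lee_wpmul2l// ?lee_fin//.
apply: (@le_trans _ _ (\sum_(0 <= k <oo) (k%:R%:E * 1) * (ppmf lam k)%:E)).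
  apply: lee_nneseries => [k _ _|k _]; first by rewrite mule_ge0// lee_fin ppmf_ge0.
  rewrite lee_wpmul2r ?lee_fin ?ppmf_ge0// mulr1.
  by case: k => [|k] //; rewrite (ler_nat R 1).
rewrite (poisson_series_stein (h := fun k => 1))//.
under eq_eseriesr do rewrite mul1e.
by rewrite sum_ppmf// mule1.
Qed.

Lemma voidU A B w : measurable A -> measurable B ->
  void (A `|` B) w = (void A w * void B w)%R.
Proof.
move=> mA mB; rewrite /void !indicE -natrM mulnb; congr (_%:R).
congr nat_of_bool; apply/idP/andP => [|[]]; rewrite !inE /=.
- move=> h; split; apply/eqP; rewrite eq_le measure_ge0 andbT -h le_measure ?inE//;
    exact: measurableU.
- by move=> A0 B0; rewrite measureU0.
Qed.

Lemma void_prod (T : choiceType) (D : T -> set Z) (s : seq T) w :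
  (forall t, measurable (D t)) ->
  (\prod_(t <- s) void (D t) w)%R = void (\big[setU/set0]_(t <- s) D t) w.
Proof.
move=> mD; elim: s => [|t s IH].
  by rewrite !big_nil /void indicE mem_set//= measure0.
rewrite !big_cons IH voidU//; exact: bigsetU_measurable.
Qed.

Lemma measure_seqU (m : {measure set Z -> \bar R}) (T : choiceType) (D : T -> set Z)
    (s : seq T) : uniq s -> (forall t, measurable (D t)) -> trivIset setT D ->
  m (\big[setU/set0]_(t <- s) D t) = \sum_(t <- s) m (D t).
Proof.
move=> us mD tD; elim: s us => [|t s IH] /=; first by rewrite !big_nil measure0.
move=> /andP[ts us].
have mU : measurable (\big[setU/set0]_(t <- s) D t) by exact: bigsetU_measurable.
rewrite !big_cons measureU//; first by congr (_ + _); exact: IH.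
rewrite -bigcup_seq setI_bigcupr; apply: bigcup0 => t' /= t's.
move/trivIsetP : tD; apply => //; apply: contraNneq ts => ->; exact: t's.
Qed.

Lemma expect_void_prod (T : finType) (D : T -> set Z) (U : {set T}) :
  (forall t, measurable (D t)) -> (forall t, mu (D t) < +oo) -> trivIset setT D ->
  E (fun w => \prod_(t in U) void (D t) w)%R =
  (\prod_(t in U) expR (- fine (mu (D t))))%R.
Proof.
move=> mD Doo tD.
have -> : (fun w => \prod_(t in U) void (D t) w)%R =
    void (\big[setU/set0]_(t <- enum U) D t).
  by apply/funext => w; rewrite -void_prod// big_enum.
have muE : mu (\big[setU/set0]_(t <- enum U) D t) = \sum_(t <- enum U) mu (D t).
  by apply: measure_seqU => //; exact: enum_uniq.
have mU : measurable (\big[setU/set0]_(t <- enum U) D t) by exact: bigsetU_measurable.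
rewrite (expect_void mU); last by rewrite muE; apply/lte_sum_pinfty => t _; exact: Doo.
rewrite muE big_enum /= -expR_sum; congr expR; rewrite sumrN; congr (- _)%R.
rewrite (eq_bigr (fun t => (fine (mu (D t)))%:E)) ?sumEFin// => t _.
by rewrite fineK// ge0_fin_numE.
Qed.

Section factor.
Variables (I : finType) (J : nat) (D : I -> 'I_J -> set Z).
Hypothesis mD : forall i j, measurable (D i j).
Hypothesis Doo : forall i j, mu (D i j) < +oo.
Hypothesis tD : trivIset setT (fun t : I * 'I_J => D t.1 t.2).

(** Polynomials in the void indicators of group [i]. These indicators are idempotent, so monomials
    indexed by subsets suffice and multiply by taking unions. *)
Definition void_poly i (Y : Omega -> R) := exists c : {set 'I_J} -> R,
  forall w, Y w = (\sum_u c u * \prod_(j in u) void (D i j) w)%R.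

Lemma void_poly_cst i a : void_poly i (cst a).
Proof.
exists (fun u => if u == finset.set0 then a else 0%R) => w.
rewrite (bigD1 finset.set0)//= eqxx big_set0 mulr1 big1 ?addr0// => u /negbTE ->.
by rewrite mul0r.
Qed.

Lemma void_poly_void i j : void_poly i (void (D i j)).
Proof.
exists (fun u => (u == [set j]%SET)%:R) => w.
rewrite (bigD1 [set j]%SET)//= eqxx big_set1 mul1r big1 ?addr0// => u /negbTE ->.
by rewrite mul0r.
Qed.

Lemma void_polyD i Y Y' : void_poly i Y -> void_poly i Y' ->
  void_poly i (fun w => Y w + Y' w)%R.
Proof.
move=> [c cE] [c' c'E]; exists (fun u => c u + c' u)%R => w.
by rewrite cE c'E -big_split; apply: eq_bigr => u _; rewrite mulrDl.
Qed.

Lemma void_polyM i Y Y' : void_poly i Y -> void_poly i Y' ->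
  void_poly i (fun w => Y w * Y' w)%R.
Proof.
move=> [c cE] [c' c'E].
exists (fun u => \sum_(p : {set 'I_J} * {set 'I_J} | (p.1 :|: p.2)%SET == u) c p.1 * c' p.2)%R => w.
rewrite cE c'E big_distrlr /= pair_big /=.
rewrite (partition_big (fun p : {set 'I_J} * {set 'I_J} => (p.1 :|: p.2)%SET) xpredT)//=.
apply: eq_bigr => u _; rewrite big_distrl /=; apply: eq_bigr => -[u1 u2] /= /eqP <-.
rewrite mulrACA; congr (_ * _)%R.
rewrite !(big_mkcond (fun j => j \in _)) -big_split /=; apply: eq_bigr => j _.
rewrite !inE; case: (j \in u1); case: (j \in u2); rewrite ?mulr1 ?mul1r//=.
by rewrite /void indicE; case: (_ \in _); rewrite ?mulr1 ?mulr0.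
Qed.

Lemma void_polyX i Y k : void_poly i Y -> void_poly i (fun w => Y w ^+ k)%R.
Proof.
move=> Yp; elim: k => [|k IH].
  rewrite (_ : (fun _ => _) = cst 1%R); first exact: void_poly_cst.
  by apply/funext => w; rewrite expr0.
rewrite (_ : (fun _ => _) = (fun w => Y w * Y w ^+ k)%R); first exact: void_polyM.
by apply/funext => w; rewrite exprS.
Qed.

Lemma void_poly_sum i (T : Type) (s : seq T) (Y : T -> Omega -> R) :
  (forall t, void_poly i (Y t)) -> void_poly i (fun w => \sum_(t <- s) Y t w)%R.
Proof.
move=> Yp; elim: s => [|t s IH].
  rewrite (_ : (fun _ => _) = cst 0%R); first exact: void_poly_cst.
  by apply/funext => w; rewrite big_nil.
rewrite (_ : (fun _ => _) = (fun w => Y t w + \sum_(t <- s) Y t w)%R).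
  exact: void_polyD.
by apply/funext => w; rewrite big_cons.
Qed.

Lemma all_moments_void_poly i Y : void_poly i Y -> all_moments Y.
Proof.
move=> [c cE]; rewrite (_ : Y = fun w => \sum_u c u * \prod_(j in u) void (D i j) w)%R.
  apply: all_moments_sum => u _; apply: all_momentsM; first exact: all_moments_cst.
  by apply: all_moments_prod => j _; exact: all_moments_void.
by apply/funext => w; rewrite cE.
Qed.

(** After multilinear expansion only products of void indicators remain, whose expectation is an
    exponential of a sum of measures and hence a product over the groups. *)
Lemma expect_void_poly (Y : I -> Omega -> R) : (forall i, void_poly i (Y i)) ->
  E (fun w => \prod_i Y i w)%R = (\prod_i E (Y i))%R.
Proof.
move=> /choice[c cE].
pose v i j := expR (- fine (mu (D i j))).
have amprod i u : all_moments (fun w => \prod_(j in u) void (D i j) w)%R.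
  by apply: all_moments_prod => j _; exact: all_moments_void.
have EY i : E (Y i) = (\sum_u c i u * \prod_(j in u) v i j)%R.
  have -> : Y i = (fun w => \sum_u c i u * \prod_(j in u) void (D i j) w)%R.
    by apply/funext => w; rewrite cE.
  rewrite expect_sum => [|u _]; last first.
    by apply: all_momentsM; [exact: all_moments_cst|exact: amprod].
  apply: eq_bigr => u _; rewrite expectZ//; congr (_ * _)%R.
  apply: expect_void_prod => // .
  apply/trivIsetP => j j' _ _ jj'.
  move/trivIsetP: (tD) => tD'; apply: (tD' (i, j) (i, j')) => //.
  by apply: contra_neq jj' => -[].
under [RHS]eq_bigr do rewrite EY.
rewrite bigA_distr_bigA /=.
have -> : (fun w => \prod_i Y i w)%R = (fun w => \sum_(f : {ffun I -> {set 'I_J}})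
   (\prod_i c i (f i)) * \prod_(t in [set t : I * 'I_J | t.2 \in f t.1]%SET) void (D t.1 t.2) w)%R.
  apply/funext => w; under eq_bigr do rewrite cE.
  rewrite bigA_distr_bigA; apply: eq_bigr => f _; rewrite big_split /=; congr (_ * _)%R.
  by rewrite pair_big_dep /=; apply: eq_bigl => t; rewrite inE.
rewrite expect_sum => [|f _]; last first.
  apply: all_momentsM; first exact: all_moments_cst.
  by apply: all_moments_prod => t _; exact: all_moments_void.
apply: eq_bigr => f _; rewrite expectZ; last first.
  by apply: all_moments_prod => t _; exact: all_moments_void.
rewrite big_split /=; congr (_ * _)%R.
rewrite expect_void_prod// pair_big_dep /=; apply: eq_bigl => t; by rewrite inE.
Qed.

End factor.

Definition centered (B : set Z) (w : Omega) : R := (count_in eta B w - fine (mu B))%R.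

Lemma all_moments_centered B : measurable B -> mu B < +oo -> all_moments (centered B).
Proof.
move=> mB Boo; apply: all_momentsD; first exact: (all_moments_count_in Peta).
exact: (all_moments_cst P (- fine (mu B))).
Qed.

Lemma count_in_nat_ae B : measurable B -> mu B < +oo ->
  {ae P, forall w, exists n : nat, eta w B = n%:R%:E}.
Proof.
move=> mB Boo; pose U : set (\bar R) := \bigcup_n [set n%:R%:E].
have mU : measurable U by apply: bigcup_measurable => n _; exact: emeasurable_set1.
have mX : measurable_fun setT (fun w => eta w B) by exact: measurable_kernel.
exists ((fun w => eta w B) @^-1` (~` U)); split.
- by rewrite -[X in measurable X]setTI; apply: mX => //; exact: measurableC.
- rewrite Peta.1//; last exact: measurableC.
  rewrite (_ : [set _ | _] = set0) ?measure0//.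
  by apply/seteqP; split => // n /=; apply; exists n.
- move=> w /= h [n _ /= nE]; apply: h; by exists n.
Qed.

Lemma ae_le_expect Y Y' : all_moments Y -> all_moments Y' ->
  (forall w, 0 <= Y w)%R -> (forall w, 0 <= Y' w)%R ->
  {ae P, forall w, (Y w <= Y' w)%R} -> (E Y <= E Y')%R.
Proof.
move=> Ym Ym' Y0 Y'0 YY'; rewrite -lee_fin !expectE//.
apply: ae_ge0_le_integral => //.
- by move=> w _; rewrite lee_fin.
- by apply/measurable_EFinP; case: Ym.
- by move=> w _; rewrite lee_fin.
- by apply/measurable_EFinP; case: Ym'.
- by apply: filterS YY' => w h _; rewrite lee_fin.
Qed.

Section approximation.
Variables (I : finType) (B : I -> set Z).
Hypothesis mB : forall i, measurable (B i).
Hypothesis Boo : forall i, mu (B i) < +oo.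
Hypothesis tB : trivIset setT B.

Let dominant (k : I -> nat) w := (\prod_i (count_in eta (B i) w + fine (mu (B i))) ^+ k i)%R.
Let total := (\sum_i fine (mu (B i)))%R.

Let all_moments_dominant k : all_moments (dominant k).
Proof.
apply: all_moments_prod => i _; apply: all_momentsX; apply: all_momentsD.
  exact: (all_moments_count_in Peta).
exact: (all_moments_cst P (fine (mu (B i)))).
Qed.

(** Exponents that retain one factor only: the product structure of the approximants can be stated
    in terms of the same function [b]. *)
Definition single (i : I) (k : I -> nat) := fun j => if j == i then k i else 0%N.

(* On a fine partition of the cells, a count is a sum of [1 - void] outside of an
   event of small probability where some piece is crowded. *)
Lemma moments_approx (delta : R) : (0 < delta)%R -> exists b : (I -> nat) -> R,
  (forall k, b k = \prod_i b (single i k))%R /\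
  forall k, (`|E (fun w => \prod_i centered (B i) w ^+ k i) - b k| <=
    delta * (E (fun w => dominant k w ^+ 2) + total))%R.
Proof.
move=> delta0.
(* The mesh is [delta ^+ 2] because the probability of crowding will be multiplied by [delta^-1]. *)
have eps0 : (0 < delta ^+ 2)%R by exact: exprn_gt0.
have /choice[n_ /choice[D_ DP]] := fun i => fine_partition Zborel mu_atomless (mB i) (Boo i) eps0.
pose J := (\max_i n_ i)%N.
pose D i (j : 'I_J) := D_ i j.
have DB i : B i = \big[setU/set0]_(j < J) D i j.
  have [_ _ D0 <- _] := DP i.
  rewrite -bigcup_mkord; apply/seteqP; split => z [j jJ Dz]; last by exists j.
  exists j => //=; rewrite ltnNge; apply/negP => Jj.
  by move: Dz; rewrite D0//; apply: leq_trans Jj; exact: leq_bigmax.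
have mD i j : measurable (D i j) by have [h _ _ _ _] := DP i; exact: h.
have Dsub i j : D i j `<=` B i.
  by rewrite DB => z Dz; rewrite -bigcup_seq; exists j => //=; rewrite mem_index_enum.
have Doo i j : mu (D i j) < +oo.
  by apply: le_lt_trans (Boo i); apply: le_measure; rewrite ?inE.
have Deps i j : mu (D i j) <= (delta ^+ 2)%:E by have [_ _ _ _ h] := DP i; exact: h.
have tDi i : trivIset setT (D i).
  have [_ h _ _ _] := DP i; apply/trivIsetP => j j' _ _ jj'.
  by move/trivIsetP : h; apply.
have tD : trivIset setT (fun t : I * 'I_J => D t.1 t.2).
  apply/trivIsetP => -[i j] [i' j'] _ _ /=; have [<-|ii'] := eqVneq i i'.
    by move=> jj'; move/trivIsetP: (tDi i); apply => //; apply: contra_neq jj' => ->.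
  move=> _; apply: subsetI_eq0 (@Dsub i j) (@Dsub i' j') _.
  by move/trivIsetP: tB; apply.
(* Occupied pieces are counted instead of points: the result is a polynomial in void indicators, so
   its moments factorize exactly. *)
pose X i w := (\sum_(j < J) (1 - void (D i j) w) - fine (mu (B i)))%R.
have Xpoly i k : void_poly D i (fun w => X i w ^+ k)%R.
  apply: void_polyX.
  apply: (void_polyD (Y' := cst (- fine (mu (B i)))%R)); last exact: void_poly_cst.
  apply: void_poly_sum => j.
  rewrite (_ : (fun _ => _) = (fun w => cst 1 w + cst (-1) w * void (D i j) w)%R).
    apply: void_polyD; first exact: void_poly_cst.
    apply: void_polyM; first exact: void_poly_cst.
    exact: void_poly_void.
  by apply/funext => w; rewrite /= mulN1r.
have am_a k : all_moments (fun w => \prod_i centered (B i) w ^+ k i)%R.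
  by apply: all_moments_prod => i _; apply: all_momentsX; exact: all_moments_centered.
have am_X k : all_moments (fun w => \prod_i X i w ^+ k i)%R.
  by apply: all_moments_prod => i _; exact: (all_moments_void_poly mD (Xpoly i (k i))).
have bE k : E (fun w => \prod_i X i w ^+ k i)%R = (\prod_i E (fun w => X i w ^+ k i))%R.
  by apply: (expect_void_poly mD Doo tD (Y := fun i w => (X i w ^+ k i)%R)) => i; exact: Xpoly.
exists (fun k => E (fun w => \prod_i X i w ^+ k i)%R); split.
  move=> k; rewrite bE; apply: eq_bigr => i _; congr expect; apply/funext => w.
  rewrite (bigD1 i)//= /single eqxx big1 ?mulr1// => j /negbTE ->.
  by rewrite expr0.
move=> k.
pose W w := (\sum_i \sum_j crowd (D i j) w)%R.
have am_W : all_moments W.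
  by apply: all_moments_sum => i _; apply: all_moments_sum => j _; exact: all_moments_crowd.
have EW : (E W <= delta ^+ 2 * total)%R.
  rewrite /W expect_sum => [|i _]; last by apply: all_moments_sum => j _; exact: all_moments_crowd.
  rewrite /total mulr_sumr; apply: ler_sum => i _.
  rewrite expect_sum => [|j _]; last exact: all_moments_crowd.
  have -> : fine (mu (B i)) = (\sum_j fine (mu (D i j)))%R.
    apply: EFin_inj; rewrite fineK ?ge0_fin_numE// [X in mu X]DB measure_seqU ?index_enum_uniq//.
    by rewrite -sumEFin; apply: eq_bigr => j _; rewrite fineK// ge0_fin_numE.
  rewrite mulr_sumr; apply: ler_sum => j _.
  apply: (le_trans (expect_crowd (mD i j) (Doo i j))).
  rewrite expr2 ler_wpM2r ?fine_ge0// -lee_fin fineK ?ge0_fin_numE//.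
have l0 i : (0 <= fine (mu (B i)))%R by exact: fine_ge0.
have dom0 w : (0 <= dominant k w)%R.
  by apply: prodr_ge0 => i _; rewrite exprn_ge0// addr_ge0// count_in_ge0.
have W0 w : (0 <= W w)%R.
  by apply: sumr_ge0 => i _; apply: sumr_ge0 => j _; rewrite /crowd indicE.
have -> : (E (fun w => \prod_i centered (B i) w ^+ k i) - E (fun w => \prod_i X i w ^+ k i))%R =
  E (fun w => \prod_i centered (B i) w ^+ k i - \prod_i X i w ^+ k i)%R.
  by rewrite /expect RintegralB//; exact: all_moments_integrable.
have am_d : all_moments (fun w => \prod_i centered (B i) w ^+ k i - \prod_i X i w ^+ k i)%R.
  rewrite (_ : (fun _ => _) = (fun w => \prod_i centered (B i) w ^+ k i +
    (cst (-1) w) * \prod_i X i w ^+ k i)%R).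
    by apply: all_momentsD => //; apply: all_momentsM => //; exact: all_moments_cst.
  by apply/funext => w; rewrite /= mulN1r.
have bnd0 w : (0 <= delta * dominant k w ^+ 2 + delta^-1 * W w)%R.
  by apply: addr_ge0; apply: mulr_ge0; rewrite ?exprn_ge0 ?invr_ge0 ?(ltW delta0).
have am_b : all_moments (fun w => delta * dominant k w ^+ 2 + delta^-1 * W w)%R.
  apply: all_momentsD; apply: all_momentsM => //.
  - exact: (all_moments_cst P delta).
  - exact: all_momentsX.
  - exact: (all_moments_cst P delta^-1).
apply: (@le_trans _ _ (E (fun w => delta * dominant k w ^+ 2 + delta^-1 * W w)%R)); last first.
  rewrite expectD; last 2 first.
  - apply: all_momentsM; first exact: (all_moments_cst P delta).
    exact: all_momentsX.
  - by apply: all_momentsM => //; exact: (all_moments_cst P delta^-1).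
  rewrite !expectZ//; last exact: all_momentsX.
  rewrite mulrDr lerD2l ler_pdivrMl// mulrA -expr2//.
apply: (@le_trans _ _ (E (fun w => `|\prod_i centered (B i) w ^+ k i - \prod_i X i w ^+ k i|)%R)).
  by apply: le_normr_Rintegral => //; exact: all_moments_integrable.
apply: ae_le_expect => //.
- case: am_d => m1 m2; split; first exact: measurableT_comp.
  by move=> n; under eq_integral do rewrite normr_id.
have good : {ae P, forall w, forall t : I * 'I_J, exists n : nat, eta w (D t.1 t.2) = n%:R%:E}.
  by apply: filter_forall => t; exact: count_in_nat_ae.
apply: filterS good => w good.
have [n nE] : exists n : I -> 'I_J -> nat, forall i j, eta w (D i j) = (n i j)%:R%:E.
  have /choice[n nE] := good; by exists (fun i j => n (i, j)) => i j; exact: (nE (i, j)).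
have NE i : count_in eta (B i) w = (\sum_j (n i j)%:R)%R.
  rewrite /count_in DB measure_seqU ?index_enum_uniq//.
  by under eq_bigr do rewrite nE; rewrite sumEFin.
have vE i j : void (D i j) w = (n i j == 0)%N%:R.
  rewrite /void indicE nE; congr (_%:R); congr nat_of_bool.
  by apply/idP/eqP => [|->]; rewrite inE//= => -[/eqP]; rewrite pnatr_eq0 => /eqP.
have cE i j : crowd (D i j) w = (1 < n i j)%N%:R.
  rewrite /crowd indicE nE; congr (_%:R); case: (n i j) => [|[|m]] /=.
  - by rewrite memNset//= => h; apply: h; left.
  - by rewrite memNset//= => h; apply: h; right.
  - rewrite mem_set//= => -[] [] /eqP; first by rewrite pnatr_eq0.
    by rewrite (eqr_nat R _ 1).
have XE i : X i w = (\sum_j (0 < n i j)%N%:R - fine (mu (B i)))%R.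
  rewrite /X; congr (_ - _)%R; apply: eq_bigr => j _; rewrite vE.
  by case: (n i j) => [|m]; rewrite ?subrr ?subr0.
(* Without a crowded piece both products coincide. Otherwise [1 <= W], both products are at most [G]
   in absolute value, and [2 G <= delta G^2 + delta^-1]. *)
have [small|] := boolP [forall t : I * 'I_J, (n t.1 t.2 <= 1)%N].
  have -> : (\prod_i centered (B i) w ^+ k i = \prod_i X i w ^+ k i)%R.
    apply: eq_bigr => i _; congr (_ ^+ _)%R; rewrite XE /centered NE; congr (_ - _)%R.
    apply: eq_bigr => j _; have := forallP small (i, j) => /=.
    by case: (n i j) => [|[|m]].
  by rewrite subrr normr0.
move=> /forallPn[[i0 j0] /=]; rewrite -ltnNge => n1.
have W1 : (1 <= W w)%R.
  rewrite /W (bigD1 i0)//= (bigD1 j0)//= cE n1 -addrA lerDl addr_ge0//.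
    by apply: sumr_ge0 => j _; rewrite /crowd indicE.
  by apply: sumr_ge0 => i _; apply: sumr_ge0 => j _; rewrite /crowd indicE.
have ha : (`|\prod_i centered (B i) w ^+ k i| <= dominant k w)%R.
  rewrite normr_prod; apply: ler_prod => i _; rewrite normr_ge0/= normrX lerXn2r ?nnegrE//.
    by rewrite addr_ge0// count_in_ge0.
  by rewrite (le_trans (ler_normB _ _))// lerD// ger0_norm// count_in_ge0.
have hX : (`|\prod_i X i w ^+ k i| <= dominant k w)%R.
  rewrite normr_prod; apply: ler_prod => i _; rewrite normr_ge0/= normrX lerXn2r ?nnegrE//.
    by rewrite addr_ge0// count_in_ge0.
  rewrite XE (le_trans (ler_normB _ _))// NE [X in (_ + X <= _)%R]ger0_norm// lerD2r.
  rewrite ger0_norm; last by apply: sumr_ge0.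
  by apply: ler_sum => j _; rewrite ler_nat; case: (n i j).
set a := (\prod_i _ ^+ _)%R in ha *; set x := (\prod_i X i w ^+ k i)%R in hX *.
set G := dominant k w in ha hX dom0 *.
apply: (@le_trans _ _ (2 * G)%R).
  by rewrite (le_trans (ler_normB _ _))// mulr_natl mulr2n lerD.
apply: (@le_trans _ _ (delta * G ^+ 2 + delta^-1)%R); last first.
  by rewrite lerD2l ler_peMr// invr_ge0 ltW.
rewrite -subr_ge0 (_ : _ - _ = delta * (G - delta^-1) ^+ 2)%R.
  by rewrite mulr_ge0 ?sqr_ge0// ltW.
have d1 : (delta * delta^-1 = 1)%R by rewrite mulfV// gt_eqF.
transitivity (delta * G ^+ 2 + delta^-1 * (delta * delta^-1) - 2 * G * (delta * delta^-1))%R.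
  by rewrite d1 !mulr1.
ring.
Qed.

(** Each approximant factorizes exactly, and the factorization persists when [delta = 1/(n+1)] tends
    to zero. *)
Lemma centered_independent k :
  E (fun w => \prod_i centered (B i) w ^+ k i)%R = (\prod_i E (fun w => centered (B i) w ^+ k i))%R.
Proof.
pose a k := E (fun w => \prod_i centered (B i) w ^+ k i)%R.
pose C k := (E (fun w => dominant k w ^+ 2) + total)%R.
have /choice[b bP] : forall n : nat, exists b : (I -> nat) -> R,
    (forall k, b k = \prod_i b (single i k))%R /\
    forall k, (`|a k - b k| <= n.+1%:R^-1 * C k)%R.
  by move=> n; apply: moments_approx; rewrite invr_gt0.
have cvgb k' : (b n k' @[n --> \oo] --> a k').
  apply/cvgrPdist_le => e e0.
  have h : (n.+1%:R^-1 * C k')%R @[n --> \oo] --> (0 * C k')%R.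
    by apply: cvgMl; exact: cvg_harmonic.
  rewrite mul0r in h; move/cvgr0Pnorm_le : h => /(_ _ e0).
  apply: filterS => n h; have [_ /(_ k')] := bP n.
  by move=> /le_trans; apply; apply: le_trans h; exact: ler_norm.
transitivity (\prod_i a (single i k))%R; last first.
  apply: eq_bigr => i _; congr expect; apply/funext => w.
  rewrite (bigD1 i)//= /single eqxx big1 ?mulr1// => j /negbTE ->.
  by rewrite expr0.
have cvgP : (\prod_i b n (single i k))%R @[n --> \oo] --> (\prod_i a (single i k))%R.
  apply: (cvg_big (op := fun x y : R => x * y)%R); first exact: mul_continuous.
  by move=> i _; exact: cvgb.
have bE : (fun n => \prod_i b n (single i k))%R = (fun n => b n k).
  by apply/funext => n; case: (bP n) => ->.
by rewrite bE in cvgP; exact: (cvg_unique _ (cvgb k) cvgP).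
Qed.

End approximation.
End independence.

(** * Moments of one centered count *)

Section centered_moments.
Context {R : realType} {d d' : measure_display}.
Context {Z : measurableType d} {Omega : measurableType d'}.
Variables (P : probability Omega R) (mu : {sigma_finite_measure set Z -> \bar R})
  (eta : R.-ker Omega ~> Z).
Hypothesis Peta : is_poisson_measure P mu eta.
Variable B : set Z.
Hypothesis mB : measurable B.
Hypothesis Boo : mu B < +oo.

Local Notation E := (expect P).
Local Notation N := (count_in eta B).
Local Notation lam := (fine (mu B)).

Let amN : all_moments P N := all_moments_count_in Peta mB Boo.

Lemma stein_pow k : (E (fun w => N w * N w ^+ k) = lam * E (fun w => (N w + 1) ^+ k))%R.
Proof.
have am1 : all_moments P (fun w => N w + 1)%R.
  by apply: all_momentsD => //; exact: (all_moments_cst P 1%R).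
apply: EFin_inj; rewrite EFinM !expectE; last 2 first.
- exact: all_momentsX.
- by apply: all_momentsM => //; exact: all_momentsX.
rewrite fineK ?ge0_fin_numE//.
transitivity (\int[P]_w ((N w)%:E * (`|N w| ^+ k)%:E)).
  by apply: eq_integral => w _; rewrite ger0_norm// count_in_ge0.
rewrite (stein Peta (h := fun x => (`|x| ^+ k)%:E) mB Boo); last 2 first.
- by apply/measurable_EFinP; apply: measurable_funX; exact: normr_measurable.
- by move=> x; rewrite lee_fin exprn_ge0.
by congr (_ * _); apply: eq_integral => w _; rewrite ger0_norm// addr_ge0// count_in_ge0.
Qed.

Lemma stein_poly (p : {poly R}) :
  (E (fun w => N w * p.[N w]) = lam * E (fun w => p.[N w + 1]))%R.
Proof.
have amX c i : all_moments P (fun w => (N w + c) ^+ i)%R.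
  by apply: all_momentsX; apply: all_momentsD => //; exact: (all_moments_cst P c).
have -> : (fun w => N w * p.[N w])%R = (fun w => \sum_(i < size p) p`_i * (N w * N w ^+ i))%R.
  apply/funext => w; rewrite horner_coef mulr_sumr; apply: eq_bigr => i _.
  by rewrite mulrCA.
have -> : (fun w => p.[N w + 1])%R = (fun w => \sum_(i < size p) p`_i * (N w + 1) ^+ i)%R.
  by apply/funext => w; rewrite horner_coef.
have amNX i : all_moments P (fun w => N w * N w ^+ i)%R.
  by apply: all_momentsM => //; exact: all_momentsX.
rewrite !expect_sum; last 2 first.
- by move=> i _; apply: all_momentsM => //; exact: (all_moments_cst P p`_i).
- by move=> i _; apply: all_momentsM => //; exact: (all_moments_cst P p`_i).
rewrite mulr_sumr; apply: eq_bigr => i _; rewrite !expectZ// stein_pow.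
by rewrite mulrCA.
Qed.

Lemma centered_moment0 : E (fun w => centered mu eta B w ^+ 0)%R = 1%R.
Proof.
rewrite (_ : (fun _ => _) = cst 1%R); first by rewrite expect_cst.
by apply/funext => w; rewrite expr0.
Qed.

(** The Chen-Stein identity for [(x - lam)^n]: its left side is [E[xi^(n+1)] + lam E[xi^n]], and the
    second term cancels the top binomial term on the right. The missing index [j = n] is what will
    exclude singleton blocks. *)
Lemma centered_momentS n :
  (E (fun w => centered mu eta B w ^+ n.+1) =
   lam * \sum_(j < n) 'C(n, j)%:R * E (fun w => centered mu eta B w ^+ j))%R.
Proof.
have amc k : all_moments P (fun w => centered mu eta B w ^+ k)%R.
  by apply: all_momentsX; exact: (all_moments_centered Peta).
have := stein_poly (('X - lam%:P) ^+ n)%R.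
have -> : (fun w => N w * (('X - lam%:P) ^+ n).[N w])%R =
  (fun w => centered mu eta B w ^+ n.+1 + lam * centered mu eta B w ^+ n)%R.
  apply/funext => w; rewrite hornerE hornerXsubC exprS -mulrDl /centered.
  by rewrite subrK.
have -> : (fun w => (('X - lam%:P) ^+ n).[N w + 1])%R =
  (fun w => \sum_(j < n.+1) 'C(n, j)%:R * centered mu eta B w ^+ j)%R.
  apply/funext => w; rewrite hornerE hornerXsubC addrAC -/(centered mu eta B w).
  rewrite addrC exprDn; apply: eq_bigr => j _.
  by rewrite expr1n mul1r mulr_natl.
rewrite expectD//; last by apply: all_momentsM => //; exact: (all_moments_cst P lam).
rewrite expectZ// expect_sum; last first.
  by move=> j _; apply: all_momentsM => //; exact: (all_moments_cst P 'C(n, j)%:R).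
rewrite big_ord_recr /= binn mulrDr expectZ// mul1r => /addIr ->.
by congr (_ * _)%R; apply: eq_bigr => j _; rewrite expectZ.
Qed.

End centered_moments.

(** * Fourth moments of simple kernels *)

Section partition_sum.
Variables (R : comNzRingType) (T : finType) (lam : R) (m : nat -> R).
Hypothesis m0 : m 0 = 1%R.
Hypothesis mS : forall n, m n.+1 = (lam * \sum_(j < n) 'C(n, j)%:R * m j)%R.

Definition thick_partition (tau : {set {set T}}) (S : {set T}) : bool :=
  finset.partition tau S && [forall A in tau, (2 <= #|A|)%N].

Lemma setDDK (S C : {set T}) : C \subset S -> (S :\: (S :\: C))%SET = C.
Proof.
move=> CS; apply/setP => z; rewrite !inE negb_and negbK.
case zC: (z \in C) => /=; first exact: (fintype.subsetP CS).
by case: (z \in S).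
Qed.

Lemma sum_proper_subsets (S : {set T}) :
  (\sum_(C : {set T} | (C \subset S) && (#|C| < #|S|)%N) m #|C| =
   \sum_(j < #|S|) 'C(#|S|, j)%:R * m j)%R.
Proof.
transitivity (\sum_(C : {set T} | C \subset S) \sum_(j < #|S| | #|C| == j) m j)%R.
  rewrite big_mkcondr; apply: eq_bigr => C _.
  have [CS|CS] := ltnP #|C| #|S|.
    by rewrite (big_pred1 (Ordinal CS))// => j; rewrite eq_sym.
  by rewrite big_pred0// => j; apply/negbTE; rewrite neq_ltn (leq_trans _ CS) ?orbT.
rewrite (exchange_big_dep xpredT)//=; apply: eq_bigr => j _.
rewrite -cards_draws sumr_const mulr_natl; congr (_ *+ _)%R.
by apply: eq_card => C; rewrite !inE.
Qed.

(** Both sides satisfy the recursion [mS]: the block of a fixed [x] is removed, contributing one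
    factor [lam], and the rest is a thick partition of its complement. *)
Lemma sum_thick_partition (S : {set T}) :
  (\sum_(tau | thick_partition tau S) lam ^+ #|tau| = m #|S|)%R.
Proof.
have [k] := ubnP #|S|; elim: k S => // k IH S Sk.
have [->|[x xS]] := set_0Vmem S.
  rewrite cards0 m0 (big_pred1 finset.set0) ?cards0 ?expr0// => tau.
  rewrite /thick_partition partition_set0 /=.
  case: eqP => //= ->; apply/forall_inP => A; by rewrite inE.
pose Q (B : {set T}) := [&& x \in B, B \subset S & (2 <= #|B|)%N].
have blockP tau : thick_partition tau S -> finset.pblock tau x \in tau /\ Q (finset.pblock tau x).
  move=> /andP[tauS /forall_inP tau2].
  have xc : x \in finset.cover tau by rewrite (cover_partition tauS).
  have bt := pblock_mem xc; split => //.
  rewrite /Q mem_pblock xc tau2// andbT /=.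
  rewrite -(cover_partition tauS); apply/fintype.subsetP => y yB.
  by apply/finset.bigcupP; exists (finset.pblock tau x).
rewrite (partition_big (fun tau => finset.pblock tau x) Q)/=; last first.
  by move=> tau /blockP[].
transitivity (\sum_(B | Q B) lam * m #|S :\: B|)%R.
  apply: eq_bigr => B /and3P[xB BS B2].
  have Bn0 : B != finset.set0 by apply/set0Pn; exists x.
  rewrite (reindex_onto (fun tau => B |: tau)%SET (fun tau => tau :\ B)%SET)/=; last first.
    by move=> tau /andP[/blockP[bt _] /eqP <-]; rewrite finset.setD1K.
  rewrite -IH; last first.
    apply: leq_trans (_ : #|S| <= k)%N => //; apply/proper_card/properP; split; first exact: finset.subsetDl.
    by exists x; rewrite // !inE xB.
  rewrite big_distrr /=.
  have condE tau : [&& thick_partition (B |: tau)%SET S, finset.pblock (B |: tau)%SET x == B &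
      ((B |: tau) :\ B)%SET == tau] = thick_partition tau (S :\: B).
    apply/idP/idP.
      move=> /and3P[/andP[p /forall_inP h] _ /eqP tauE]; apply/andP; split.
        rewrite -{1}tauE; apply: partitionD1 => //; by rewrite finset.setU11.
      apply/forall_inP => A At; apply: h; by rewrite inE At orbT.
    move=> /andP[p /forall_inP h].
    have Bt : B \notin tau.
      apply/negP => Bt; have : x \in finset.cover tau.
        by apply/finset.bigcupP; exists B.
      by rewrite (cover_partition p) !inE xB.
    have pU : finset.partition (B |: tau)%SET S.
      have SE : (B :|: (S :\: B))%SET = S.
        apply/setP => z; rewrite !inE; case zB: (z \in B) => //=.
        by rewrite (fintype.subsetP BS).
      rewrite -SE; apply: partitionU1 => //.
      by rewrite -finset.setI_eq0 finset.setIDA; apply/eqP/setP => z; rewrite !inE; case: (z \in B); rewrite ?andbF.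
    apply/and3P; split.
    - apply/andP; split => //; apply/forall_inP => A; rewrite !inE => /predU1P[->//|]; exact: h.
    - apply/eqP/def_pblock => //; [by case/and3P: pU|by rewrite finset.setU11].
    - by rewrite finset.setU1K.
  apply: eq_big => [tau|tau]; first by rewrite -andbA condE.
  rewrite -andbA condE => /andP[p _].
  have Bt : B \notin tau.
    apply/negP => Bt; have : x \in finset.cover tau by apply/finset.bigcupP; exists B.
    by rewrite (cover_partition p) !inE xB.
  by rewrite finset.cardsU1 Bt exprS.
have xS' : #|S| = #|S :\ x|.+1 by rewrite (finset.cardsD1 x) xS.
rewrite xS' mS -sum_proper_subsets big_distrr /=.
(* The sum runs over the complement [C] of the block; the block has at least two elements iff [C] is
   a proper subset of [S :\ x]. *)
rewrite (reindex_onto (fun C => S :\: C)%SET (fun B => S :\: B)%SET)/=; last first.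
  by move=> B /and3P[_ BS _]; exact: setDDK.
apply: eq_big => [C|C /andP[_ /eqP ->]//].
apply/andP/andP => [[/and3P[]]|[CS cC]].
  rewrite inE => /andP[xC _] _ c2 /eqP CE.
  have CS : C \subset S by rewrite -CE finset.subsetDl.
  split; first by rewrite finset.subsetD1 CS.
  move: c2; rewrite finset.cardsDS// ; lia.
have [CS1 xC] : C \subset S /\ x \notin C by move: CS; rewrite finset.subsetD1 => /andP[].
rewrite /Q inE xC xS finset.subsetDl finset.cardsDS//; split; first by move: cC; rewrite /=; lia.
by apply/eqP/setDDK.
Qed.

End partition_sum.

Section tuple_sums.
Context {R : comNzRingType}.

Lemma big_tuple_cons (T : finType) n (G : seq T -> R) :
  (\sum_(t : n.+1.-tuple T) G t = \sum_x \sum_(t : n.-tuple T) G (x :: t))%R.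
Proof.
rewrite pair_big /=.
rewrite (reindex (fun p : T * n.-tuple T => [tuple of p.1 :: p.2])) //=.
exists (fun t => (thead t, [tuple of behead t])) => [[x t] _|t _] /=.
  by congr pair; apply: val_inj.
by apply: val_inj; case/tupleP: t => x t.
Qed.

Lemma big_tuple0 (T : finType) (G : seq T -> R) :
  (\sum_(t : 0.-tuple T) G t = G [::])%R.
Proof.
by rewrite (big_pred1 [tuple]) // => t; rewrite [t]tuple0 /= eqxx.
Qed.


(** The discrete counterpart of [iterint]. Weighted by the measures of the cells it is an integral
    of a simple kernel, weighted by the centered counts it is the multiple integral. *)
Fixpoint wsum (T : finType) (x : T -> R) n (G : seq T -> R) : R :=
  if n is n'.+1 then (\sum_i x i * wsum x n' (fun s => G (i :: s)))%R else G [::].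

Lemma wsumE (T : finType) (x : T -> R) n (G : seq T -> R) :
  wsum x n G = (\sum_(t : n.-tuple T) G t * \prod_(i <- t) x i)%R.
Proof.
elim: n G => [|n IH] G /=.
  by rewrite (big_tuple0 (fun t => G t * \prod_(i <- t) x i)%R) big_nil mulr1.
rewrite (big_tuple_cons n (fun t => G t * \prod_(i <- t) x i)%R).
apply: eq_bigr => i _; rewrite IH mulr_sumr; apply: eq_bigr => t _.
by rewrite big_cons mulrCA.
Qed.

Lemma big_tuple_zip (L T : finType) n (G : seq (L * T) -> R) :
  (\sum_(w : n.-tuple L) \sum_(x : n.-tuple T) G (zip w x) =
   \sum_(v : n.-tuple (L * T)) G v)%R.
Proof.
elim: n G => [|n IH] G.
  rewrite big_tuple0 (big_tuple0 (fun w => \sum_(x : 0.-tuple T) G (zip w x))%R).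
  by rewrite (big_tuple0 (fun x => G (zip [::] x))).
rewrite (big_tuple_cons n (fun w => \sum_(x : n.+1.-tuple T) G (zip w x))%R) big_tuple_cons.
rewrite [RHS](eq_bigr (fun p : L * T => \sum_(v : n.-tuple (L * T)) G ((p.1, p.2) :: v)))%R; last by case.
rewrite -(pair_bigA _ (fun l t => \sum_(v : n.-tuple (L * T)) G ((l, t) :: v)))%R /=.
apply: eq_bigr => l _.
rewrite (eq_bigr (fun w : n.-tuple L => \sum_t \sum_(x : n.-tuple T) G ((l, t) :: zip w x)))%R; last first.
  by move=> w _; rewrite (big_tuple_cons n (fun x => G (zip (l :: w) x))).
rewrite exchange_big /=; apply: eq_bigr => t _.
exact: (IH (fun v => G ((l, t) :: v))).
Qed.

(** Each set of [n] elements is listed in [n!] orders; both the factor [q!] of the integral and the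
    weight [1/N!] of the words originate here. *)
Lemma sum_uniq_tuples (T : finType) n (G : seq T -> R) :
  (forall s s', perm_eq s s' -> G s = G s') -> (forall s, ~~ uniq s -> G s = 0%R) ->
  (\sum_(t : n.-tuple T) G t = n`!%:R * \sum_(K : {set T} | #|K| == n) G (enum K))%R.
Proof.
move=> Gp Gu.
rewrite (bigID (fun t : n.-tuple T => uniq t))/= [X in (_ + X)%R]big1 ?addr0; last first.
  by move=> t; exact: Gu.
rewrite (partition_big (fun t : n.-tuple T => [set x in t]%SET) (fun K => #|K| == n))/=; last first.
  by move=> t ut; rewrite cardsE (card_uniqP ut) size_tuple.
rewrite mulr_sumr; apply: eq_bigr => K /eqP Kn.
rewrite (eq_bigr (fun=> G (enum K))); last first.
  move=> t /andP[ut /eqP <-]; apply: Gp; apply: uniq_perm => //; first exact: enum_uniq.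
  by move=> x; rewrite mem_enum inE.
rewrite sumr_const mulr_natl; congr (_ *+ _)%R.
have <- : #|[set t : n.-tuple T | all (mem K) t & uniq t]%SET| = n`!.
  by rewrite card_uniq_tuples Kn ffactnn.
apply: eq_card => t; rewrite !inE.
rewrite [RHS]andbC; rewrite unfold_in; have [ut|//] := boolP (uniq t) => /=.
apply/eqP/allP => [tK x xt|h]; first by rewrite -tK /= inE.
apply/eqP; rewrite eqEcard; apply/andP; split.
  by apply/fintype.subsetP => x; rewrite inE; exact: h.
by rewrite cardsE (card_uniqP ut) size_tuple Kn.
Qed.

End tuple_sums.

Section simple_kernels.
Context {R : realType} {d d' : measure_display}.
Context {Z : measurableType d} {Omega : measurableType d'}.
Variables (P : probability Omega R) (mu : {sigma_finite_measure set Z -> \bar R})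
  (eta : R.-ker Omega ~> Z).
Hypothesis Zborel : borel_space R Z.
Hypothesis mu_atomless : atomless mu.
Hypothesis Peta : is_poisson_measure P mu eta.

Section system.
Variables (I : finType) (A : I -> set Z).
Hypothesis mA : forall i, measurable (A i).
Hypothesis Aoo : forall i, mu (A i) < +oo.
Hypothesis tA : trivIset setT A.

Local Notation lam := (fun i => fine (mu (A i))).
Local Notation xi w := (fun i => centered mu eta (A i) w).

(** [None] stands for the complement of the cells, on which the coefficients vanish. *)
Definition index_of (z : Z) : option I := [pick i | `[< A i z >]].

Lemma index_ofP z i : index_of z = Some i <-> A i z.
Proof.
rewrite /index_of; case: pickP => [j /asboolP Aj|h]; last first.
  by split => // Ai; have := h i; move/asboolP: Ai => ->.
split=> [[<-//]|Ai]; congr Some; apply/eqP/negPn/negP => ji.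
by move/trivIsetP: tA => /(_ j i Logic.I Logic.I ji); apply/eqP/set0P; exists z.
Qed.

Lemma sum_index_of (H : option I -> R) z : H None = 0%R ->
  (H (index_of z) = \sum_i H (Some i) * \1_(A i) z)%R.
Proof.
move=> H0; case E : (index_of z) => [i|].
  rewrite (bigD1 i)//= indicE mem_set; last exact/index_ofP.
  rewrite mulr1 big1 ?addr0// => j ji; rewrite indicE memNset ?mulr0//.
  by move=> /index_ofP; rewrite E => -[/esym/eqP]; rewrite (negbTE ji).
rewrite H0 big1// => i _; rewrite indicE memNset ?mulr0// => /index_ofP.
by rewrite E.
Qed.

Lemma integral_index_of (H : option I -> R) : H None = 0%R -> (forall i, 0 <= H i)%R ->
  \int[mu]_z (H (index_of z))%:E = (\sum_i lam i * H (Some i))%:E.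
Proof.
move=> H0 Hge0; under eq_integral do rewrite sum_index_of// -sumEFin.
rewrite ge0_integral_sum//; last 2 first.
- move=> i; apply/measurable_EFinP; exact: measurable_funM.
- by move=> i z _; rewrite lee_fin mulr_ge0.
rewrite -sumEFin; apply: eq_bigr => i _.
under eq_integral do rewrite EFinM.
rewrite ge0_integralZl_EFin//; last by apply/measurable_EFinP; exact: (measurable_indic (mA i)).
by rewrite integral_indic// setIT EFinM fineK ?ge0_fin_numE// muleC.
Qed.

Lemma seq_measurable_index (Phi : seq (option I) -> R) :
  (forall s, None \in s -> Phi s = 0%R) ->
  seq_measurable (fun s => (Phi (map index_of s))%:E).
Proof.
move=> PhiN n; apply/measurable_EFinP; elim: n Phi PhiN => [|n IH] Phi PhiN.
  rewrite (_ : (fun _ => _) = cst (Phi [::]))//.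
  by apply/funext => x; rewrite tuple0.
rewrite (_ : (fun _ => _) = (fun x : n.+1.-tuple Z => \sum_i
    Phi (Some i :: map index_of (tval [tuple of behead x])) * \1_(A i) (tnth x ord0))%R).
  apply: measurable_sum => i; apply: measurable_funM.
    apply: (measurableT_comp (f := fun y : n.-tuple Z => Phi (Some i :: map index_of y))).
      by apply: (IH (fun s => Phi (Some i :: s))) => s sN; apply: PhiN; rewrite inE sN orbT.
    exact: measurable_behead.
  exact: (measurableT_comp (measurable_indic (mA i)) (@measurable_tnth _ _ _ ord0)).
apply/funext => x; case/tupleP: x => z x /=.
rewrite (tnth_nth z) /=.
by rewrite (sum_index_of (H := fun o => Phi (o :: map index_of x)))// PhiN// mem_head.
Qed.

Lemma iterint_index (Phi : seq (option I) -> R) n : (forall s, 0 <= Phi s)%R ->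
  (forall s, size s = n -> None \in s -> Phi s = 0%R) ->
  iterint mu n (fun s => (Phi (map index_of s))%:E) =
  (wsum lam n (fun s => Phi (map Some s)))%:E.
Proof.
elim: n Phi => [//|n IH] Phi Phi0 PhiN /=.
pose H o : R := if o is Some i then wsum lam n (fun s => Phi (Some i :: map Some s)) else 0%R.
transitivity (\int[mu]_z (H (index_of z))%:E).
  apply: eq_integral => z _; rewrite /H; case E : (index_of z) => [i|].
    rewrite -(IH (fun s => Phi (Some i :: s)))//.
    by move=> s sn sN; apply: PhiN; rewrite /= ?sn// inE sN orbT.
  rewrite (@eq_iterint _ _ _ mu _ _ (fun=> 0)); last first.
    by move=> s sn; rewrite PhiN//= ?size_map ?sn// mem_head.
  by elim: (n) => //= m IHm; under eq_integral do rewrite IHm; rewrite integral0.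
rewrite integral_index_of//.
move=> [i|//]; rewrite /H wsumE; apply: sumr_ge0 => t _; apply: mulr_ge0 => //.
by apply: prodr_ge0 => j _; exact: fine_ge0.
Qed.

Definition simple_coef q (a : seq (option I) -> R) : Prop :=
  [/\ forall s s', perm_eq s s' -> a s = a s',
      forall s, None \in s -> a s = 0%R,
      forall s, ~~ uniq s -> a s = 0%R &
      forall s, size s <> q -> a s = 0%R].

Definition simple_fun (a : seq (option I) -> R) (s : seq Z) : R := a (map index_of s).

Definition simple_integral q (a : seq (option I) -> R) (w : Omega) : R :=
  wsum (xi w) q (fun s => a (map Some s)).

Lemma simple_integral_sets q a w : simple_coef q a ->
  simple_integral q a w =
  (q`!%:R * \sum_(K : {set I}) a (map Some (enum K)) * \prod_(k in K) xi w k)%R.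
Proof.
move=> [ap aN au aq]; rewrite /simple_integral wsumE.
rewrite (sum_uniq_tuples q (G := fun s => a (map Some s) * \prod_(i <- s) xi w i))%R; last 2 first.
- move=> s s' ss'; congr (_ * _)%R; last exact: perm_big.
  by apply: ap; exact: perm_map.
- move=> s us; rewrite au ?mul0r//; rewrite map_inj_uniq//; exact: Some_inj.
congr (_ * _)%R; rewrite big_mkcond /=; apply: eq_bigr => K _.
rewrite big_enum /=; case: eqP => // Kq.
by rewrite aq ?mul0r// size_map -cardE.
Qed.

Lemma all_moments_simple_integral q a : all_moments P (simple_integral q a).
Proof.
rewrite (_ : simple_integral q a = fun w =>
    (\sum_(t : q.-tuple I) a (map Some t) * \prod_(i <- t) xi w i)%R); last first.
  by apply/funext => w; rewrite /simple_integral wsumE.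
apply: all_moments_sum => t _; apply: all_momentsM.
  exact: (all_moments_cst P (a (map Some t))).
by apply: all_moments_prod => i _; exact: (all_moments_centered Peta).
Qed.

Local Notation E := (expect P).

Lemma expect_centered_pow (n : I -> nat) :
  (E (fun w => \prod_k xi w k ^+ n k) = \prod_k E (fun w => xi w k ^+ n k))%R.
Proof. exact: (centered_independent Zborel mu_atomless Peta). Qed.

Lemma iterint_simple_sq q a : simple_coef q a ->
  iterint mu q (fun s => (simple_fun a s ^+ 2)%:E) =
  (q`!%:R * \sum_(K : {set I}) a (map Some (enum K)) ^+ 2 * \prod_(k in K) lam k)%:E.
Proof.
move=> [ap aN au aq].
rewrite (iterint_index (Phi := fun s => a s ^+ 2)%R); last 2 first.
- by move=> s; exact: sqr_ge0.
- by move=> s _ sN; rewrite aN// expr0n.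
rewrite wsumE (sum_uniq_tuples q (G := fun s => a (map Some s) ^+ 2 * \prod_(i <- s) lam i))%R; last 2 first.
- move=> s s' ss'; congr (_ ^+ 2 * _)%R; last exact: perm_big.
  by apply: ap; exact: perm_map.
- move=> s us; rewrite au ?expr0n ?mul0r//; rewrite map_inj_uniq//; exact: Some_inj.
congr (_ * _)%:E; rewrite big_mkcond /=; apply: eq_bigr => K _.
rewrite big_enum /=; case: eqP => // Kq.
by rewrite aq ?expr0n ?mul0r// size_map -cardE.
Qed.

(** Two different index sets differ in some cell, which then occurs with exponent one and has mean
    zero; only the diagonal terms remain. *)
Lemma simple_isometry q a : simple_coef q a ->
  (E (fun w => simple_integral q a w ^+ 2))%:E =
  q`!%:R%:E * iterint mu q (fun s => (simple_fun a s ^+ 2)%:E).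
Proof.
move=> ca; rewrite iterint_simple_sq// -EFinM; congr (_%:E).
pose c (K : {set I}) := a (map Some (enum K)).
have M1 k : E (fun w => xi w k ^+ 1)%R = 0%R.
  by rewrite (centered_momentS Peta (mA k) (Aoo k)) big_ord0 mulr0.
have M2 k : E (fun w => xi w k ^+ 2)%R = lam k.
  rewrite (centered_momentS Peta (mA k) (Aoo k)) big_ord_recl big_ord0 addr0.
  by rewrite centered_moment0 !mulr1.
have -> : (fun w => simple_integral q a w ^+ 2)%R = (fun w => \sum_(p : {set I} * {set I})
   (q`!%:R ^+ 2 * c p.1 * c p.2) * \prod_k xi w k ^+ ((k \in p.1) + (k \in p.2)))%R.
  apply/funext => w; rewrite simple_integral_sets// exprMn [X in (_ * X)%R]expr2 big_distrlr /=.
  rewrite pair_big /= mulr_sumr; apply: eq_bigr => -[K K'] _ /=.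
  transitivity (q`!%:R ^+ 2 * c K * c K' *
    ((\prod_(k in K) xi w k) * (\prod_(k in K') xi w k)))%R; first by rewrite /c; ring.
  congr (_ * _)%R.
  rewrite !(big_mkcond (fun j => j \in _)) -big_split /=; apply: eq_bigr => j _.
  by rewrite exprD; case: (j \in K); case: (j \in K'); rewrite ?expr0 ?expr1.
have amp (n : I -> nat) : all_moments P (fun w => \prod_k xi w k ^+ n k)%R.
  by apply: all_moments_prod => k _; apply: all_momentsX; exact: (all_moments_centered Peta).
rewrite expect_sum; last first.
  by move=> p _; apply: all_momentsM => //; exact: (all_moments_cst P (q`!%:R ^+ 2 * c p.1 * c p.2)%R).
rewrite -(pair_bigA _ (fun K K' => E (fun w => (q`!%:R ^+ 2 * c K * c K') *
   \prod_k xi w k ^+ ((k \in K) + (k \in K')))))%R /= !mulr_sumr.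
apply: eq_bigr => K _; rewrite (bigD1 K)//= [X in (_ + X)%R]big1 ?addr0; last first.
  move=> K' KK'; rewrite expectZ// expect_centered_pow.
  have [k kK] : exists k, (k \in K) != (k \in K').
    apply/existsP; apply: contra_neqT KK' => /existsPn h; apply/setP => k.
    by apply/esym/eqP/negPn; exact: h.
  rewrite (bigD1 k)//= [X in (_ * (X * _))%R](_ : _ = 0%R) ?mul0r ?mulr0//.
  by move: kK; case: (k \in K); case: (k \in K') => // _; exact: M1.
rewrite expectZ// expect_centered_pow.
rewrite [X in (_ * X)%R](_ : _ = \prod_(k in K) lam k)%R; first by rewrite /c; ring.
rewrite [RHS]big_mkcond; apply: eq_bigr => k _.
by case: (k \in K); [exact: M2|exact: centered_moment0].
Qed.

(** Thick letters are nonempty, so every variable is read by some copy; this carries the vanishing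
    of a kernel over to the whole word. *)
Lemma mem_row_of (T : eqType) (w : seq letter) (s : seq T) x : size s = size w ->
  thick_word w -> x \in s -> exists i, x \in row_of i (zip w s).
Proof.
elim: w s => [|S w IH] [|y s] //= [sw] /andP[S2 w2].
rewrite inE => /predU1P[->|xs].
  have [i iS] : exists i, i \in S by apply/card_gt0P; exact: ltnW S2.
  by exists i; rewrite row_of_cons iS mem_head.
have [i xi] := IH s sw w2 xs; exists i; rewrite row_of_cons.
by case: ifP => // _; rewrite inE xi orbT.
Qed.

Lemma Jword_simple q (a : 'I_4 -> seq (option I) -> R) w :
  (forall i, simple_coef q (a i)) -> (forall i s, 0 <= a i s)%R ->
  thick_word w ->
  Jword mu (fun i => simple_fun (a i)) w =
  (wsum lam (size w) (fun k => \prod_i a i (map Some (row_of i (zip w k)))))%:E.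
Proof.
move=> ca a0 w2; rewrite /Jword /wordint.
pose Phi s := (\prod_i a i (row_of i (zip w s)))%R.
transitivity (iterint mu (size w) (fun s => (Phi (map index_of s))%:E)).
  apply: eq_iterint => s ss; rewrite /wordprod /Phi; congr (_%:E).
  by apply: eq_bigr => i _; rewrite /simple_fun map_row_of.
rewrite iterint_index.
- by congr (_%:E); congr wsum; apply/funext => k; apply: eq_bigr => i _; rewrite map_row_of.
- by move=> s; apply: prodr_ge0 => i _.
- move=> s ss sN; have [i Ni] := mem_row_of ss w2 sN.
  by rewrite /Phi (bigD1 i)//=; have [_ -> // _ _] := ca i; rewrite mul0r.
Qed.

Section word_sum.
Variables (q : nat) (a : 'I_4 -> seq (option I) -> R).
Hypothesis ca : forall i, simple_coef q (a i).
Hypothesis a0 : forall i s, (0 <= a i s)%R.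

(** The term of a word whose variables have been placed in cells. It is symmetric in the pairs and
    vanishes on repetitions, so sums over lists become sums over sets of pairs. *)
Let Psi (v : seq (letter * I)) : R :=
  ((thick_word (unzip1 v))%:R * (\prod_i a i (map Some (row_of i v)) * \prod_(p <- v) lam p.2))%R.

Let Psi_perm v v' : perm_eq v v' -> Psi v = Psi v'.
Proof.
move=> vv'; rewrite /Psi; congr (_%:R * (_ * _))%R; last exact: perm_big.
  by congr nat_of_bool; apply: perm_all; exact: perm_map.
apply: eq_bigr => i _; have [ap _ _ _] := ca i.
by apply: ap; apply: perm_map; exact: perm_row_of.
Qed.

Let Psi_row0 v i : a i (map Some (row_of i v)) = 0%R -> Psi v = 0%R.
Proof. by move=> h; rewrite /Psi (bigD1 i)//= h !mul0r mulr0. Qed.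

Let Psi_thick v : ~~ thick_word (unzip1 v) -> Psi v = 0%R.
Proof. by move=> /negbTE h; rewrite /Psi h mul0r. Qed.

(** Copy [i] would read the cell [k] twice, and its coefficient vanishes on diagonals. The letters
    placed in one cell are therefore pairwise disjoint. *)
Let Psi_twice v i (S S' : letter) (k : I) : (S, k) \in v -> (S', k) \in rem (S, k) v ->
  i \in S -> i \in S' -> Psi v = 0%R.
Proof.
move=> Sv S'v iS iS'; apply: (@Psi_row0 _ i); have [ap _ au _] := ca i.
rewrite (ap _ (map Some (row_of i ((S, k) :: (S', k) :: rem (S', k) (rem (S, k) v))))); last first.
  apply: perm_map; apply: perm_row_of; apply: (perm_trans (perm_to_rem Sv)).
  by rewrite perm_cons; exact: perm_to_rem.
by apply: au; rewrite !row_of_cons iS iS' /= mem_head.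
Qed.

Let Psi_uniq v : ~~ uniq v -> Psi v = 0%R.
Proof.
move=> uv; have [tv|] := boolP (thick_word (unzip1 v)); last exact: Psi_thick.
have [[S k] [Sv Sv']] : exists p, p \in v /\ p \in rem p v.
  elim: v uv {tv} => //= p v IH; rewrite negb_and negbK => /orP[pv|/IH[p' [h1 h2]]].
    by exists p; rewrite eqxx mem_head.
  exists p'; rewrite inE h1 orbT; split => //.
  by case: eqP => // _; rewrite inE h2 orbT.
have S2 : (2 <= #|S|)%N by apply: (allP tv); apply/mapP; exists (S, k).
have [i iS] : exists i, i \in S by apply/card_gt0P; exact: ltnW S2.
exact: (Psi_twice Sv Sv' iS iS).
Qed.

(** Four rows of length [q] offer [4 q] places and every letter takes at least two; hence the bound
    [2 q] on the length of the words. *)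
Let Psi_size v : (2 * q < size v)%N -> Psi v = 0%R.
Proof.
move=> qv; have [tv|] := boolP (thick_word (unzip1 v)); last exact: Psi_thick.
have sumE : (2 * size v <= \sum_i size (row_of i v))%N.
  elim: v tv {qv} => [|[S k] v IH] /=; first by rewrite big1.
  move=> /andP[S2 /IH h]; rewrite mulnS.
  rewrite (eq_bigr (fun i => (i \in S) + size (row_of i v)))%N; last first.
    by move=> i _; rewrite row_of_cons; case: (i \in S).
  by rewrite big_split /= leq_add// -[in X in (_ <= X)%N]big_mkcond sum1_card.
have [/forallP h|/forallPn[i ri]] := boolP [forall i, size (row_of i v) == q].
  move: sumE; rewrite (eq_bigr (fun=> q)) => [|i _]; last exact/eqP.
  by rewrite sum_nat_const card_ord; lia.
apply: (@Psi_row0 _ i); have [_ _ _ aq] := ca i; apply: aq.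
by rewrite size_map; exact/eqP.
Qed.

Let word_sumE : fourth_moment_sum mu q (fun i => simple_fun (a i)) =
  (q`!%:R ^+ 4 * \sum_(V : {set letter * I}) Psi (enum V))%:E.
Proof.
rewrite /fourth_moment_sum [RHS]EFinM; congr (_ * _).
have wE N : \sum_(w : N.-tuple letter | thick_word w) Jword mu (fun i => simple_fun (a i)) w =
    (N`!%:R * \sum_(V : {set letter * I} | #|V| == N) Psi (enum V))%:E.
  rewrite -(sum_uniq_tuples N Psi_perm Psi_uniq) -big_tuple_zip -sumEFin big_mkcond.
  apply: eq_bigr => w _; case: ifP => [w2|w2].
    rewrite (Jword_simple ca a0 w2) size_tuple wsumE; congr (_%:E); apply: eq_bigr => x _.
    rewrite /Psi unzip1_zip ?size_tuple// w2 mul1r; congr (_ * _)%R.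
    have {1}-> : tval x = unzip2 (zip w x) by rewrite unzip2_zip ?size_tuple.
    by rewrite big_map.
  rewrite big1// => x _; apply: Psi_thick.
  by rewrite unzip1_zip ?size_tuple ?w2.
rewrite (eq_bigr (fun N : 'I_(2 * q).+1 =>
  (\sum_(V : {set letter * I} | #|V| == N) Psi (enum V))%:E)); last first.
  move=> N _; have f0 : (N`!%:R != 0 :> R)%R by rewrite pnatr_eq0 -lt0n fact_gt0.
  by rewrite wE -EFinM mulrA mulVf// mul1r.
rewrite sumEFin; congr (_%:E).
rewrite (exchange_big_dep xpredT)//=; apply: eq_bigr => V _.
have [Vq|Vq] := ltnP #|V| (2 * q).+1.
  by rewrite (big_pred1 (Ordinal Vq))// => N; rewrite eq_sym.
rewrite big_pred0 ?Psi_size -?cardE// => N.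
by apply/negbTE; rewrite neq_ltn (leq_trans _ Vq) ?orbT.
Qed.

Let valid (t : {set letter}) := thick_partition t (finset.cover t).
Let rowset (tau : {ffun I -> {set letter}}) i : {set I} :=
  [set k | i \in finset.cover (tau k)]%SET.

(** A set of pairs amounts to a set of letters for each cell. The term survives only if in each cell
    these letters are thick and disjoint, that is, form a partition of the set of copies reading
    that cell. *)
Let Psi_family (tau : {ffun I -> {set letter}}) :
  Psi (enum [set p : letter * I | p.1 \in tau p.2]%SET) =
  if [forall k, valid (tau k)] then
    (\prod_i a i (map Some (enum (rowset tau i))) * \prod_k lam k ^+ #|tau k|)%R else 0%R.
Proof.
set V := finset _; set v := enum V.
have vE S k : ((S, k) \in v) = (S \in tau k) by rewrite mem_enum inE.
have uv : uniq v by exact: enum_uniq.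
have prodE : (\prod_(p <- v) lam p.2 = \prod_k lam k ^+ #|tau k|)%R.
  rewrite /v big_enum /=.
  rewrite (eq_bigl (fun p : letter * I => (p.1 \in tau p.2))); last by move=> p; rewrite inE.
  rewrite -(pair_big_dep xpredT (fun S k => S \in tau k) (fun S k => lam k))/=.
  rewrite (exchange_big_dep xpredT)//=; apply: eq_bigr => k _.
  by rewrite prodr_const.
clearbody v.
have [tv|tv] := boolP (thick_word (unzip1 v)); last first.
  rewrite Psi_thick//; case: ifP => // /forallP h.
  move: tv => /allPn[_ /mapP[[S k] Skv ->] /negP[]].
  by have /andP[_ /forall_inP] := h k; apply; rewrite -vE.
have thick k S : S \in tau k -> (2 <= #|S|)%N.
  by rewrite -vE => Sv; apply: (allP tv); apply/mapP; exists (S, k).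
have [/forallP trv|/forallPn[k ntr]] := boolP [forall k, finset.trivIset (tau k)]; last first.
  rewrite (_ : [forall k, valid (tau k)] = false); last first.
    apply/negbTE/forallPn; exists k; apply: contra ntr.
    by move=> /andP[/and3P[]].
  have [S [S' [Sk S'k SS' ndis]]] : exists S S', [/\ S \in tau k, S' \in tau k, S != S' & ~~ [disjoint S & S']].
    apply: contrapT => h; move/negP: ntr; apply; apply/finset.trivIsetP => S S' Sk S'k SS'.
    by apply: contrapT => nd; apply: h; exists S, S'; split => //; exact/negP.
  have [i /andP[iS iS']] : exists i, (i \in S) && (i \in S').
    by move/pred0Pn: ndis => [i]; exists i.
  apply: (Psi_twice (S := S) (S' := S') (k := k) _ _ iS iS'); first by rewrite vE.
  by rewrite mem_rem_uniq// !inE vE S'k andbT; apply: contra_neq SS' => -[].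
have -> : [forall k, valid (tau k)].
  apply/forallP => k; rewrite /valid /thick_partition /finset.partition eqxx trv /=.
  apply/andP; split; last by apply/forall_inP => S; exact: thick.
  by apply/negP => /thick; rewrite cards0.
rewrite /Psi tv mul1r; congr (_ * _)%R; last exact: prodE.
  apply: eq_bigr => i _; have [ap _ _ _] := ca i; apply: ap; apply: perm_map.
  apply: uniq_perm; last 2 first.
  - exact: enum_uniq.
  - move=> k; rewrite mem_enum inE; apply/mapP/finset.bigcupP.
      by move=> [[S k']]; rewrite mem_filter vE /= => /andP[iS Sk] ->; exists S.
    by move=> [S Sk iS]; exists (S, k) => //; rewrite mem_filter vE /= iS Sk.
  rewrite map_inj_in_uniq; first exact: filter_uniq uv.
  move=> -[S k] [S' k'].
  rewrite !mem_filter !vE /= => /andP[iS Sk] /andP[iS' Sk'] kk'.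
  rewrite -kk' in Sk' *; congr pair; apply/eqP; apply: contraT => SS'.
  have /finset.trivIsetP/(_ S S' Sk Sk' SS') := trv k.
  by move/pred0P/(_ i); rewrite /= iS iS'.
Qed.

(** Expanding the product chooses an index set for each copy; a cell then enters with the number of
    copies that chose it. Independence leaves a product of centered moments, each a sum over thick
    partitions of these copies, and the blocks are the letters. *)
Lemma simple_fourth_moment :
  (E (fun w => \prod_i simple_integral q (a i) w))%:E =
  fourth_moment_sum mu q (fun i => simple_fun (a i)).
Proof.
rewrite word_sumE; congr (_%:E).
pose c i (K : {set I}) := a i (map Some (enum K)).
pose rows (K : {ffun 'I_4 -> {set I}}) k : letter := [set i | k \in K i]%SET.
have -> : (fun w => \prod_i simple_integral q (a i) w)%R =
  (fun w => \sum_(K : {ffun 'I_4 -> {set I}})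
    (q`!%:R ^+ 4 * \prod_i c i (K i)) * \prod_k xi w k ^+ #|rows K k|)%R.
  apply/funext => w; under eq_bigr do rewrite simple_integral_sets//.
  rewrite big_split /= prodr_const card_ord bigA_distr_bigA mulr_sumr.
  apply: eq_bigr => K _; rewrite big_split /= mulrA; congr (_ * _)%R.
  under eq_bigr do rewrite big_mkcond /=.
  rewrite exchange_big /=; apply: eq_bigr => k _.
  rewrite -big_mkcond /= -prodr_const; apply: eq_bigl => i.
  by rewrite inE.
have amp (n : I -> nat) : all_moments P (fun w => \prod_k xi w k ^+ n k)%R.
  by apply: all_moments_prod => k _; apply: all_momentsX; exact: (all_moments_centered Peta).
rewrite expect_sum; last first.
  by move=> K _; apply: all_momentsM => //; exact: (all_moments_cst P (q`!%:R ^+ 4 * \prod_i c i (K i))%R).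
rewrite (eq_bigr (fun K : {ffun 'I_4 -> {set I}} => q`!%:R ^+ 4 *
  \sum_(tau : {ffun I -> {set letter}} | [forall k, thick_partition (tau k) (rows K k)])
     \prod_i c i (K i) * \prod_k lam k ^+ #|tau k|))%R; last first.
  move=> K _; rewrite expectZ// expect_centered_pow -mulrA -mulr_sumr; congr (_ * (_ * _))%R.
  rewrite (eq_bigr (fun k => \sum_(t | thick_partition t (rows K k)) lam k ^+ #|t|))%R; last first.
    move=> k _; rewrite (sum_thick_partition (m := fun n => E (fun w => xi w k ^+ n)%R))//.
      exact: centered_moment0.
    exact: (centered_momentS Peta (mA k) (Aoo k)).
  rewrite bigA_distr_big_dep; apply: eq_bigl => tau.
  by apply/familyP/forallP => h k; have := h k.
rewrite -mulr_sumr; congr (_ * _)%R.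
rewrite (exchange_big_dep xpredT)//=.
rewrite (reindex (fun tau : {ffun I -> {set letter}} => [set p : letter * I | p.1 \in tau p.2]%SET)) /=; last first.
  exists (fun V : {set letter * I} => [ffun k => [set S | (S, k) \in V]%SET]) => [tau _|V _].
    by apply/ffunP => k; rewrite ffunE; apply/setP => S; rewrite !inE.
  by apply/setP => -[S k]; rewrite !inE /= ffunE inE.
apply: eq_bigr => tau _; rewrite Psi_family.
case: ifPn => [/forallP vt|/forallPn[k nvt]]; last first.
  rewrite big_pred0// => K; apply/negbTE/forallPn; exists k; apply: contra nvt => h.
  by rewrite /valid (cover_partition (proj1 (andP h))).
(* After exchanging the sums, the partitions determine the index sets: copy [i] uses the cells whose
   blocks contain [i]. *)
rewrite (big_pred1 [ffun i => rowset tau i]); first by congr (_ * _)%R; apply: eq_bigr => i _; rewrite ffunE.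
move=> K; apply/forallP/eqP => [h|-> k].
  apply/ffunP => i; rewrite ffunE; apply/setP => k; rewrite inE.
  by rewrite (cover_partition (proj1 (andP (h k)))) inE.
rewrite (_ : rows _ k = finset.cover (tau k)); first exact: vt.
by apply/setP => i; rewrite inE ffunE inE.
Qed.

End word_sum.

End system.
End simple_kernels.

(** * Symmetrization of functions of tuples *)

Section symmetrization.
Context {R : realType}.

Definition symmetrize (T : eqType) q (b : q.-tuple T -> R) (s : seq T) : R :=
  if insub s is Some t then
    ((q`!%:R)^-1 * \sum_(p : 'S_q) b [tuple tnth (t : q.-tuple T) (p i) | i < q])%R else 0%R.

Lemma symmetrize_tuple (T : eqType) q (b : q.-tuple T -> R) (t : q.-tuple T) :
  symmetrize b t = ((q`!%:R)^-1 * \sum_(p : 'S_q) b [tuple tnth t (p i) | i < q])%R.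
Proof. by rewrite /symmetrize valK. Qed.

Lemma symmetrize_size (T : eqType) q (b : q.-tuple T -> R) s : size s <> q ->
  symmetrize b s = 0%R.
Proof. by move=> sq; rewrite /symmetrize insubN//; exact/eqP. Qed.

Lemma perm_eq_invariant (T : eqType) q (b : seq T -> R) :
  (forall s, size s <> q -> b s = 0%R) ->
  (forall (t : q.-tuple T) (p : 'S_q), b [tuple tnth t (p i) | i < q] = b t) ->
  forall s s', perm_eq s s' -> b s = b s'.
Proof.
move=> bq bp s s' ss'; have [sq|/eqP sq] := eqVneq (size s) q; last first.
  by rewrite !bq// -(perm_size ss').
have sq' : size s' = q by rewrite -(perm_size ss').
pose t := tcast sq (in_tuple s); pose t' := tcast sq' (in_tuple s').
have tE : tval t = s by rewrite val_tcast.
have tE' : tval t' = s' by rewrite val_tcast.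
move: ss'; rewrite -tE -tE' => /tuple_permP[p tp].
by rewrite tp; exact: (bp t' p).
Qed.

Lemma symmetrize_perm (T : eqType) q (b : q.-tuple T -> R) s s' : perm_eq s s' ->
  symmetrize b s = symmetrize b s'.
Proof.
apply: (perm_eq_invariant (q := q)); first exact: symmetrize_size.
move=> t p; rewrite !symmetrize_tuple; congr (_ * _)%R.
rewrite [RHS](reindex_inj (mulIg p))/=; apply: eq_bigr => p' _; congr b.
by apply: eq_from_tnth => i; rewrite !tnth_mktuple permM.
Qed.

Lemma sum_symmetrize (T : finType) q (b : q.-tuple T -> R) (c : seq T -> R) :
  (forall s s', perm_eq s s' -> c s = c s') ->
  (\sum_(t : q.-tuple T) symmetrize b t * c t = \sum_(t : q.-tuple T) b t * c t)%R.
Proof.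
move=> cP; under eq_bigr do rewrite symmetrize_tuple -mulrA mulr_suml mulr_sumr.
rewrite exchange_big /=.
transitivity (\sum_(p : 'S_q) (q`!%:R)^-1 * \sum_(t : q.-tuple T) b t * c t)%R.
  apply: eq_bigr => p _; rewrite -mulr_sumr; congr (_ * _)%R.
  pose g (t : q.-tuple T) := [tuple tnth t (p i) | i < q].
  rewrite [RHS](reindex g)/=; last first.
    exists (fun t => [tuple tnth t ((p^-1)%g i) | i < q]) => t _;
      by apply: eq_from_tnth => i; rewrite !tnth_mktuple ?permK ?permKV.
  apply: eq_bigr => t _; congr (_ * _)%R; apply: cP.
  by rewrite perm_sym; apply/tuple_permP; exists p.
rewrite sumr_const card_Sn -[LHS]mulr_natl mulrA mulfV ?mul1r//.
Qed.

(** The difference of the two sides is a variance. *)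
Lemma sqr_mean_le (I : finType) (x : I -> R) (n : nat) : #|I| = n -> (0 < n)%N ->
  ((n%:R^-1 * \sum_i x i) ^+ 2 <= n%:R^-1 * \sum_i x i ^+ 2)%R.
Proof.
move=> In n0; have n1 : (0 < n%:R :> R)%R by rewrite ltr0n.
set m := (n%:R^-1 * \sum_i x i)%R.
have sE : (\sum_i x i = n%:R * m)%R by rewrite /m mulrA mulfV ?mul1r// gt_eqF.
have : (0 <= \sum_i (x i - m) ^+ 2)%R by apply: sumr_ge0 => i _; exact: sqr_ge0.
have -> : (\sum_i (x i - m) ^+ 2 = \sum_i x i ^+ 2 - n%:R * m ^+ 2)%R.
  under eq_bigr do rewrite sqrrB; rewrite big_split sumrB /= sumr_const In sumrMnl.
  by rewrite -mulr_suml sE -[(m ^+ 2 *+ n)%R]mulr_natl; ring.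
move=> h.
by rewrite [X in (_ <= X)%R]mulrC ler_pdivlMr// mulrC -subr_ge0.
Qed.

End symmetrization.

(** * Invariance of iterated integrals under permutations *)

Section permuted_integral.
Context {R : realType} {d : measure_display} {Z : measurableType d}.
Variable mu : {sigma_finite_measure set Z -> \bar R}.

Lemma iterint_insert k n (h : seq Z -> \bar R) : seq_measurable h -> (forall s, 0 <= h s) ->
  iterint mu (k + n).+1 h =
  \int[mu]_z iterint mu (k + n) (fun s => h (take k s ++ z :: drop k s)).
Proof.
move=> mh h0; rewrite -addnS iterint_cat /=.
rewrite -(iterint_swap mu k (h := fun z s => iterint mu n (fun t => h (s ++ z :: t)))); last 2 first.
- move=> m.
  pose g (p : Z * m.-tuple Z) s := h (tval p.2 ++ p.1 :: s).
  apply: (measurable_iterint mu n (h := g)); first by move=> p s; exact: h0.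
  have : pseq_measurable (fun (x : m.-tuple Z * Z) s => h (tval x.1 ++ x.2 :: s)).
    exact: (pseq_measurable_cons (h := fun (x : m.-tuple Z) s => h (tval x ++ s))
      (pseq_measurable_catr mh)).
  apply: (pseq_measurable_comp (phi := fun p : Z * m.-tuple Z => (p.2, p.1))).
  by apply: measurable_fun_pair; [exact: measurable_snd|exact: measurable_fst].
- by move=> z s; exact: iterint_ge0.
apply: eq_integral => z _; rewrite iterint_cat; apply: eq_iterint => s sk.
by apply: eq_iterint => t tn; rewrite take_size_cat// drop_size_cat.
Qed.

Lemma seq_measurable_gather (h : seq Z -> \bar R) (p : seq nat) (z0 : Z) : seq_measurable h ->
  seq_measurable (fun s => h [seq nth z0 s i | i <- p]).
Proof.
move=> mh m; have szn (x : seq Z) : size [seq nth z0 x i | i <- p] = size p.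
  by rewrite size_map.
pose g (x : m.-tuple Z) : (size p).-tuple Z :=
  tcast (szn x) (in_tuple [seq nth z0 x i | i <- p]).
have -> : (fun x : m.-tuple Z => h [seq nth z0 x i | i <- p]) =
   (fun y : (size p).-tuple Z => h y) \o g by apply/funext => x; rewrite /= val_tcast.
apply: measurableT_comp; first exact: (mh (size p)).
apply/measurable_fun_tnthP => i.
have gE x : tnth (g x) i = nth z0 x (nth 0%N p i).
  by rewrite (tnth_nth z0) val_tcast (nth_map 0%N).
have [im|im] := ltnP (nth 0%N p i) m.
  rewrite (_ : _ \o g = fun x : m.-tuple Z => tnth x (Ordinal im)).
    exact: measurable_tnth.
  by apply/funext => x /=; rewrite gE (tnth_nth z0).
rewrite (_ : _ \o g = cst z0)//.
by apply/funext => x /=; rewrite gE nth_default// size_tuple.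
Qed.

(** The variable in position [k], the first one that [h] receives, is made outermost by Tonelli; the
    other positions form a permutation of [n] indices, to which the induction applies. *)
Lemma iterint_perm n (h : seq Z -> \bar R) (p : seq nat) (z0 : Z) :
  seq_measurable h -> (forall s, 0 <= h s) -> perm_eq p (iota 0 n) ->
  iterint mu n (fun s => h [seq nth z0 s i | i <- p]) = iterint mu n h.
Proof.
elim: n h p => [|n IH] h p mh h0 pn.
  by move: pn => /perm_nilP ->.
have sp : size p = n.+1 by rewrite (perm_size pn) size_iota.
case: p sp pn => [//|k p] [sp] pn.
have up : uniq (k :: p) by rewrite (perm_uniq pn) iota_uniq.
have mp i : i \in k :: p -> (i < n.+1)%N by rewrite (perm_mem pn) mem_iota.
have kn : (k <= n)%N by rewrite -ltnS mp// mem_head.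
have nE : n = (k + (n - k))%N by rewrite subnKC.
(* Removing position [k] lowers the later positions by one. *)
pose p' := map (unbump k) p.
have kp : k \notin p by move: up => /= /andP[].
have p'n : perm_eq p' (iota 0 n).
  have up' : uniq p'.
    rewrite map_inj_in_uniq; first by move: up => /= /andP[].
    move=> i j ip jp ij; rewrite -(@unbumpK k i) ?inE; last by apply: contraNneq kp => <-.
    by rewrite ij unbumpK// inE; apply: contraNneq kp => <-.
  apply: uniq_perm => //; first exact: iota_uniq.
  apply: (uniq_min_size up' _ _).2; last by rewrite size_map size_iota sp.
  move=> _ /mapP[i ip ->]; rewrite mem_iota add0n /=.
  have ik : i != k by apply: contraNneq kp => <-.
  have := mp i; rewrite inE ip orbT => /(_ isT) iN.
  by rewrite /unbump; move: ik iN kn; clear; case: (ltnP k i); lia.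
have mS : seq_measurable (fun s => h [seq nth z0 s i | i <- k :: p]).
  exact: seq_measurable_gather.
rewrite nE iterint_insert//.
rewrite -nE /=; apply: eq_integral => z _.
rewrite -(IH (fun s => h (z :: s)) p')//; last first.
  exact: (pseq_measurable_section z (seq_measurable_cons mh)).
apply: eq_iterint => s sn; congr h => /=.
have sk : size (take k s) = k by rewrite size_takel// sn.
congr cons; first by rewrite nth_cat sk ltnn subnn.
rewrite -map_comp; apply/eq_in_map => i ip /=.
have ik : i != k by apply: contraNneq kp => <-.
rewrite nth_cat sk /unbump; case: (ltngtP k i) ik => //= ki _.
  rewrite (_ : i - k = (i - k.+1).+1)%N; last by rewrite subnSK.
  by rewrite /= nth_drop; congr nth; lia.
by rewrite subn0 nth_take.
Qed.

End permuted_integral.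

(** * Refinement of systems of cells *)

Section refinement.
Context {R : realType} {d d' : measure_display}.
Context {Z : measurableType d} {Omega : measurableType d'}.
Variables (P : probability Omega R) (mu : {sigma_finite_measure set Z -> \bar R})
  (eta : R.-ker Omega ~> Z).
Hypothesis Peta : is_poisson_measure P mu eta.

Lemma eq_expect_ae (Y Y' : Omega -> R) : all_moments P Y -> all_moments P Y' ->
  {ae P, forall w, Y w = Y' w} -> expect P Y = expect P Y'.
Proof.
move=> Ym Ym' YY'; apply: EFin_inj; rewrite !expectE//; apply: ae_eq_integral => //.
- by apply/measurable_EFinP; case: Ym.
- by apply/measurable_EFinP; case: Ym'.
- by apply: filterS YY' => w -> _.
Qed.

Section refine.
Variables (I T : finType) (A : I -> set Z) (C : T -> set Z).
Hypothesis mA : forall i, measurable (A i).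
Hypothesis Aoo : forall i, mu (A i) < +oo.
Hypothesis tA : trivIset setT A.
Hypothesis mC : forall i, measurable (C i).
Hypothesis tC : trivIset setT C.
Variable pi : option T -> option I.
Hypothesis piC : forall z, pi (index_of C z) = index_of A z.
Hypothesis pi0 : pi None = None.

Lemma simple_fun_refine (a : seq (option I) -> R) s : simple_fun C (a \o map pi) s = simple_fun A a s.
Proof.
rewrite /simple_fun /= -map_comp; congr a; apply: eq_map => z; exact: piC.
Qed.

Lemma simple_coef_refine q (a : seq (option I) -> R) : simple_coef q a -> simple_coef q (a \o map pi).
Proof.
move=> [ap aN au aq]; split => s /=.
- by move=> s' ss'; apply: ap; exact: perm_map.
- by move=> sN; apply: aN; rewrite -pi0; apply: map_f.
- by move=> us; apply: au; apply: contra us; exact: map_uniq.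
- by move=> sq; apply: aq; rewrite size_map.
Qed.

Lemma refine_cover i : A i = \big[setU/set0]_(c <- enum [pred c | pi (Some c) == Some i]) C c.
Proof.
rewrite -bigcup_seq; apply/seteqP; split => z.
  move=> /(index_ofP tA) Ai; have := piC z; rewrite Ai.
  case E : (index_of C z) => [c|]; last by rewrite pi0.
  by move=> pc; exists c; [rewrite /= mem_enum inE pc|exact/(index_ofP tC)].
move=> [c]; rewrite /= mem_enum inE => /eqP pc /(index_ofP tC) Cc.
by apply/(index_ofP tA); rewrite -piC Cc.
Qed.

Lemma fine_refine (m : {measure set Z -> \bar R}) i : m (A i) < +oo ->
  (fine (m (A i)) = \sum_(c | pi (Some c) == Some i) fine (m (C c)))%R.
Proof.
move=> mi; have cfin c : pi (Some c) == Some i -> m (C c) \is a fin_num.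
  move=> pc; rewrite ge0_fin_numE//; apply: le_lt_trans mi.
  apply: le_measure; rewrite ?inE//; rewrite refine_cover -bigcup_seq => z Cz.
  by exists c => //=; rewrite mem_enum inE.
rewrite {1}refine_cover measure_seqU ?enum_uniq// big_enum /= -sum_fine//.
Qed.

(** [fine] is additive only when the count of the cell is finite, hence the almost sure
    statement. *)
Lemma centered_refine i : {ae P, forall w,
  centered mu eta (A i) w = (\sum_(c | pi (Some c) == Some i) centered mu eta (C c) w)%R}.
Proof.
apply: filterS (count_in_nat_ae Peta (mA i) (Aoo i)) => w [n wn].
have ew : (fine (eta w (A i)) = \sum_(c | pi (Some c) == Some i) fine (eta w (C c)))%R.
  by apply: (fine_refine (m := eta w)); rewrite wn ltry.
rewrite /centered /count_in ew (fine_refine (Aoo i)) -sumrB.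
by apply: eq_bigr.
Qed.

Lemma wsum_refine (x : T -> R) (y : I -> R) n (b : seq (option I) -> R) :
  (forall s, None \in s -> b s = 0%R) ->
  (forall i, y i = \sum_(c | pi (Some c) == Some i) x c)%R ->
  wsum x n (fun s => b (map pi (map Some s))) = wsum y n (fun s => b (map Some s)).
Proof.
move=> bN yx; elim: n b bN => [//|n IH] b bN /=.
under [RHS]eq_bigr do rewrite yx mulr_suml.
rewrite (exchange_big_dep xpredT)//=; apply: eq_bigr => c _.
case E : (pi (Some c)) => [i|].
  rewrite (bigD1 i)//= big1 ?addr0; last first.
    by move=> j /andP[/eqP[->]]; rewrite eqxx.
  by rewrite (IH (fun s => b (Some i :: s)))// => s sN; apply: bN; rewrite inE sN orbT.
rewrite big_pred0//; rewrite wsumE big1 ?mulr0// => t _.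
by rewrite bN ?mul0r// mem_head.
Qed.

Lemma simple_integral_refine q (a : seq (option I) -> R) : simple_coef q a -> {ae P, forall w,
  simple_integral mu eta C q (a \o map pi) w = simple_integral mu eta A q a w}.
Proof.
move=> [_ aN _ _].
have : {ae P, forall w, forall i,
  centered mu eta (A i) w = (\sum_(c | pi (Some c) == Some i) centered mu eta (C c) w)%R}.
  by apply: filter_forall => i; exact: centered_refine.
by apply: filterS => w yx; rewrite /simple_integral; exact: wsum_refine.
Qed.

End refine.

Section product_system.
Variables (I J : finType) (A : I -> set Z) (B : J -> set Z).
Hypothesis mA : forall i, measurable (A i).
Hypothesis Aoo : forall i, mu (A i) < +oo.
Hypothesis tA : trivIset setT A.
Hypothesis mB : forall i, measurable (B i).
Hypothesis Boo : forall i, mu (B i) < +oo.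
Hypothesis tB : trivIset setT B.

(** The atoms generated by both systems. The pair [(None, None)] is given the empty set, since the
    complement of all cells may have infinite measure. *)
Definition product_set (t : option I * option J) : set Z :=
  [set z | [/\ index_of A z = t.1, index_of B z = t.2 & t <> (None, None)]].

Definition proj_fst (o : option (option I * option J)) := if o is Some t then t.1 else None.
Definition proj_snd (o : option (option I * option J)) := if o is Some t then t.2 else None.

Lemma product_set_trivIset : trivIset setT product_set.
Proof.
apply/trivIsetP => -[i j] [i' j'] _ _ tt'; apply/seteqP; split => // z [] [/= e1 e2 _] [/= e3 e4 _].
by move/eqP : tt'; apply; rewrite -e1 -e2 e3 e4.
Qed.

Let measurable_index (K : finType) (D : K -> set Z) (o : option K) :
  (forall i, measurable (D i)) -> trivIset setT D -> measurable [set z | index_of D z = o].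
Proof.
move=> mD tD; case: o => [i|].
  rewrite (_ : [set z | _] = D i)//.
  by apply/seteqP; split => z; [move=> /(index_ofP tD)|move=> Di; exact/(index_ofP tD)].
rewrite (_ : [set z | _] = ~` (\bigcup_(i in [set: K]) D i)).
  by apply: measurableC; apply: fin_bigcup_measurable.
apply/seteqP; split => z /=.
  by move=> zN [i _ /(index_ofP tD)]; rewrite zN.
move=> h; case E : (index_of D z) => [i|//].
by exfalso; apply: h; exists i => //; exact/(index_ofP tD).
Qed.

Lemma measurable_product_set t : measurable (product_set t).
Proof.
rewrite /product_set; have [->|/eqP tN] := eqVneq t (None, None).
  by rewrite (_ : [set z | _] = set0)//; apply/seteqP; split => z // [].
rewrite (_ : [set z | _] = [set z | index_of A z = t.1] `&` [set z | index_of B z = t.2]).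
  by apply: measurableI; exact: measurable_index.
by apply/seteqP; split => z; [move=> []|move=> [? ?]; split].
Qed.

Lemma product_set_fin t : mu (product_set t) < +oo.
Proof.
case: t (measurable_product_set t) => [[i|] j] mt.
  apply: le_lt_trans (Aoo i); apply: le_measure; rewrite ?inE//.
  by move=> z [/= /(index_ofP tA)].
case: j mt => [j|] mt.
  apply: le_lt_trans (Boo j); apply: le_measure; rewrite ?inE//.
  by move=> z [/= _ /(index_ofP tB)].
rewrite (_ : product_set _ = set0) ?measure0 ?ltry//.
by apply/seteqP; split => z // [].
Qed.

Lemma index_of_product z : index_of product_set z =
  if (index_of A z, index_of B z) == (None, None) then None
  else Some (index_of A z, index_of B z).
Proof.
case: eqP => [zN|zN]; last by apply/(index_ofP product_set_trivIset).
case E : (index_of product_set z) => [t|//].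
move: E => /(index_ofP product_set_trivIset) [h1 h2 tN]; exfalso; apply: tN.
by move: zN; rewrite h1 h2; case: t {h1 h2}.
Qed.

Lemma proj_fst_index z : proj_fst (index_of product_set z) = index_of A z.
Proof. by rewrite index_of_product; case: eqP => [[->]|]. Qed.

Lemma proj_snd_index z : proj_snd (index_of product_set z) = index_of B z.
Proof. by rewrite index_of_product; case: eqP => [[_ ->]|]. Qed.

End product_system.
End refinement.

(** * Simple kernels: mixed moments, isometry, truncation *)

Section kernels.
Context {R : realType} {d d' : measure_display}.
Context {Z : measurableType d} {Omega : measurableType d'}.
Variables (P : probability Omega R) (mu : {sigma_finite_measure set Z -> \bar R})
  (eta : R.-ker Omega ~> Z).
Hypothesis Zborel : borel_space R Z.
Hypothesis mu_atomless : atomless mu.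
Hypothesis Peta : is_poisson_measure P mu eta.
Variable q : nat.

Record simple_kernel := SimpleKernel {
  cell_index : finType;
  cell : cell_index -> set Z;
  kcoef : seq (option cell_index) -> R;
  measurable_cell : forall i, measurable (cell i);
  cell_fin : forall i, mu (cell i) < +oo;
  cell_disjoint : trivIset setT cell;
  kernel_simple : simple_coef q kcoef }.

Definition kfun (k : simple_kernel) : seq Z -> R := simple_fun (@cell k) (@kcoef k).
Definition kint (k : simple_kernel) : Omega -> R := simple_integral mu eta (@cell k) q (@kcoef k).
Definition knonneg (k : simple_kernel) := forall s, (0 <= @kcoef k s)%R.

Lemma kfun_perm k s s' : perm_eq s s' -> kfun k s = kfun k s'.
Proof. by case: (kernel_simple k) => kP _ _ _ ss'; apply: kP; exact: perm_map. Qed.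

Lemma kfun_size k s : size s <> q -> kfun k s = 0%R.
Proof. by case: (kernel_simple k) => _ _ _ kq sq; apply: kq; rewrite size_map. Qed.

Lemma kfun_measurable k : seq_measurable (EFin \o kfun k).
Proof.
case: (kernel_simple k) => _ kN _ _.
apply: (seq_measurable_index (@measurable_cell k) (@cell_disjoint k)) => //.
Qed.

Lemma all_moments_kint k : all_moments P (kint k).
Proof.
exact: (all_moments_simple_integral Peta (@measurable_cell k) (@cell_fin k)).
Qed.

Section common.
Variables k k' : simple_kernel.

Let A := @cell k.
Let B := @cell k'.
Let C := product_set A B.
Let mC := measurable_product_set (@measurable_cell k) (@cell_disjoint k)
  (@measurable_cell k') (@cell_disjoint k').
Let Coo := product_set_fin (@measurable_cell k) (@cell_fin k) (@cell_disjoint k)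
  (@measurable_cell k') (@cell_fin k') (@cell_disjoint k').
Let tC := product_set_trivIset (A := A) (B := B).

Lemma common_refinement : exists b b' : seq (option (option (cell_index k) * option (cell_index k'))) -> R,
  [/\ simple_coef q b /\ simple_coef q b',
      kfun k = simple_fun C b /\ kfun k' = simple_fun C b',
      {ae P, forall w, simple_integral mu eta C q b w = kint k w},
      {ae P, forall w, simple_integral mu eta C q b' w = kint k' w} &
      (knonneg k -> forall s, 0 <= b s)%R /\ (knonneg k' -> forall s, 0 <= b' s)%R].
Proof.
have pf z : proj_fst (index_of C z) = index_of A z by exact: proj_fst_index.
have ps z : proj_snd (index_of C z) = index_of B z by exact: proj_snd_index.
exists (@kcoef k \o map (proj_fst (J := _))), (@kcoef k' \o map (proj_snd (J := _))); split.
- by split; apply: simple_coef_refine => //; exact: kernel_simple.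
- by split; apply/funext => s; [rewrite (simple_fun_refine pf)|rewrite (simple_fun_refine ps)].
- apply: (simple_integral_refine Peta _ _ _ _ tC pf) => //.
  + exact: measurable_cell.
  + exact: cell_fin.
  + exact: cell_disjoint.
  + exact: kernel_simple.
- apply: (simple_integral_refine Peta _ _ _ _ tC ps) => //.
  + exact: measurable_cell.
  + exact: cell_fin.
  + exact: cell_disjoint.
  + exact: kernel_simple.
- by split => h s; exact: h.
Qed.

(** On a common refinement the word formula applies with [k] as copy 0 and [k'] as the other three:
    the mixed moment that Young's inequality will require. *)
Lemma kernel_fourth_moment : knonneg k -> knonneg k' ->
  (expect P (fun w => kint k w * kint k' w ^+ 3)%R)%:E =
  fourth_moment_sum mu q (fun i => if i == 0%R :> 'I_4 then kfun k else kfun k').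
Proof.
move=> k0 k'0; have [b [b' [[cb cb'] [-> ->] bk bk' [b0 b'0]]]] := common_refinement.
pose a (i : 'I_4) := if i == 0%R :> 'I_4 then b else b'.
rewrite (_ : (fun i => _) = fun i => simple_fun C (a i)); last first.
  by apply/funext => i; rewrite /a; case: ifP.
have ca i : simple_coef q (a i) by rewrite /a; case: ifP.
have a0 i s : (0 <= a i s)%R by rewrite /a; case: ifP => _; [exact: b0|exact: b'0].
rewrite -(simple_fourth_moment Zborel mu_atomless Peta mC Coo tC ca a0); congr EFin.
have am c : all_moments P (simple_integral mu eta C q c).
  exact: (all_moments_simple_integral Peta mC Coo).
apply: eq_expect_ae.
- by apply: all_momentsM; [|apply: all_momentsX]; exact: all_moments_kint.
- by apply: all_moments_prod => i _; exact: am.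
apply: filterS2 bk bk' => w kw k'w.
by rewrite !big_ord_recl big_ord0 /a /= kw k'w mulr1 !exprS expr0 mulr1.
Qed.

Lemma kernel_isometry_diff :
  (expect P (fun w => (kint k w - kint k' w) ^+ 2)%R)%:E =
  q`!%:R%:E * iterint mu q (fun s => ((kfun k s - kfun k' s) ^+ 2)%:E).
Proof.
have [b [b' [[cb cb'] [-> ->] bk bk' _]]] := common_refinement.
pose c s := (b s - b' s)%R.
have cc : simple_coef q c.
  move: cb cb' => [p1 N1 u1 s1] [p2 N2 u2 s2]; split => s.
  - by move=> s' ss'; rewrite /c (p1 _ _ ss') (p2 _ _ ss').
  - by move=> sN; rewrite /c N1 ?N2 ?subrr.
  - by move=> us; rewrite /c u1 ?u2 ?subrr.
  - by move=> sq; rewrite /c s1 ?s2 ?subrr.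
have := simple_isometry Zborel mu_atomless Peta mC Coo tC cc.
rewrite /simple_fun /c => <-; congr EFin.
have am e : all_moments P (simple_integral mu eta C q e).
  exact: (all_moments_simple_integral Peta mC Coo).
apply: eq_expect_ae.
- apply: all_momentsX; apply: all_momentsD; first exact: all_moments_kint.
  rewrite (_ : (fun _ => _) = fun w => -1 * kint k' w)%R.
    by apply: all_momentsM; [exact: (all_moments_cst P (-1)%R)|exact: all_moments_kint].
  by apply/funext => w; rewrite mulN1r.
- exact: all_momentsX.
apply: filterS2 bk bk' => w <- <-; congr (_ ^+ 2)%R.
rewrite /simple_integral !wsumE -sumrB; apply: eq_bigr => t _.
by rewrite -mulrBl.
Qed.

End common.

Lemma kernel_pos_simple k : simple_coef q (fun s => Num.max (@kcoef k s) 0)%R.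
Proof.
case: (kernel_simple k) => kP kN ku ks; split => s.
- by move=> s' ss'; rewrite (kP _ _ ss').
- by move=> sN; rewrite kN ?maxxx.
- by move=> us; rewrite ku ?maxxx.
- by move=> sq; rewrite ks ?maxxx.
Qed.

Definition kernel_pos k : simple_kernel :=
  SimpleKernel (@measurable_cell k) (@cell_fin k) (@cell_disjoint k) (kernel_pos_simple k).

Lemma kernel_pos_nonneg k : knonneg (kernel_pos k).
Proof. by move=> s; rewrite /= le_max lexx orbT. Qed.

Lemma kfun_pos k s : kfun (kernel_pos k) s = Num.max (kfun k s) 0%R.
Proof. by []. Qed.

(** The positive part is included because the approximating kernels may take negative values. *)
Definition clip (B : set Z) (K : R) (u : seq Z -> R) (s : seq Z) : R :=
  if all (fun z => `[< B z >]) s then Num.min (Num.max (u s) 0%R) K else 0%R.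

(** Refining the cells by [B] makes membership of all arguments in [B] a function of their cell
    indices, so the clipped kernel is again simple. *)
Lemma kernel_clip (B : set Z) (K : R) k : measurable B -> mu B < +oo -> (0 <= K)%R ->
  exists k', kfun k' = clip B K (kfun k) /\ knonneg k'.
Proof.
move=> mB Boo K0.
pose B' (_ : unit) := B; pose A := @cell k; pose C := product_set A B'.
have tB : trivIset setT B' by apply/trivIsetP => -[] [].
have mC := measurable_product_set (@measurable_cell k) (@cell_disjoint k) (fun _ : unit => mB) tB.
have Coo := product_set_fin (@measurable_cell k) (@cell_fin k) (@cell_disjoint k)
  (fun _ : unit => mB) (fun=> Boo) tB.
have tC := product_set_trivIset (A := A) (B := B').
pose c (s : seq (option (option (cell_index k) * option unit))) : R := if None \in map (proj_snd (J := _)) s then 0%R else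
  Num.min (Num.max (@kcoef k (map (proj_fst (J := _)) s)) 0%R) K.
have clip0 : Num.min (Num.max 0%R 0%R) K = 0%R by rewrite maxxx min_l.
have cc : simple_coef q c.
  case: (kernel_simple k) => kP kN ku ks; rewrite /c; split => s.
  - move=> s' ss'; rewrite (perm_mem (perm_map (proj_snd (J := _)) ss')).
    by rewrite (kP _ _ (perm_map (proj_fst (J := _)) ss')).
  - by move=> sN; rewrite (map_f (proj_snd (J := _)) sN).
  - move=> us; case: ifP => // _; rewrite ku//; apply: contra us; exact: map_uniq.
  - by move=> sq; case: ifP => // _; rewrite ks// size_map.
exists (SimpleKernel mC Coo tC cc); split; last first.
  by move=> s; rewrite /= /c; case: ifP => // _; rewrite le_min K0 le_max lexx orbT.
apply/funext => s; rewrite /kfun /simple_fun /= /c /clip -!map_comp.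
rewrite (eq_map (g := index_of A)); last by move=> z; exact: proj_fst_index.
rewrite (eq_map (g := index_of B')); last by move=> z; exact: proj_snd_index.
rewrite (_ : None \in _ = ~~ all (fun z => `[< B z >]) s); last first.
  elim: s => [//|z s IH]; rewrite [LHS]inE IH /= negb_and; congr (_ || _).
  case E : (index_of B' z) => [[]|] /=.
    by move: E => /(index_ofP tB) Bz; rewrite asboolT.
  rewrite eqxx asboolF// => Bz.
  by have : index_of B' z = Some tt; [exact/(index_ofP tB)|rewrite E].
by rewrite if_neg.
Qed.

End kernels.

(** * Stability of the fourth moment sum *)

Section stability.
Context {R : realType} {d : measure_display} {Z : measurableType d}.
Variable mu : {sigma_finite_measure set Z -> \bar R}.

Lemma le_iterint_size n (h h' : seq Z -> \bar R) : (forall s, 0 <= h s) ->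
  seq_measurable h -> seq_measurable h' -> (forall s, size s = n -> h s <= h' s) ->
  iterint mu n h <= iterint mu n h'.
Proof.
move=> h0 mh mh' hh'.
(* The maximum agrees with [h'] on the relevant length and dominates [h] on every length. *)
rewrite [leRHS](@eq_iterint _ _ _ mu _ _ (fun s => maxe (h s) (h' s))); last first.
  by move=> s /hh' ?; rewrite max_r.
apply: le_iterint => // [k|s]; last by rewrite le_max lexx.
by apply: measurable_maxe; [exact: (mh k)|exact: (mh' k)].
Qed.

Lemma iterintZr n (h : seq Z -> \bar R) (k : \bar R) : (forall s, 0 <= h s) -> seq_measurable h ->
  0 <= k -> iterint mu n (fun s => h s * k) = iterint mu n h * k.
Proof.
move=> h0 mh k0; rewrite muleC -iterintZl//; apply: eq_iterint => s _; exact: muleC.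
Qed.

Definition inside (B : set Z) (s : seq Z) : R := (\prod_(z <- s) \1_B z)%R.

Lemma inside_ge0 B s : (0 <= inside B s)%R. Proof. by apply: prodr_ge0. Qed.

Lemma inside_le1 B s : (inside B s <= 1)%R.
Proof. by apply: prodr_ile1 => z _; rewrite indicE; case: (_ \in _); rewrite !lexx ler01. Qed.

Lemma inside_all B s : inside B s = (all (fun z => `[< B z >]) s)%:R.
Proof.
elim: s => [|z s IH]; first by rewrite /inside big_nil.
rewrite /inside big_cons -/(inside B s) IH indicE /= -natrM mulnb.
by congr (_ && _)%:R; apply/idP/idP => [/set_mem/asboolP//|/asboolP/mem_set].
Qed.

Lemma seq_measurable_inside B : measurable B -> seq_measurable (fun s => (inside B s)%:E).
Proof.
move=> mB n; apply/measurable_EFinP; rewrite /inside.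
rewrite (_ : (fun _ => _) = fun x : n.-tuple Z => (\prod_(i < n) \1_B (tnth x i))%R).
  apply: measurable_prod => i _.
  exact: (measurableT_comp (measurable_indic mB) (@measurable_tnth _ _ _ i)).
by apply/funext => x; rewrite big_tuple.
Qed.

Lemma iterint_inside B n : measurable B -> iterint mu n (fun s => (inside B s)%:E) = mu B ^+ n.
Proof.
move=> mB; elim: n => [|n IH]; first by rewrite /= /inside big_nil.
rewrite expeS /=.
transitivity (\int[mu]_z ((\1_B z)%:E * mu B ^+ n)).
  apply: eq_integral => z _; rewrite -IH -iterintZl//.
  - by apply: eq_iterint => s _; rewrite /inside big_cons EFinM.
  - by move=> s; rewrite lee_fin inside_ge0.
  - exact: seq_measurable_inside.
rewrite ge0_integralZr//; last 2 first.
- by apply/measurable_EFinP; exact: (measurable_indic mB).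
- by apply: expe_ge0.
by rewrite integral_indic ?setIT.
Qed.

Lemma word_measurable_row_inside B (e : seq Z -> R) i : measurable B ->
  seq_measurable (EFin \o e) ->
  word_measurable (fun v : seq (letter * Z) => (e (row_of i v) * inside B (unzip2 v))%:E).
Proof.
move=> mB me.
move=> u n; apply/measurable_EFinP; apply: measurable_funM; apply/measurable_EFinP.
    exact: (seq_measurable_row i u me).
  (* [zip] truncates to the shorter list, so only the first [size u] variables are labelled. *)
  have mI : measurable_fun setT (fun x : n.-tuple Z => (inside B (take (size u) x))%:E).
    apply/measurable_EFinP.
    rewrite (_ : (fun _ => _) = fun x : n.-tuple Z =>
      (\prod_(j < n | (j < size u)%N) \1_B (tnth x j))%R).
      rewrite (_ : (fun _ => _) = fun x : n.-tuple Z =>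
        (\prod_(j < n) if (j < size u)%N then \1_B (tnth x j) else 1)%R); last first.
        by apply/funext => x; rewrite -big_mkcond.
      apply: measurable_prod => j _; case: (j < size u)%N => //.
      exact: (measurableT_comp (measurable_indic mB) (@measurable_tnth _ _ _ j)).
    apply/funext => x; rewrite /inside; set z0 : Z := point.
    rewrite (big_nth z0) big_mkord size_take size_tuple.
    rewrite (eq_bigr (fun j : 'I__ => \1_B (nth z0 x j))%R); last first.
      move=> j _; rewrite nth_take//; apply: leq_trans (ltn_ord j) _.
      by case: ltnP.
    rewrite [RHS](eq_bigr (fun j : 'I__ => \1_B (nth z0 x j))%R); last first.
      by move=> j _; rewrite (tnth_nth z0).
    case: ltnP => su.
      by rewrite (big_ord_widen n (fun j => \1_B (nth z0 x j))%R (ltnW su)).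
    by apply: eq_bigl => j; rewrite (leq_trans (ltn_ord j) su).
  apply: (eq_measurable_fun _ _ mI) => x _ /=; congr (inside B _)%:E; move: (tval x).
  clear; elim: u => [|S u IH] [|z t] //=; by rewrite IH.
Qed.

(** Each of the at most [2 q] variables not read by copy [i] integrates to [mu B]; the base
    [1 + mu B] makes the bound monotone in their number. *)
Lemma wordint_row_le B (e : seq Z -> R) q i (w : seq letter) : measurable B -> mu B < +oo ->
  (forall s, 0 <= e s)%R -> seq_measurable (EFin \o e) ->
  (forall s s', perm_eq s s' -> e s = e s') -> count (fun S : letter => i \in S) w = q ->
  (size w <= 2 * q)%N ->
  wordint mu (fun v => (e (row_of i v) * inside B (unzip2 v))%:E) w <=
  ((1 + fine (mu B)) ^+ (2 * q))%:E * iterint mu q (EFin \o e).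
Proof.
move=> mB Boo e0 me eP wq sw.
have mE := word_measurable_row_inside i mB me.
rewrite (wordint_split mu i)//; last 2 first.
- move=> v v' vv'; rewrite (eP _ _ (perm_row_of i vv')); congr (_ * _)%:E.
  by rewrite /inside; apply: perm_big; exact: perm_map.
- by move=> v; rewrite lee_fin mulr_ge0// inside_ge0.
set m := count _ w; rewrite wq.
have J0 : 0 <= iterint mu q (EFin \o e) by apply: iterint_ge0 => s; rewrite lee_fin.
apply: (@le_trans _ _ (iterint mu m (fun x => (inside B x)%:E * iterint mu q (EFin \o e)))).
  pose G x y := (e (row_of i (zip (seq.filter (fun S : letter => i \notin S) w) x ++ zip (seq.filter (fun S : letter => i \in S) w) y)) *
    inside B (unzip2 (zip (seq.filter (fun S : letter => i \notin S) w) x ++ zip (seq.filter (fun S : letter => i \in S) w) y)))%:E.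
  have GE x y : size x = m -> size y = q -> G x y = (e y)%:E * (inside B x * inside B y)%:E.
    move=> sx sy; rewrite /G row_of_split ?wq// -EFinM; congr (_ * _)%:E.
    rewrite /unzip2 map_cat -/unzip2 !unzip2_zip ?size_filter ?sx ?wq ?sy//.
    by rewrite /inside big_cat.
  rewrite (@eq_iterint _ _ _ mu _ _ (fun x => (inside B x)%:E *
     iterint mu q (fun y => (e y)%:E * (inside B y)%:E))); last first.
    move=> x sx; rewrite -iterintZl.
    - apply: eq_iterint => y sy; rewrite -/(G x y) GE// -!EFinM; congr EFin; ring.
    - by move=> y; rewrite -EFinM lee_fin mulr_ge0// inside_ge0.
    - by move=> n; apply: emeasurable_funM; [exact: me|exact: seq_measurable_inside].
    - by rewrite lee_fin inside_ge0.
  have mi : seq_measurable (fun y => (e y)%:E * (inside B y)%:E).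
    by move=> n; apply: emeasurable_funM; [exact: me|exact: seq_measurable_inside].
  have i0 y : 0 <= (e y)%:E * (inside B y)%:E by rewrite -EFinM lee_fin mulr_ge0// inside_ge0.
  have I0 := iterint_ge0 mu q i0.
  rewrite !iterintZr//; try by [move=> s; rewrite lee_fin inside_ge0|exact: seq_measurable_inside].
  apply: lee_wpmul2l; first by apply: iterint_ge0 => s; rewrite lee_fin inside_ge0.
  apply: le_iterint => // y /=.
  by rewrite -EFinM lee_fin ler_piMr// inside_le1.
rewrite iterintZr//; [|by move=> s; rewrite lee_fin inside_ge0|exact: seq_measurable_inside].
apply: lee_wpmul2r => //; rewrite iterint_inside//.
have Bf : mu B \is a fin_num by rewrite ge0_fin_numE.
rewrite -(fineK Bf) -EFin_expe lee_fin.
have b0 : (0 <= fine (mu B))%R by exact: fine_ge0.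
apply: (@le_trans _ _ ((1 + fine (mu B)) ^+ m)%R).
  by apply: lerXn2r; rewrite ?nnegrE ?addr_ge0// lerDr.
rewrite ler_weXn2l ?lerDl//; apply: leq_trans sw; exact: count_size.
Qed.

End stability.

Section fourth_moment_stability.
Context {R : realType} {d : measure_display} {Z : measurableType d}.
Variable mu : {sigma_finite_measure set Z -> \bar R}.

Lemma iterint_sum (I : Type) (r : seq I) n (h : I -> seq Z -> \bar R) :
  (forall i s, 0 <= h i s) -> (forall i, seq_measurable (h i)) ->
  iterint mu n (fun s => \sum_(i <- r) h i s) = \sum_(i <- r) iterint mu n (h i).
Proof.
move=> h0 mh; elim: r => [|i r IH].
  by rewrite big_nil -[RHS](iterint0 mu n); apply: eq_iterint => s _; rewrite big_nil.
rewrite big_cons -IH -iterintD//.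
- by apply: eq_iterint => s _; rewrite big_cons.
- by move=> s; apply: sume_ge0.
- by move=> k; apply: emeasurable_sum => j; exact: (mh j k).
Qed.

(** Telescoping: the factors are exchanged one at a time while the other three are bounded by
    [K]. *)
Lemma prod4_le (K : R) (a b : 'I_4 -> R) : (forall i, 0 <= a i <= K)%R ->
  (forall i, 0 <= b i <= K)%R ->
  (\prod_i a i <= \prod_i b i + \sum_i K ^+ 3 * `|a i - b i|)%R.
Proof.
move=> aK bK.
have K0 : (0 <= K)%R by have /andP[h1 h2] := aK 0%R; exact: le_trans h2.
have step (x y c : R) : (0 <= c <= K ^+ 3 -> (x - y) * c <= K ^+ 3 * `|x - y|)%R.
  move=> /andP[c0 cK]; apply: le_trans (ler_norm _) _.
  by rewrite normrM (ger0_norm c0) mulrC; exact: ler_wpM2r.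
have p3 (x y z : R) : (0 <= x <= K -> 0 <= y <= K -> 0 <= z <= K ->
    0 <= x * y * z <= K ^+ 3)%R.
  move=> /andP[x0 xK] /andP[y0 yK] /andP[z0 zK]; rewrite !mulr_ge0//=.
  have -> : (K ^+ 3 = K * K * K)%R by ring.
  by apply: ler_pM; rewrite ?mulr_ge0//; apply: ler_pM.
rewrite !big_ord_recl !big_ord0 !mulr1 !addr0.
set i0 := ord0; set i1 := lift _ _; set i2 := lift _ _; set i3 := lift _ _.
have h0 := step (a i0) (b i0) _ (p3 _ _ _ (aK i1) (aK i2) (aK i3)).
have h1 := step (a i1) (b i1) _ (p3 _ _ _ (bK i0) (aK i2) (aK i3)).
have h2 := step (a i2) (b i2) _ (p3 _ _ _ (bK i0) (bK i1) (aK i3)).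
have h3 := step (a i3) (b i3) _ (p3 _ _ _ (bK i0) (bK i1) (bK i2)).
rewrite -subr_ge0; rewrite -subr_ge0 in h0; rewrite -subr_ge0 in h1.
rewrite -subr_ge0 in h2; rewrite -subr_ge0 in h3.
apply: le_trans (addr_ge0 (addr_ge0 h0 h1) (addr_ge0 h2 h3)) _.
by rewrite le_eqVlt; apply/orP; left; apply/eqP; ring.
Qed.

Variables (q : nat) (B : set Z) (K : R) (u v : 'I_4 -> seq Z -> R).
Hypothesis mB : measurable B.
Hypothesis Boo : mu B < +oo.
Hypothesis uK : forall i s, (0 <= u i s <= K)%R.
Hypothesis vK : forall i s, (0 <= v i s <= K)%R.
Hypothesis mU : forall i, seq_measurable (EFin \o u i).
Hypothesis mv : forall i, seq_measurable (EFin \o v i).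
Hypothesis uP : forall i s s', perm_eq s s' -> u i s = u i s'.
Hypothesis vP : forall i s s', perm_eq s s' -> v i s = v i s'.
Hypothesis uq : forall i s, size s <> q -> u i s = 0%R.
Hypothesis uB : forall i s, inside B s = 0%R :> R -> u i s = 0%R.

Let e i s := (`|u i s - v i s|)%R.
Let total := \sum_(i < 4) iterint mu q (EFin \o e i).
Let kappa := (K ^+ 3 * (1 + fine (mu B)) ^+ (2 * q))%R.

Let me_ i : seq_measurable (EFin \o e i).
Proof.
move=> n; apply/measurable_EFinP; apply: measurableT_comp => //.
by apply: measurable_funB; apply/measurable_EFinP; [exact: mU|exact: mv].
Qed.

Let u0 i s : (0 <= u i s)%R. Proof. by have /andP[] := uK i s. Qed.
Let v0 i s : (0 <= v i s)%R. Proof. by have /andP[] := vK i s. Qed.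
Let K0 : (0 <= K)%R. Proof. by have /andP[h1 h2] := uK 0%R [::]; exact: le_trans h2. Qed.
Let kappa0 : (0 <= kappa)%R.
Proof. by rewrite /kappa mulr_ge0 ?exprn_ge0 ?addr_ge0// fine_ge0. Qed.
Let total0 : 0 <= total.
Proof. by apply: sume_ge0 => i _; apply: iterint_ge0 => s; rewrite lee_fin /= normr_ge0. Qed.

Lemma Jword_stable w : thick_word w -> (size w <= 2 * q)%N ->
  Jword mu u w <= Jword mu v w + kappa%:E * total.
Proof.
move=> w2 wq.
have Jv0 : 0 <= Jword mu v w by exact: Jword_ge0.
have kt0 : 0 <= kappa%:E * total by rewrite mule_ge0// lee_fin.
have [/forallP wc|] := boolP [forall i, count (fun S : letter => i \in S) w == q]; last first.
  by rewrite negb_forall => /existsP[i wi]; rewrite (Jword0 mu (@uq i) wi); exact: adde_ge0.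
pose G i (s : seq Z) := (e i (row_of i (zip w s)) * inside B (unzip2 (zip w s)))%:E.
have G0 i s : 0 <= G i s by rewrite lee_fin mulr_ge0// ?inside_ge0//= normr_ge0.
have mG i : seq_measurable (G i).
  exact: (word_measurable_row_inside i mB (@me_ i) w).
have mKG i : seq_measurable (fun s => (K ^+ 3)%:E * G i s).
  by move=> n; apply: emeasurable_funM => //; exact: (mG i n).
have KG0 i s : 0 <= (K ^+ 3)%:E * G i s by rewrite mule_ge0// lee_fin exprn_ge0.
apply: (@le_trans _ _ (iterint mu (size w) (fun s =>
    wordprod v (zip w s) + \sum_(i <- index_enum 'I_4) (K ^+ 3)%:E * G i s))).
  apply: le_iterint_size.
  - by move=> s; exact: wordprod_ge0.
  - exact: (wordprod_measurable mU).
  - move=> n; apply: emeasurable_funD; first exact: (wordprod_measurable mv).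
    by apply: emeasurable_sum => i; exact: (mKG i n).
  move=> s sw; have szip : unzip2 (zip w s) = s by rewrite unzip2_zip// sw.
  have [sB|sB] := eqVneq (inside B s) (0%R : R); last first.
    have sB1 : inside B s = 1%R :> R by move: sB; rewrite inside_all; case: all => //; rewrite eqxx.
    rewrite /wordprod /G szip sB1.
    under [X in _ <= _ + X]eq_bigr do rewrite mulr1 -EFinM.
    by rewrite sumEFin -EFinD lee_fin; exact: prod4_le.
  (* A variable outside [B] is read by some copy, whose kernel vanishes there, so the product for
     [u] is zero. *)
  have [i ui] : exists i, u i (row_of i (zip w s)) = 0%R.
    have /allPn[z zs zB] : ~~ all (fun z => `[< B z >]) s.
      by move: sB; rewrite inside_all; case: all => //= /eqP; rewrite oner_eq0.
    have [i zi] := mem_row_of sw w2 zs; exists i; apply: uB; rewrite inside_all.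
    suff -> : all (fun z => `[< B z >]) (row_of i (zip w s)) = false by [].
    by apply/negbTE/allPn; exists z.
  rewrite {1}/wordprod (bigD1 i)//= ui mul0r adde_ge0 ?wordprod_ge0//.
  exact: sume_ge0.
rewrite iterintD; last 4 first.
- by move=> s; exact: wordprod_ge0.
- exact: (wordprod_measurable mv).
- by move=> s; exact: sume_ge0.
- by move=> n; apply: emeasurable_sum => i; exact: (mKG i n).
apply: leeD => //; rewrite iterint_sum// /total ge0_sume_distrr; last first.
  by move=> i _; apply: iterint_ge0 => s; rewrite lee_fin /= normr_ge0.
apply: lee_sum => i _; rewrite iterintZl ?lee_fin ?exprn_ge0// /kappa (EFinM (K ^+ 3)) -muleA.
apply: lee_wpmul2l; first by rewrite lee_fin exprn_ge0.
apply: wordint_row_le => //.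
- by move=> s; rewrite /e normr_ge0.
- by move=> s s' ss'; rewrite /e (uP _ ss') (vP _ ss').
- exact/eqP/wc.
Qed.

Definition word_total : R := (q`!%:R ^+ 4 * \sum_(N < (2 * q).+1) N`!%:R^-1 *
  \sum_(w : N.-tuple letter | thick_word w) 1)%R.

Lemma fourth_moment_stable :
  fourth_moment_sum mu q u <= fourth_moment_sum mu q v + (word_total * kappa)%:E * total.
Proof.
have kt0 : 0 <= kappa%:E * total by rewrite mule_ge0// lee_fin.
have sv0 N : 0 <= \sum_(w : N.-tuple letter | thick_word w) Jword mu v w.
  by apply: sume_ge0 => w _; exact: Jword_ge0.
have n0 N : (0 <= N`!%:R^-1 :> R)%R by rewrite invr_ge0.
have s1 N : 0 <= \sum_(w : N.-tuple letter | thick_word w) (1%R : R)%:E.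
  by apply: sume_ge0 => w _; rewrite lee_fin.
rewrite (EFinM word_total) -muleA /word_total (EFinM (q`!%:R ^+ 4)) -muleA /fourth_moment_sum -ge0_muleDr; last 2 first.
- by apply: sume_ge0 => N _; rewrite mule_ge0// lee_fin.
- by rewrite mule_ge0// lee_fin; apply: sumr_ge0 => N _; rewrite mulr_ge0// sumr_ge0.
apply: lee_wpmul2l; first by rewrite lee_fin exprn_ge0.
rewrite -sumEFin ge0_sume_distrl; last first.
  by move=> N _; rewrite lee_fin mulr_ge0// sumr_ge0.
rewrite -big_split /=; apply: lee_sum => N _.
rewrite (EFinM (N`!%:R^-1)) -muleA -ge0_muleDr; last 2 first.
- exact: sv0.
- by rewrite mule_ge0// lee_fin sumr_ge0.
apply: lee_wpmul2l; first by rewrite lee_fin.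
rewrite -sumEFin ge0_sume_distrl; last by move=> w _; rewrite lee_fin.
rewrite -big_split /=; apply: lee_sum => w w2; rewrite mul1e.
by apply: Jword_stable => //; rewrite size_tuple -ltnS.
Qed.

End fourth_moment_stability.

(** * Passage to the limit *)

Section clip.
Context {R : realType} {d : measure_display} {Z : measurableType d}.
Variable mu : {sigma_finite_measure set Z -> \bar R}.

Lemma eventual_monotone_cvg d1 (T : measurableType d1) (m : {measure set T -> \bar R})
    (g : nat -> T -> \bar R) (h : T -> \bar R) :
  (forall n, measurable_fun setT (g n)) -> (forall n x, 0 <= g n x) ->
  (forall x, {homo g^~ x : n p / (n <= p)%N >-> n <= p}) ->
  (forall x, exists N, forall n, (N <= n)%N -> g n x = h x) ->
  \int[m]_x g n x @[n --> \oo] --> \int[m]_x h x.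
Proof.
move=> mg g0 gm gh.
rewrite (_ : \int[m]_x h x = \int[m]_x (fun x0 => limn (g^~ x0)) x).
  exact: (cvg_monotone_convergence measurableT mg (fun n x _ => g0 n x) (fun x _ => gm x)).
apply: eq_integral => x _; apply/esym/cvg_lim => //; apply: cvg_near_cst.
by have [N hN] := gh x; exists N => // n /= /hN.
Qed.

Lemma eventual_monotone_cvg_iterint N (g : nat -> seq Z -> \bar R) (h : seq Z -> \bar R) :
  (forall n, seq_measurable (g n)) -> seq_measurable h -> (forall n s, 0 <= g n s) ->
  (forall s, 0 <= h s) -> (forall s, {homo g^~ s : n p / (n <= p)%N >-> n <= p}) ->
  (forall s, exists N, forall n, (N <= n)%N -> g n s = h s) ->
  iterint mu N (g n) @[n --> \oo] --> iterint mu N h.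
Proof.
move=> mg mh g0 h0 gm gh.
have cv : \int[tuple_measure mu N]_x g n (tval x) @[n --> \oo] -->
    \int[tuple_measure mu N]_x h (tval x).
  apply: eventual_monotone_cvg.
  - by move=> n; exact: (mg n N).
  - by move=> n x.
  - by move=> x; exact: gm.
  - by move=> x; exact: gh.
rewrite (_ : (fun n => iterint mu N (g n)) =
  fun n => \int[tuple_measure mu N]_x g n (tval x)); last first.
  by apply/funext => n; rewrite integral_tuple_measure.
by rewrite -integral_tuple_measure.
Qed.

Lemma le_fourth_moment_sum q (u v : 'I_4 -> seq Z -> R) :
  (forall i, seq_measurable (EFin \o u i)) -> (forall i, seq_measurable (EFin \o v i)) ->
  (forall i s, 0 <= u i s <= v i s)%R -> fourth_moment_sum mu q u <= fourth_moment_sum mu q v.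
Proof.
move=> mu' mv uv; apply: lee_wpmul2l; first by rewrite lee_fin exprn_ge0.
apply: lee_sum => N _; apply: lee_wpmul2l; first by rewrite lee_fin invr_ge0.
apply: lee_sum => w _; apply: le_iterint.
- by move=> s; apply: wordprod_ge0 => i t; have /andP[] := uv i t.
- exact: (wordprod_measurable mu').
- exact: (wordprod_measurable mv).
by move=> s; rewrite lee_fin; apply: ler_prod => i _; exact: uv.
Qed.

Lemma clip_range (B : set Z) (K : R) u s : (0 <= K)%R -> (0 <= clip B K u s <= K)%R.
Proof.
move=> K0; rewrite /clip; case: ifP => _; last by rewrite lexx.
by rewrite le_min le_max lexx orbT K0 ge_min lexx orbT.
Qed.

Lemma clip_le (B : set Z) (K : R) u s : (0 <= u s)%R -> (clip B K u s <= u s)%R.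
Proof. by move=> u0; rewrite /clip; case: ifP => // _; rewrite ge_min ge_max lexx u0. Qed.

Lemma clip_lipschitz (B : set Z) (K : R) u v s : (0 <= K)%R ->
  (`|clip B K u s - clip B K v s| <= `|u s - v s| * inside B s)%R.
Proof.
move=> K0; rewrite inside_all /clip; case: ifP => _; last by rewrite subrr normr0 mulr0.
rewrite mulr1; have n1 := ler_norm (u s - v s); have n2 := ler_norm (v s - u s).
rewrite distrC in n2; set N := `|u s - v s|%R in n1 n2 *.
have N0 : (0 <= N)%R by exact: normr_ge0.
rewrite ler_norml; case: (lerP (u s) 0%R) => h1; case: (lerP (v s) 0%R) => h2.
- by case: (lerP 0%R K); lra.
- by case: (lerP 0%R K); case: (lerP (v s) K); lra.
- by case: (lerP 0%R K); case: (lerP (u s) K); lra.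
by case: (lerP (u s) K); case: (lerP (v s) K); lra.
Qed.

Lemma clip_outside (B : set Z) (K : R) u s : inside B s = 0%R :> R -> clip B K u s = 0%R.
Proof. by rewrite inside_all /clip; case: ifP => // _ /eqP; rewrite oner_eq0. Qed.

Lemma clip_perm (B : set Z) (K : R) u s s' : (u s = u s') -> perm_eq s s' ->
  clip B K u s = clip B K u s'.
Proof. by move=> uu ss'; rewrite /clip uu (perm_all _ ss'). Qed.

Lemma clip_zero (B : set Z) (K : R) u s : (0 <= K)%R -> u s = 0%R -> clip B K u s = 0%R.
Proof. by move=> K0 u0; rewrite /clip u0 maxxx min_l//; case: ifP. Qed.

Lemma clipE (B : set Z) (K : R) u s : clip B K u s = (inside B s * Num.min (Num.max (u s) 0%R) K)%R.
Proof. by rewrite inside_all /clip; case: ifP => _; rewrite ?mul1r ?mul0r. Qed.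

Lemma clip_measurable (B : set Z) (K : R) u : measurable B -> seq_measurable (EFin \o u) ->
  seq_measurable (EFin \o clip B K u).
Proof.
move=> mB mU n; apply/measurable_EFinP.
rewrite (_ : (fun _ => _) = fun x : n.-tuple Z =>
  (inside B x * Num.min (Num.max (u x) 0%R) K)%R); last by apply/funext => x; exact: clipE.
apply: measurable_funM; first by apply/measurable_EFinP; exact: seq_measurable_inside.
apply: measurable_minr => //; apply: measurable_maxr => //.
by apply/measurable_EFinP; exact: mU.
Qed.

Section exhaustion.
Variables (F : seq Z -> R) (B : nat -> set Z).
Hypothesis F0 : forall s, (0 <= F s)%R.
Hypothesis mF : seq_measurable (EFin \o F).
Hypothesis mB : forall n, measurable (B n).
Hypothesis Bhomo : {homo B : n m / (n <= m)%N >-> (n <= m)%O}.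
Hypothesis Bcover : [set: Z] = \bigcup_n B n.

Let Fn n := clip (B n) n%:R F.

Lemma clip_homo s : {homo Fn^~ s : n m / (n <= m)%N >-> (n <= m)%R}.
Proof.
move=> n m nm; rewrite /Fn /clip; case: ifPn => [Bn|_]; last first.
  by case: ifP => // _; rewrite le_min le_max lexx orbT ler0n.
have -> : all (fun z => `[< B m z >]) s.
  apply: sub_all Bn => z /asboolP Bz; apply/asboolP.
  by move: (Bhomo nm) z Bz => /subsetPset.
by rewrite le_min !ge_min lexx /= ler_nat nm orbT.
Qed.

Lemma clip_eventually s : exists N, forall n, (N <= n)%N -> Fn n s = F s.
Proof.
have [N1 h1] : exists N, forall n, (N <= n)%N -> all (fun z => `[< B n z >]) s.
  elim: s => [|z s [N IH]]; first by exists 0%N.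
  have [k _ Bk] : (\bigcup_n B n) z by rewrite -Bcover.
  exists (maxn k N) => n; rewrite geq_max => /andP[kn Nn] /=; rewrite IH// andbT.
  by apply/asboolP; move: (Bhomo kn) z Bk => /subsetPset.
exists (maxn N1 (Num.Def.archi_bound (F s))) => n; rewrite geq_max => /andP[Nn Kn].
rewrite /Fn /clip h1// max_l// min_l//; apply: ltW; apply: lt_le_trans (archi_boundP (F0 s)) _.
by rewrite ler_nat.
Qed.

(** Monotone convergence in each word, valid also when the limit is infinite; nonnegativity of [F]
    is essential here. *)
Lemma fourth_moment_clip_cvg q :
  fourth_moment_sum mu q (fun=> Fn n) @[n --> \oo] --> fourth_moment_sum mu q (fun=> F).
Proof.
have Fn0 n s : (0 <= Fn n s)%R by have /andP[] := clip_range (B n) F s (ler0n R n).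
have mFn n : seq_measurable (EFin \o Fn n) by exact: clip_measurable.
apply: cvgeZl => //; apply: cvg_nnesum.
  move=> N _; near=> n; rewrite mule_ge0 ?lee_fin ?invr_ge0//.
  by apply: sume_ge0 => w _; exact: Jword_ge0.
move=> N _; apply: cvgeZl => //; apply: cvg_nnesum.
  by move=> w _; near=> n; exact: Jword_ge0.
move=> w _; apply: (@eventual_monotone_cvg_iterint _ (fun n s => wordprod (fun=> Fn n) (zip w s))).
- by move=> n; exact: (wordprod_measurable (fun=> mFn n)).
- exact: (wordprod_measurable (fun=> mF)).
- by move=> n s; exact: wordprod_ge0.
- by move=> s; exact: wordprod_ge0.
- move=> s n m nm; rewrite lee_fin; apply: ler_prod => i _.
  by rewrite Fn0; exact: clip_homo.
move=> s; have /choice[L hL] := fun i : 'I_4 => clip_eventually (row_of i (zip w s)).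
exists (\max_i L i)%N => n Nn; congr EFin; apply: eq_bigr => i _; apply: hL.
by apply: leq_trans Nn; exact: leq_bigmax.
Unshelve. all: by end_near.
Qed.

(** For [0 <= Fn <= F] one has [(F - Fn)^2 + Fn^2 <= F^2], so the L^2 distance is controlled by the
    monotone convergence of the squared norms. *)
Lemma square_clip_cvg q (rho : R) : (0 < rho)%R ->
  iterint mu q (fun s => (F s ^+ 2)%:E) < +oo ->
  exists n, iterint mu q (fun s => ((F s - Fn n s) ^+ 2)%:E) <= rho%:E.
Proof.
move=> rho0 Foo; set Y := iterint mu q _ in Foo.
have Fn0 n s : (0 <= Fn n s)%R by have /andP[] := clip_range (B n) F s (ler0n R n).
have FnF n s : (Fn n s <= F s)%R by exact: clip_le.
have mFn n : seq_measurable (EFin \o Fn n) by exact: clip_measurable.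
have sq0 u s : 0 <= (u s ^+ 2 : R)%:E by rewrite lee_fin sqr_ge0.
have msq (u : seq Z -> R) : seq_measurable (EFin \o u) -> seq_measurable (fun s => (u s ^+ 2 : R)%:E).
  by move=> mU n; apply/measurable_EFinP; apply: measurable_funX; apply/measurable_EFinP; exact: mU.
have Y0 : 0 <= Y by apply: iterint_ge0.
have cvgY : iterint mu q (fun s => (Fn n s ^+ 2)%:E) @[n --> \oo] --> Y.
  apply: (@eventual_monotone_cvg_iterint _ (fun n s => (Fn n s ^+ 2)%:E)) => //.
  - by move=> n; exact: msq.
  - exact: msq.
  - by move=> s n m nm; rewrite lee_fin; apply: lerXn2r; rewrite ?nnegrE// clip_homo.
  - by move=> s; have [N hN] := clip_eventually s; exists N => n /hN ->.
have [n hn] : exists n, Y <= iterint mu q (fun s => (Fn n s ^+ 2)%:E) + rho%:E.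
  apply: contrapT => /forallNP h.
  have : Y <= Y - rho%:E.
    apply: (cvge_to_le cvgY); near=> n; have := h n => /negP; rewrite -ltNge => /ltW.
    by rewrite leeBrDr.
  rewrite -(fineK (_ : Y \is a fin_num)) ?ge0_fin_numE// -EFinB lee_fin.
  by rewrite lerBrDl gerDr leNgt rho0.
exists n.
have yn : iterint mu q (fun s => (Fn n s ^+ 2)%:E) <= Y.
  apply: le_iterint => //; [exact: msq|exact: msq|move=> s].
  by rewrite lee_fin; apply: lerXn2r; rewrite ?nnegrE.
have yfin : iterint mu q (fun s => (Fn n s ^+ 2)%:E) \is a fin_num.
  by rewrite ge0_fin_numE ?iterint_ge0//; exact: le_lt_trans Foo.
have mD : seq_measurable (fun s => ((F s - Fn n s) ^+ 2)%:E).
  refine (msq (fun s => F s - Fn n s)%R _) => k; apply/measurable_EFinP.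
  by apply: measurable_funB; apply/measurable_EFinP; [exact: mF|exact: mFn].
have : iterint mu q (fun s => ((F s - Fn n s) ^+ 2)%:E) +
    iterint mu q (fun s => (Fn n s ^+ 2)%:E) <= Y.
  rewrite -iterintD; last 4 first.
  - by move=> s; rewrite lee_fin sqr_ge0.
  - exact: mD.
  - by move=> s; exact: sq0.
  - exact: msq.
  apply: le_iterint.
  - by move=> s; rewrite adde_ge0// lee_fin sqr_ge0.
  - by move=> k; apply: emeasurable_funD; [exact: mD|exact: (msq _ (mFn n))].
  - exact: msq.
  move=> s /=; rewrite -EFinD lee_fin; have := FnF n s; have := Fn0 n s; nra.
move=> h; have := le_trans h hn; rewrite addeC leeD2lE//.
Unshelve. all: by end_near.
Qed.

End exhaustion.
End clip.

(** * Second and fourth moments of an L^2 limit of simple integrals *)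

Section fourth_moment_limit.
Context {R : realType} {d d' : measure_display}.
Context {Z : measurableType d} {Omega : measurableType d'}.
Variables (P : probability Omega R) (mu : {sigma_finite_measure set Z -> \bar R})
  (eta : R.-ker Omega ~> Z).
Hypothesis Zborel : borel_space R Z.
Hypothesis mu_atomless : atomless mu.
Hypothesis Peta : is_poisson_measure P mu eta.
Variables (q : nat) (F : seq Z -> R) (X : Omega -> R).
Hypothesis F0 : forall s, (0 <= F s)%R.
Hypothesis mF : seq_measurable (EFin \o F).
Hypothesis FP : forall s s', perm_eq s s' -> F s = F s'.
Hypothesis Fq : forall s, size s <> q -> F s = 0%R.
Hypothesis mX : measurable_fun setT X.
Hypothesis Foo : iterint mu q (fun s => (F s ^+ 2)%:E) < +oo.

Local Notation sqdist u v := (iterint mu q (fun s => ((u s - v s) ^+ 2)%:E)).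
Local Notation L2sq Y := (\int[P]_w ((Y w) ^+ 2)%:E).

Hypothesis approx : forall eps : R, (0 < eps)%R -> exists k : simple_kernel mu q,
  sqdist (kfun k) F <= eps%:E /\ L2sq (fun w => kint eta k w - X w)%R <= eps%:E.

Let kint_measurable (k : simple_kernel mu q) : measurable_fun setT (kint eta k).
Proof. by case: (all_moments_kint Peta k). Qed.

Lemma sqdist_measurable (u v : seq Z -> R) : seq_measurable (EFin \o u) -> seq_measurable (EFin \o v) ->
  seq_measurable (fun s => ((u s - v s) ^+ 2 : R)%:E).
Proof.
move=> mU mV k; apply/measurable_EFinP; apply: measurable_funX.
by apply: measurable_funB; apply/measurable_EFinP; [exact: mU|exact: mV].
Qed.

Lemma sqdist_triangle (u v w : seq Z -> R) : seq_measurable (EFin \o u) ->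
  seq_measurable (EFin \o v) -> seq_measurable (EFin \o w) ->
  sqdist u w <= 2%:E * sqdist u v + 2%:E * sqdist v w.
Proof.
move=> mU mV mW; have sq0 (a b : seq Z -> R) s : 0 <= ((a s - b s) ^+ 2 : R)%:E by rewrite lee_fin sqr_ge0.
have m1 := sqdist_measurable mU mV; have m2 := sqdist_measurable mV mW.
rewrite -!iterintZl// -iterintD//; last 4 first.
- by move=> s; rewrite mule_ge0.
- by move=> n; apply: emeasurable_funM => //; exact: (m1 n).
- by move=> s; rewrite mule_ge0.
- by move=> n; apply: emeasurable_funM => //; exact: (m2 n).
apply: le_iterint => //; first exact: sqdist_measurable.
- by move=> n; apply: emeasurable_funD; apply: emeasurable_funM => //; [exact: (m1 n)|exact: (m2 n)].
move=> s /=; rewrite -!EFinM -EFinD lee_fin.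
by have := sqr_ge0 (u s - v s - (v s - w s))%R; nra.
Qed.

Lemma L2sq_triangle (Y1 Y2 Y3 : Omega -> R) : measurable_fun setT Y1 ->
  measurable_fun setT Y2 -> measurable_fun setT Y3 ->
  L2sq (fun w => Y1 w - Y3 w)%R <=
  2%:E * L2sq (fun w => Y1 w - Y2 w)%R + 2%:E * L2sq (fun w => Y2 w - Y3 w)%R.
Proof.
move=> m1 m2 m3; have msq (Y Y' : Omega -> R) : measurable_fun setT Y -> measurable_fun setT Y' ->
    measurable_fun setT (fun w => ((Y w - Y' w) ^+ 2)%:E).
  by move=> mY mY'; apply/measurable_EFinP; apply: measurable_funX; exact: measurable_funB.
have sq0 (a b : Omega -> R) w : 0 <= ((a w - b w) ^+ 2)%:E by rewrite lee_fin sqr_ge0.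
have ma := msq _ _ m1 m2; have mb := msq _ _ m2 m3.
rewrite -!ge0_integralZl//.
rewrite -ge0_integralD//; try by [move=> w _; rewrite mule_ge0|apply: emeasurable_funM].
apply: ge0_le_integral => //; first exact: msq.
  by apply: emeasurable_funD; apply: emeasurable_funM.
move=> w _ /=; rewrite -!EFinM -EFinD lee_fin.
by have := sqr_ge0 (Y1 w - Y2 w - (Y2 w - Y3 w))%R; nra.
Qed.

Lemma L2sq_kint_diff (k k' : simple_kernel mu q) :
  L2sq (fun w => kint eta k w - kint eta k' w)%R = q`!%:R%:E * sqdist (kfun k) (kfun k').
Proof.
rewrite -(kernel_isometry_diff Zborel mu_atomless Peta) expectE//.
apply: all_momentsX; apply: all_momentsD; first exact: all_moments_kint.
rewrite (_ : (fun _ => _) = fun w => -1 * kint eta k' w)%R.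
  by apply: all_momentsM; [exact: (all_moments_cst P (-1)%R)|exact: all_moments_kint].
by apply/funext => w; rewrite mulN1r.
Qed.

Section fixed_clip.
Variables (B : set Z) (K : R).
Hypothesis mB : measurable B.
Hypothesis Boo : mu B < +oo.
Hypothesis K0 : (0 <= K)%R.

Let m := (1 + fine (mu B))%R.
Let m0 : (0 < m)%R. Proof. by rewrite /m ltr_pwDl// fine_ge0. Qed.

(** On the finite-measure set [B^q], [a <= delta + a^2 / delta] is integrated; with
    [delta = tau / (2 m^q)] and the stated L^2 closeness each term contributes at most [tau / 2]. *)
Lemma clip_L1 (u v : seq Z -> R) (tau : R) : (0 < tau)%R ->
  seq_measurable (EFin \o u) -> seq_measurable (EFin \o v) ->
  sqdist u v <= (tau ^+ 2 / (4 * m ^+ q))%:E ->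
  iterint mu q (fun s => `|clip B K u s - clip B K v s|%:E) <= tau%:E.
Proof.
move=> tau0 mU mV uv; pose delta := (tau / (2 * m ^+ q))%R.
have mq : (0 < m ^+ q)%R by rewrite exprn_gt0.
have d0 : (0 < delta)%R by rewrite divr_gt0// mulr_gt0.
have mi : seq_measurable (fun s => (inside B s : R)%:E) by exact: seq_measurable_inside.
have i0 s : 0 <= (inside B s : R)%:E by rewrite lee_fin inside_ge0.
have ms := sqdist_measurable mU mV.
have s0 s : 0 <= ((u s - v s) ^+ 2)%:E by rewrite lee_fin sqr_ge0.
apply: (@le_trans _ _ (iterint mu q (fun s =>
    delta%:E * (inside B s)%:E + (delta^-1)%:E * ((u s - v s) ^+ 2)%:E))).
  apply: le_iterint.
  - by move=> s; rewrite lee_fin normr_ge0.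
  - move=> n; apply/measurable_EFinP; apply: measurableT_comp => //.
    by apply: measurable_funB; apply/measurable_EFinP; exact: clip_measurable.
  - by move=> n; apply: emeasurable_funD; apply: emeasurable_funM => //; [exact: (mi n)|exact: (ms n)].
  move=> s; rewrite -!EFinM -EFinD lee_fin.
  apply: le_trans (clip_lipschitz B u v s K0) _; rewrite -real_normK ?num_real//.
  set a := `|u s - v s|%R; rewrite inside_all; case: all; rewrite ?mulr1 ?mulr0.
    rewrite -(ler_pM2l d0) mulrDr mulrA mulfV ?gt_eqF// mul1r.
    by have := sqr_ge0 (delta - a)%R; have := sqr_ge0 (delta + a)%R; nra.
  by rewrite add0r mulr_ge0 ?invr_ge0 ?sqr_ge0 ?(ltW d0).
rewrite iterintD; last 4 first.
- by move=> s; rewrite mule_ge0// lee_fin ltW.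
- by move=> n; apply: emeasurable_funM => //; exact: (mi n).
- by move=> s; rewrite mule_ge0// lee_fin invr_ge0 ltW.
- by move=> n; apply: emeasurable_funM => //; exact: (ms n).
rewrite !iterintZl ?lee_fin ?invr_ge0 ?(ltW d0)// iterint_inside//.
have Bf : mu B \is a fin_num by rewrite ge0_fin_numE.
have b0 : (0 <= fine (mu B))%R by exact: fine_ge0.
rewrite -(fineK Bf) -EFin_expe.
apply: (@le_trans _ _ (delta%:E * (m ^+ q)%:E + (delta^-1)%:E * (tau ^+ 2 / (4 * m ^+ q))%:E)).
  apply: leeD; last by apply: lee_wpmul2l => //; rewrite lee_fin invr_ge0 ltW.
  rewrite -!EFinM lee_fin; apply: ler_wpM2l; first exact: ltW.
  by apply: lerXn2r; rewrite ?nnegrE ?(ltW m0)// /m lerDr.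
rewrite -!EFinM -EFinD lee_fin le_eqVlt; apply/orP; left; apply/eqP.
by rewrite /delta; field; rewrite !gt_eqF.
Qed.

Lemma clip_stable (g : 'I_4 -> seq Z -> R) (h : 'I_4 -> seq Z -> R) (tau : R) :
  (forall i, seq_measurable (EFin \o g i)) -> (forall i, seq_measurable (EFin \o h i)) ->
  (forall i s s', perm_eq s s' -> g i s = g i s') ->
  (forall i s s', perm_eq s s' -> h i s = h i s') ->
  (forall i s, size s <> q -> g i s = 0%R) ->
  (forall i, iterint mu q (fun s => `|clip B K (g i) s - clip B K (h i) s|%:E) <= tau%:E) ->
  fourth_moment_sum mu q (fun i => clip B K (g i)) <=
  fourth_moment_sum mu q (fun i => clip B K (h i)) +
    (word_total q * (K ^+ 3 * m ^+ (2 * q)) * (4 * tau))%:E.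
Proof.
move=> mg mh gP hP gq gh.
have := @fourth_moment_stable R d Z mu q B K (fun i => clip B K (g i)) (fun i => clip B K (h i)) mB Boo.
move=> /(_ (fun i s => clip_range B (g i) s K0) (fun i s => clip_range B (h i) s K0)).
move=> /(_ (fun i => clip_measurable K mB (mg i)) (fun i => clip_measurable K mB (mh i))).
move=> /(_ (fun i s s' ss' => clip_perm B K (gP i _ _ ss') ss')).
move=> /(_ (fun i s s' ss' => clip_perm B K (hP i _ _ ss') ss')).
move=> /(_ (fun i s sq => clip_zero B K0 (gq i s sq)) (fun i s => @clip_outside _ _ _ B K (g i) s)).
move=> h1; apply: le_trans h1 _; apply: leeD => //; rewrite [leRHS]EFinM.
apply: lee_wpmul2l.
  rewrite lee_fin !mulr_ge0// ?exprn_ge0// ?(ltW m0)//.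
  by apply: sumr_ge0 => N _; rewrite mulr_ge0// sumr_ge0.
rewrite !big_ord_recl big_ord0 adde0.
rewrite (_ : 4 * tau = tau + (tau + (tau + tau)))%R; last by ring.
by rewrite !EFinD; do ?[apply: leeD]; exact: gh.
Qed.

End fixed_clip.

(** [x^4 - 4 x g^3 + 3 g^4 = (x - g)^2 ((x + g)^2 + 2 g^2)] is nonnegative. Replacing [x] by an
    approximation [h] costs [4 (h - x) g^3], absorbed by [(h - x)^2] and [g^6]. *)
Lemma young_fourth (x g h delta : R) : (0 < delta)%R ->
  (4 * (h * g ^+ 3) <= (x ^+ 4 + 4 / delta * (h - x) ^+ 2) + (3 * g ^+ 4 + 4 * delta * g ^+ 6))%R.
Proof.
move=> d0.
have A : (0 <= (x - g) ^+ 2 * ((x + g) ^+ 2 + 2 * g ^+ 2))%R.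
  by rewrite mulr_ge0 ?sqr_ge0// addr_ge0 ?sqr_ge0// mulr_ge0// sqr_ge0.
have Bd : ((h - x) * g ^+ 3 <= delta * (g ^+ 3) ^+ 2 + delta^-1 * (h - x) ^+ 2)%R.
  rewrite -(ler_pM2l d0) mulrDr [(delta * (delta^-1 * _))%R]mulrA mulfV ?gt_eqF// mul1r.
  set a := (h - x)%R; set b := (g ^+ 3)%R.
  by have := sqr_ge0 (delta * b - a)%R; have := sqr_ge0 (delta * b)%R; have := sqr_ge0 a; nra.
have -> : (g ^+ 6 = (g ^+ 3) ^+ 2)%R by rewrite -exprM.
by move: (delta^-1)%R Bd => di Bd; nra.
Qed.

(** The fourth power has slope at most [4 r^3] on [[0, r]]: after truncation, L^1 closeness is
    enough. *)
Lemma truncated_fourth (x y r : R) : (0 <= r)%R ->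
  (Num.min `|x| r ^+ 4 <= y ^+ 4 + 4 * r ^+ 3 * `|y - x|)%R.
Proof.
move=> r0; set a := Num.min _ _.
have a0 : (0 <= a)%R by rewrite le_min normr_ge0.
have ar : (a <= r)%R by rewrite ge_min lexx orbT.
have ax : (a <= `|x|)%R by rewrite ge_min lexx.
have -> : (y ^+ 4 = `|y| ^+ 4)%R by rewrite -normrX ger0_norm// exprn_even_ge0.
have b0 : (0 <= `|y|)%R by [].
have xy : (`|x| - `|y| <= `|y - x|)%R by rewrite distrC; exact: lerB_dist.
have n0 : (0 <= `|y - x|)%R by [].
move: (`|y|)%R (`|y - x|)%R b0 xy n0 => b N b0 xy n0.
have r3 : (0 <= r ^+ 3)%R by exact: exprn_ge0.
have [ab|ab] := leP a b.
  apply: (@le_trans _ _ (b ^+ 4)%R); first by apply: lerXn2r.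
  by rewrite lerDl !mulr_ge0.
have abN : (a - b <= N)%R by lra.
have h : ((a + b) * (a ^+ 2 + b ^+ 2) <= 4 * r ^+ 3)%R.
  have br : (b <= r)%R by lra.
  have -> : (4 * r ^+ 3 = (r + r) * (r ^+ 2 + r ^+ 2))%R by ring.
  apply: ler_pM; rewrite ?addr_ge0 ?sqr_ge0//; first exact: lerD.
  by apply: lerD; apply: lerXn2r.
rewrite -lerBlDl (_ : a ^+ 4 - b ^+ 4 = (a + b) * (a ^+ 2 + b ^+ 2) * (a - b))%R; last by ring.
apply: ler_pM => //; last by lra.
by rewrite mulr_ge0// addr_ge0 ?sqr_ge0.
Qed.

(** [U] may be negative and the integral of [W] infinite, so the comparison goes through the
    positive part of [U]. *)
Lemma expect_le_integral (U : Omega -> R) (W : Omega -> \bar R) : all_moments P U ->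
  measurable_fun setT W -> (forall w, 0 <= W w) -> (forall w, (U w)%:E <= W w) ->
  (expect P U)%:E <= \int[P]_w W w.
Proof.
move=> Um mW W0 UW; rewrite expectE// integralE.
apply: (@le_trans _ _ (\int[P]_w (EFin \o U)^\+ w)).
  by apply: geeDl; rewrite oppe_le0; apply: integral_ge0 => w _; exact: funeneg_ge0.
apply: ge0_le_integral => //.
- by apply: measurable_funepos; apply/measurable_EFinP; case: Um.
- by move=> w _; rewrite funeposE ge_max UW W0.
Qed.

Lemma sqdistC (u v : seq Z -> R) : sqdist u v = sqdist v u.
Proof. by apply: eq_iterint => s _; rewrite -opprB sqrrN. Qed.

Lemma sqdist_le (u v u' v' : seq Z -> R) : seq_measurable (EFin \o u) ->
  seq_measurable (EFin \o v) -> seq_measurable (EFin \o u') -> seq_measurable (EFin \o v') ->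
  (forall s, `|u s - v s| <= `|u' s - v' s|)%R -> sqdist u v <= sqdist u' v'.
Proof.
move=> mU mV mU' mV' h; apply: le_iterint.
- by move=> s; rewrite lee_fin sqr_ge0.
- exact: sqdist_measurable.
- exact: sqdist_measurable.
by move=> s; rewrite lee_fin -(real_normK (num_real (u s - v s)))
  -(real_normK (num_real (u' s - v' s))); apply: lerXn2r; rewrite ?nnegrE.
Qed.

Lemma clip_contracts (B : set Z) (K : R) (u v : seq Z -> R) : measurable B -> (0 <= K)%R ->
  seq_measurable (EFin \o u) -> seq_measurable (EFin \o v) ->
  sqdist (clip B K u) (clip B K v) <= sqdist u v.
Proof.
move=> mB K0 mU mV; apply: sqdist_le => //; try exact: clip_measurable.
move=> s; apply: le_trans (clip_lipschitz B u v s K0) _.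
by rewrite ler_piMr// inside_le1.
Qed.

Let mkfun (k : simple_kernel mu q) : seq_measurable (EFin \o kfun k).
Proof. exact: kfun_measurable. Qed.

Let qf0 : (0 <= q`!%:R :> R)%R. Proof. exact: ler0n. Qed.

(** The chain [kfun g], clipped [F], [F], [kfun k] gives squared distance [6 eps + 4 D], a factor 2
    being lost at each link. The isometry multiplies by [q!], and the last link to [X] doubles this
    and adds [2 eps]. *)
Lemma kint_clip_dist (B : set Z) (K eps D : R) (k g : simple_kernel mu q) :
  measurable B -> (0 <= K)%R ->
  kfun g = clip B K (kfun k) -> sqdist (kfun k) F <= eps%:E ->
  L2sq (fun w => kint eta k w - X w)%R <= eps%:E -> sqdist F (clip B K F) <= D%:E ->
  L2sq (fun w => kint eta g w - X w)%R <= ((2 + 12 * q`!%:R) * eps + 8 * q`!%:R * D)%:E.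
Proof.
move=> mB K0 gE kF kX FD.
have mC : seq_measurable (EFin \o clip B K F) by exact: clip_measurable.
have h1 : sqdist (kfun g) (clip B K F) <= eps%:E.
  by rewrite gE; apply: le_trans kF; exact: clip_contracts.
have h2 : sqdist (clip B K F) (kfun k) <= (2 * D + 2 * eps)%:E.
  apply: le_trans (sqdist_triangle mC mF (mkfun k)) _.
  rewrite (EFinD (2 * D)) (EFinM 2 D) (EFinM 2 eps) (sqdistC (clip B K F)) (sqdistC F (kfun k)).
  by apply: leeD; apply: lee_wpmul2l.
have h3 : sqdist (kfun g) (kfun k) <= (2 * eps + 2 * (2 * D + 2 * eps))%:E.
  apply: le_trans (sqdist_triangle (mkfun g) mC (mkfun k)) _.
  by rewrite (EFinD (2 * eps)) (EFinM 2 eps) (EFinM 2 (2 * D + 2 * eps)); apply: leeD; apply: lee_wpmul2l.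
apply: le_trans (L2sq_triangle (kint_measurable g) (kint_measurable k) mX) _.
apply: (@le_trans _ _ (2%:E * (q`!%:R%:E * (2 * eps + 2 * (2 * D + 2 * eps))%:E) + 2%:E * eps%:E)).
  by rewrite L2sq_kint_diff; apply: leeD; apply: lee_wpmul2l => //; apply: lee_wpmul2l.
by rewrite -!EFinM -EFinD lee_fin le_eqVlt; apply/orP; left; apply/eqP; ring.
Qed.

Lemma kint_pos_dist (eps : R) (k : simple_kernel mu q) : sqdist (kfun k) F <= eps%:E ->
  L2sq (fun w => kint eta k w - X w)%R <= eps%:E ->
  L2sq (fun w => kint eta (kernel_pos k) w - X w)%R <= ((2 + 2 * q`!%:R) * eps)%:E.
Proof.
move=> kF kX; apply: le_trans (L2sq_triangle (kint_measurable _) (kint_measurable k) mX) _.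
apply: (@le_trans _ _ (2%:E * (q`!%:R%:E * eps%:E) + 2%:E * eps%:E)).
  rewrite L2sq_kint_diff; apply: leeD; apply: lee_wpmul2l => //; apply: lee_wpmul2l => //.
  (* Since [F >= 0], taking the positive part moves the kernel by at most its distance to [F]. *)
  apply: le_trans kF; apply: sqdist_le => // s; rewrite kfun_pos.
  have := F0 s; case: (lerP (kfun k s) 0%R) => h1 h2; last by rewrite subrr normr0.
  have h3 : (kfun k s - F s <= 0)%R by lra.
  by rewrite sub0r normrN (ler0_norm h1) (ler0_norm h3); lra.
by rewrite -!EFinM -EFinD lee_fin le_eqVlt; apply/orP; left; apply/eqP; ring.
Qed.

Let kernel_fourth_self (k : simple_kernel mu q) : knonneg k ->
  \int[P]_w (kint eta k w ^+ 4)%:E = fourth_moment_sum mu q (fun=> kfun k).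
Proof.
move=> k0; rewrite (_ : (fun=> kfun k) = fun i : 'I_4 => if i == 0%R :> 'I_4 then kfun k else kfun k).
  rewrite -(kernel_fourth_moment Zborel mu_atomless Peta k0 k0) expectE.
    by apply: eq_integral => w _; rewrite -exprS.
  by apply: all_momentsM; [|apply: all_momentsX]; exact: all_moments_kint.
by apply/funext => i; rewrite if_same.
Qed.

Section exhausted.
Variable B : nat -> set Z.
Hypothesis mB : forall n, measurable (B n).
Hypothesis Bfin : forall n, mu (B n) < +oo.
Hypothesis Bhomo : {homo B : n m / (n <= m)%N >-> (n <= m)%O}.
Hypothesis Bcover : [set: Z] = \bigcup_n B n.

Let Fn n := clip (B n) n%:R F.
Let m n : R := (1 + fine (mu (B n)))%R.
Let C n : R := (word_total q * (n%:R ^+ 3 * m n ^+ (2 * q)))%R.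
Let m0 n : (0 < m n)%R. Proof. by rewrite /m ltr_pwDl// fine_ge0. Qed.
Let C0 n : (0 <= C n)%R.
Proof.
rewrite /C !mulr_ge0 ?exprn_ge0 ?(ltW (m0 n))//.
by apply: sumr_ge0 => N _; rewrite mulr_ge0// sumr_ge0.
Qed.
Let closeness n (tau : R) := (tau ^+ 2 / (4 * m n ^+ q))%R.
Let closeness0 n tau : (0 < tau)%R -> (0 < closeness n tau)%R.
Proof. by move=> t0; rewrite /closeness divr_gt0 ?exprn_gt0// mulr_gt0// exprn_gt0. Qed.

Let stable_from n (tau eps : R) (k k' : simple_kernel mu q) : (0 < tau)%R ->
  (eps <= closeness n tau)%R -> sqdist (kfun k) F <= eps%:E -> sqdist (kfun k') F <= eps%:E ->
  fourth_moment_sum mu q (fun=> Fn n) <=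
  fourth_moment_sum mu q (fun i : 'I_4 => clip (B n) n%:R (if i == 0%R :> 'I_4 then kfun k else kfun k'))
   + (C n * (4 * tau))%:E.
Proof.
move=> t0 et kF k'F.
apply: (@clip_stable (B n) n%:R (mB n) (Bfin n) (ler0n _ _) (fun=> F)
  (fun i : 'I_4 => if i == 0%R :> 'I_4 then kfun k else kfun k')) => //.
- by move=> i; case: ifP.
- by move=> i s s' ss'; case: ifP => _; exact: kfun_perm.
by move=> i; case: ifP => _; apply: clip_L1 => //; rewrite sqdistC;
  [apply: le_trans kF _|apply: le_trans k'F _]; rewrite lee_fin.
Qed.

Let stable_to n (tau eps : R) (k : simple_kernel mu q) : (0 < tau)%R ->
  (eps <= closeness n tau)%R -> sqdist (kfun k) F <= eps%:E ->
  fourth_moment_sum mu q (fun=> clip (B n) n%:R (kfun k)) <=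
  fourth_moment_sum mu q (fun=> Fn n) + (C n * (4 * tau))%:E.
Proof.
move=> t0 et kF.
apply: (@clip_stable (B n) n%:R (mB n) (Bfin n) (ler0n _ _) (fun=> kfun k) (fun=> F)) => //.
- by move=> i s s' ss'; exact: kfun_perm.
- by move=> i s; exact: kfun_size.
by move=> i; apply: clip_L1 => //; apply: le_trans kF _; rewrite lee_fin.
Qed.

Let le_clip_total n : fourth_moment_sum mu q (fun=> Fn n) <= fourth_moment_sum mu q (fun=> F).
Proof.
apply: le_fourth_moment_sum => // i; first exact: clip_measurable.
by move=> s; rewrite clip_le// andbT; case/andP: (clip_range (B n) F s (ler0n R n)).
Qed.

(** [X] is compared in L^2 with the integral of a clipped kernel [g], whose fourth moment is an
    exact word sum and, by stability, at most that of the clipped [F] plus a small error. The level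
    [n] is fixed before the closeness, because the stability constant depends on it. *)
Lemma truncated_fourth_moment_le (r : R) : (0 <= r)%R ->
  \int[P]_w ((Num.min `|X w| r) ^+ 4)%:E <= fourth_moment_sum mu q (fun=> F).
Proof.
move=> r0; apply/lee_addgt0Pr => e e0.
(* The error [e] is shared out: half for the stability of the clipped sums, a quarter for each of
   the two equal terms [L delta] and [(L / delta) delta^2]. *)
pose L := (4 * r ^+ 3)%R; have L0 : (0 <= L)%R by rewrite mulr_ge0// exprn_ge0.
pose delta := (e / (4 * (L + 1)))%R.
have d0 : (0 < delta)%R by rewrite divr_gt0// mulr_gt0// ltr_wpDl.
pose Q := (q`!%:R : R)%R; have Q0 : (0 <= Q)%R by [].
have rho0 : (0 < delta ^+ 2 / (2 * (8 * Q + 1)))%R.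
  by rewrite divr_gt0 ?exprn_gt0// mulr_gt0// ltr_wpDl// mulr_ge0.
have [n hn] := square_clip_cvg F0 mF mB Bhomo Bcover rho0 Foo.
pose tau := (e / (8 * (C n + 1)))%R.
have t0 : (0 < tau)%R by rewrite divr_gt0// mulr_gt0// ltr_wpDl.
pose eps := Num.min (delta ^+ 2 / (2 * (2 + 12 * Q)))%R (closeness n tau).
have Qp : (0 < 2 + 12 * Q)%R by rewrite ltr_pwDl// mulr_ge0.
have e1 : (0 < eps)%R by rewrite lt_min closeness0// divr_gt0 ?exprn_gt0// mulr_gt0.
have et : (eps <= closeness n tau)%R by rewrite ge_min lexx orbT.
have [k [kF kX]] := approx e1.
have [g [gE g0]] := kernel_clip k (mB n) (Bfin n) (ler0n R n).
have gX := kint_clip_dist (mB n) (ler0n R n) gE kF kX hn.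
set E := (X in _ <= X%:E) in gX.
have Ed : (E <= delta ^+ 2)%R.
  have h1 : ((2 + 12 * Q) * eps <= delta ^+ 2 / 2)%R.
    apply: (@le_trans _ _ ((2 + 12 * Q) * (delta ^+ 2 / (2 * (2 + 12 * Q))))%R).
      by rewrite ler_pM2l// ge_min lexx.
    by rewrite le_eqVlt; apply/orP; left; apply/eqP; field; rewrite gt_eqF.
  have h2 : (8 * Q * (delta ^+ 2 / (2 * (8 * Q + 1))) <= delta ^+ 2 / 2)%R.
    have Q8 : (0 < 8 * Q + 1)%R by rewrite ltr_wpDl// mulr_ge0.
    rewrite mulrA ler_pdivrMr ?mulr_gt0//; have := sqr_ge0 delta; nra.
  by rewrite /E -/Q; lra.
have sg := stable_to t0 et kF.
have mG := kint_measurable g.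
have mGX : measurable_fun setT (fun w => ((kint eta g w - X w) ^+ 2)%:E).
  by apply/measurable_EFinP; apply: measurable_funX; exact: measurable_funB.
have mG4 : measurable_fun setT (fun w => (kint eta g w ^+ 4)%:E).
  by apply/measurable_EFinP; exact: measurable_funX.
have mT : measurable_fun setT (fun w => (Num.min `|X w| r ^+ 4)%:E).
  apply/measurable_EFinP; apply: measurable_funX; apply: measurable_minr => //.
  exact: measurableT_comp.
have sq0 w : 0 <= ((kint eta g w - X w) ^+ 2)%:E by rewrite lee_fin sqr_ge0.
have f0 w : 0 <= (kint eta g w ^+ 4)%:E by rewrite lee_fin exprn_even_ge0.
apply: (@le_trans _ _ (\int[P]_w ((kint eta g w ^+ 4)%:E +
    ((L * delta)%:E + (L / delta)%:E * ((kint eta g w - X w) ^+ 2)%:E)))).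
  apply: ge0_le_integral => //.
  - by move=> w _; rewrite lee_fin exprn_ge0// le_min normr_ge0.
  - by apply: emeasurable_funD => //; apply: emeasurable_funD => //; exact: emeasurable_funM.
  move=> w _; rewrite -!EFinM -!EFinD lee_fin.
  apply: le_trans (truncated_fourth (X w) (kint eta g w) r0) _; rewrite lerD2l -/L.
  rewrite -(real_normK (num_real (kint eta g w - X w))); set a := `|_ - X w|%R.
  rewrite (_ : L * delta + L / delta * a ^+ 2 = L * (delta + delta^-1 * a ^+ 2))%R; last first.
    by rewrite mulrDr !mulrA.
  apply: ler_wpM2l => //.
  rewrite -(ler_pM2l d0) mulrDr [(delta * (delta^-1 * _))%R]mulrA mulfV ?gt_eqF// mul1r.
  have := sqr_ge0 (delta - a)%R; have := sqr_ge0 delta; have := sqr_ge0 a; nra.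
have Ld : (0 <= L / delta)%R by rewrite divr_ge0// ltW.
have Ld' : (0 <= L * delta)%R by rewrite mulr_ge0// ltW.
rewrite ge0_integralD//; last 2 first.
- by move=> w _; apply: adde_ge0; [rewrite lee_fin|apply: mule_ge0; [rewrite lee_fin|exact: sq0]].
- by apply: emeasurable_funD => //; exact: emeasurable_funM.
rewrite (ge0_integralD P measurableT (f1 := cst (L * delta)%:E)); last 4 first.
- by move=> w _; rewrite lee_fin.
- exact: measurable_cst.
- by move=> w _; apply: mule_ge0; [rewrite lee_fin|exact: sq0].
- exact: emeasurable_funM.
rewrite integral_prob_cst ge0_integralZl//.
rewrite kernel_fourth_self// gE.
apply: (@le_trans _ _ ((fourth_moment_sum mu q (fun=> F) + (C n * (4 * tau))%:E) +
    ((L * delta)%:E + (L / delta)%:E * (delta ^+ 2)%:E))).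
  apply: leeD; first by apply: le_trans sg _; rewrite leeD2r.
  rewrite leeD2l//; apply: lee_wpmul2l => //; apply: le_trans gX _; by rewrite lee_fin.
rewrite -!EFinM -EFinD -addeA -EFinD; apply: leeD => //; rewrite lee_fin.
have h1 : (C n * (4 * tau) <= e / 2)%R.
  have Cp : (0 < C n + 1)%R by rewrite ltr_wpDl.
  rewrite (_ : C n * (4 * tau) = (e / 2) * (C n / (C n + 1)))%R; last first.
    by rewrite /tau; field; rewrite gt_eqF.
  by rewrite ler_piMr ?divr_ge0 ?(ltW e0)// ler_pdivrMr// mul1r lerDl.
have h2 : (L * delta <= e / 4)%R.
  have Lp : (0 < L + 1)%R by rewrite ltr_wpDl.
  rewrite (_ : L * delta = (e / 4) * (L / (L + 1)))%R; last first.
    by rewrite /delta; field; rewrite gt_eqF.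
  by rewrite ler_piMr ?divr_ge0 ?(ltW e0)// ler_pdivrMr// mul1r lerDl.
have h3 : (L / delta * delta ^+ 2 = L * delta)%R by field; rewrite gt_eqF.
by rewrite h3; lra.
Qed.

(** Let [S] be the clipped sum, [a = E[h g^3]] with [h] close to [X] and [g] clipped, and [b =
    E[g^4]]. Stability gives [a >= S] and [b <= S] up to errors, so Young's bound on [4 a - 3 b]
    leaves one [S] below [E[X^4]]. *)
Lemma clip_fourth_moment_le n :
  fourth_moment_sum mu q (fun=> Fn n) <= \int[P]_w (X w ^+ 4)%:E.
Proof.
have X40 w : 0 <= (X w ^+ 4)%:E by rewrite lee_fin exprn_even_ge0.
have mX4 : measurable_fun setT (fun w => (X w ^+ 4)%:E).
  by apply/measurable_EFinP; exact: measurable_funX.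
apply/lee_addgt0Pr => e e0.
pose Q := (q`!%:R : R)%R; have Q0 : (0 <= Q)%R by [].
(* The stability errors add up to [(4 + 3) * 4 = 28] times [C n * tau], which is to be at most
   [e / 3]; hence 84. *)
pose tau := (e / (84 * (C n + 1)))%R.
have Cp : (0 < C n + 1)%R by rewrite ltr_wpDl.
have t0 : (0 < tau)%R by rewrite divr_gt0// mulr_gt0.
have [k1 [k1F k1X]] := approx (closeness0 n t0).
have [g [gE g0]] := kernel_clip k1 (mB n) (Bfin n) (ler0n R n).
have amG6 : all_moments P (fun w => kint eta g w ^+ 6)%R.
  by apply: all_momentsX; exact: all_moments_kint.
have amG4 : all_moments P (fun w => kint eta g w ^+ 4)%R.
  by apply: all_momentsX; exact: all_moments_kint.
pose M := expect P (fun w => kint eta g w ^+ 6)%R.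
have M0 : (0 <= M)%R by apply: expect_ge0 => w; rewrite exprn_even_ge0.
have Mp : (0 < M + 1)%R by rewrite ltr_wpDl.
(* The sixth moment of [g] determines [delta], so [g] must be fixed before [h], whose distance to
   [X] is multiplied by [4 / delta]. *)
pose delta := (e / (12 * (M + 1)))%R.
have d0 : (0 < delta)%R by rewrite divr_gt0// mulr_gt0.
have Qp : (0 < 2 + 2 * Q)%R by rewrite ltr_pwDl// mulr_ge0.
pose eps := Num.min (delta * e / (12 * (2 + 2 * Q)))%R (closeness n tau).
have e1 : (0 < eps)%R.
  by rewrite lt_min closeness0// andbT divr_gt0// mulr_gt0.
have et : (eps <= closeness n tau)%R by rewrite ge_min lexx orbT.
have [k2 [k2F k2X]] := approx e1.
pose h := kernel_pos k2.
have h0 : knonneg h by exact: kernel_pos_nonneg.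
have hX := kint_pos_dist k2F k2X; rewrite -/h in hX.
have k2F' : sqdist (kfun k2) F <= (closeness n tau)%:E by apply: le_trans k2F _; rewrite lee_fin.
have lo := stable_from t0 (lexx _) k2F' k1F.
have hi := stable_to t0 (lexx _) k1F; rewrite -gE in hi.
pose a := expect P (fun w => kint eta h w * kint eta g w ^+ 3)%R.
pose b := expect P (fun w => kint eta g w ^+ 4)%R.
have amHG : all_moments P (fun w => kint eta h w * kint eta g w ^+ 3)%R.
  by apply: all_momentsM; [|apply: all_momentsX]; exact: all_moments_kint.
(* The factor [h] has to stay close to [X] and is therefore not clipped; being nonnegative, its
   kernel dominates its clip, and so do the word integrals. *)
have lo' : fourth_moment_sum mu q (fun=> Fn n) <= (a + C n * (4 * tau))%:E.
  apply: le_trans lo _; rewrite EFinD; apply: leeD => //.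
  rewrite /a (kernel_fourth_moment Zborel mu_atomless Peta h0 g0).
  apply: le_fourth_moment_sum.
  - by move=> i; apply: clip_measurable => //; case: ifP.
  - by move=> i; case: ifP.
  move=> i s; case/andP: (clip_range (B n) (if i == 0%R :> 'I_4 then kfun k2 else kfun k1) s (ler0n R n)).
  move=> -> _ /=; case: ifP => _; last by rewrite gE.
  rewrite kfun_pos /clip; case: ifP => _; last by rewrite le_max lexx orbT.
  by rewrite ge_min lexx.
have hi' : b%:E <= fourth_moment_sum mu q (fun=> Fn n) + (C n * (4 * tau))%:E.
  by rewrite /b expectE// kernel_fourth_self.
have S0 : 0 <= fourth_moment_sum mu q (fun=> Fn n).
  apply: mule_ge0; first by rewrite lee_fin exprn_ge0.
  apply: sume_ge0 => N _; apply: mule_ge0; first by rewrite lee_fin invr_ge0.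
  apply: sume_ge0 => w _; apply: Jword_ge0 => i s.
  by case/andP: (clip_range (B n) F s (ler0n R n)).
have mh := kint_measurable h; have mg := kint_measurable g.
have mHX : measurable_fun setT (fun w => ((kint eta h w - X w) ^+ 2)%:E).
  by apply/measurable_EFinP; apply: measurable_funX; exact: measurable_funB.
have sq0 w : 0 <= ((kint eta h w - X w) ^+ 2)%:E by rewrite lee_fin sqr_ge0.
have dd0 : (0 <= 4 / delta)%R by rewrite divr_ge0// ltW.
have yo : (4 * a - 3 * b - 4 * delta * M)%:E <= \int[P]_w (X w ^+ 4)%:E +
    (4 / delta * ((2 + 2 * Q) * eps))%:E.
  pose U w := (4 * (kint eta h w * kint eta g w ^+ 3) +
    ((- 3) * kint eta g w ^+ 4 + (- (4 * delta)) * kint eta g w ^+ 6))%R.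
  have amc c Y : all_moments P Y -> all_moments P (fun w => c * Y w)%R.
    by move=> amY; apply: all_momentsM => //; exact: (all_moments_cst P c).
  have amU : all_moments P U.
    by apply: all_momentsD; [exact: amc|apply: all_momentsD; exact: amc].
  have -> : (4 * a - 3 * b - 4 * delta * M = expect P U)%R.
    rewrite /U expectD; [|exact: amc|apply: all_momentsD; exact: amc].
    rewrite expectD; [|exact: amc|exact: amc].
    by rewrite !expectZ// /a /b /M; ring.
  apply: (@le_trans _ _ (\int[P]_w ((X w ^+ 4)%:E + (4 / delta)%:E * ((kint eta h w - X w) ^+ 2)%:E))).
    apply: expect_le_integral => //.
    - by apply: emeasurable_funD => //; exact: emeasurable_funM.
    - by move=> w; apply: adde_ge0 => //; apply: mule_ge0; [rewrite lee_fin|exact: sq0].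
    move=> w; rewrite -!EFinM -EFinD lee_fin /U.
    by have := young_fourth (X w) (kint eta g w) (kint eta h w) d0; lra.
  rewrite ge0_integralD//; last 2 first.
  - by move=> w _; apply: mule_ge0; [rewrite lee_fin|exact: sq0].
  - exact: emeasurable_funM.
  rewrite leeD2l// ge0_integralZl// [leRHS]EFinM; apply: lee_wpmul2l => //.
have h1 : (4 / delta * ((2 + 2 * Q) * eps) <= e / 3)%R.
  apply: (@le_trans _ _ (4 / delta * ((2 + 2 * Q) * (delta * e / (12 * (2 + 2 * Q)))))%R).
    by apply: ler_wpM2l => //; rewrite ler_pM2l// ge_min lexx.
  by rewrite le_eqVlt; apply/orP; left; apply/eqP; field; rewrite !gt_eqF.
have frac (x y : R) : (0 <= y)%R -> (x * (y / (y + 1)) <= `|x|)%R.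
  move=> y0; have yp : (0 < y + 1)%R by rewrite ltr_wpDl.
  apply: le_trans (ler_norm _) _; rewrite normrM ler_piMr// ger0_norm ?divr_ge0 ?(ltW yp)//.
  by rewrite ler_pdivrMr// mul1r lerDl.
have h2 : (4 * delta * M <= e / 3)%R.
  rewrite (_ : 4 * delta * M = (e / 3) * (M / (M + 1)))%R; last first.
    by rewrite /delta; field; rewrite gt_eqF.
  by apply: le_trans (frac _ _ M0) _; rewrite ger0_norm// divr_ge0// ltW.
have h3 : (28 * (C n * tau) <= e / 3)%R.
  rewrite (_ : 28 * (C n * tau) = (e / 3) * (C n / (C n + 1)))%R; last first.
    by rewrite /tau; field; rewrite gt_eqF.
  by apply: le_trans (frac _ _ (C0 n)) _; rewrite ger0_norm// divr_ge0// ltW.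
have Sfin : fourth_moment_sum mu q (fun=> Fn n) \is a fin_num.
  by rewrite ge0_fin_numE//; apply: le_lt_trans lo' _; rewrite ltry.
have I0 : 0 <= \int[P]_w (X w ^+ 4)%:E by apply: integral_ge0 => w _.
move: lo' hi' yo I0; rewrite -(fineK Sfin); set s := fine _.
case: (\int[P]_w (X w ^+ 4)%:E) => [x| |]//; last first.
  by move=> _ _ _ _; rewrite addye// leey.
by rewrite -!EFinD !lee_fin => h4 h5 h6 _; lra.
Qed.

End exhausted.

Lemma fourth_moment_limit : \int[P]_w (X w ^+ 4)%:E = fourth_moment_sum mu q (fun=> F).
Proof.
have /sigma_finiteP[B [Bcover Bhomo Bfin]] := sigma_finiteT mu.
have mB n : measurable (B n) by have [] := Bfin n.
have Boo n : mu (B n) < +oo by have [] := Bfin n.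
apply/eqP; rewrite eq_le; apply/andP; split; last first.
  have cv : fourth_moment_sum mu q (fun=> clip (B n) n%:R F) @[n --> \oo] -->
      fourth_moment_sum mu q (fun=> F) by exact: fourth_moment_clip_cvg.
  by apply: (cvge_to_le cv); near=> n; exact: clip_fourth_moment_le.
have cv : \int[P]_w ((Num.min `|X w| n%:R) ^+ 4)%:E @[n --> \oo] --> \int[P]_w (X w ^+ 4)%:E.
  apply: (@eventual_monotone_cvg _ _ _ P (fun n w => ((Num.min `|X w| n%:R) ^+ 4)%:E)).
  - move=> n; apply/measurable_EFinP; apply: measurable_funX; apply: measurable_minr => //.
    exact: measurableT_comp.
  - by move=> n w; rewrite lee_fin exprn_ge0// le_min normr_ge0 ler0n.
  - move=> w n p np; rewrite lee_fin; apply: lerXn2r; rewrite ?nnegrE ?le_min ?normr_ge0 ?ler0n//.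
    by rewrite !ge_min lexx /= ler_nat np orbT.
  move=> w; exists (Num.Def.archi_bound `|X w|) => n Nn; rewrite min_l.
    by rewrite -normrX ger0_norm// exprn_even_ge0.
  apply: ltW; apply: lt_le_trans (archi_boundP (normr_ge0 (X w))) _.
  by rewrite ler_nat.
apply: (cvge_to_le cv); near=> n.
by apply: (truncated_fourth_moment_le mB Boo Bhomo Bcover); exact: ler0n.
Unshelve. all: by end_near.
Qed.

Lemma square_perturb d1 (T : measurableType d1) (m : {measure set T -> \bar R}) (f g : T -> R)
    (delta : R) : (0 < delta)%R -> measurable_fun setT f -> measurable_fun setT g ->
  \int[m]_x (f x ^+ 2)%:E <= (1 + delta)%:E * \int[m]_x (g x ^+ 2)%:E +
     (1 + delta^-1)%:E * \int[m]_x ((f x - g x) ^+ 2)%:E.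
Proof.
move=> d0 mf mg.
have m1 : measurable_fun setT (fun x => (g x ^+ 2)%:E).
  by apply/measurable_EFinP; exact: measurable_funX.
have m2 : measurable_fun setT (fun x => ((f x - g x) ^+ 2)%:E).
  by apply/measurable_EFinP; apply: measurable_funX; exact: measurable_funB.
have c1 : (0 <= 1 + delta)%R by rewrite addr_ge0// ltW.
have c2 : (0 <= 1 + delta^-1)%R by rewrite addr_ge0// invr_ge0 ltW.
have s1 x : 0 <= (g x ^+ 2)%:E by rewrite lee_fin sqr_ge0.
have s2 x : 0 <= ((f x - g x) ^+ 2)%:E by rewrite lee_fin sqr_ge0.
rewrite -!ge0_integralZl// -ge0_integralD//; last 4 first.
- by move=> x _; exact: mule_ge0.
- exact: emeasurable_funM.
- by move=> x _; exact: mule_ge0.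
- exact: emeasurable_funM.
apply: ge0_le_integral => //.
- by move=> x _; rewrite lee_fin sqr_ge0.
- by apply/measurable_EFinP; exact: measurable_funX.
- by apply: emeasurable_funD; exact: emeasurable_funM.
move=> x _; rewrite -!EFinM -EFinD lee_fin.
rewrite -(ler_pM2l d0) (_ : delta * ((1 + delta) * g x ^+ 2 + (1 + delta^-1) * (f x - g x) ^+ 2) =
  delta * (1 + delta) * g x ^+ 2 + (delta + 1) * (f x - g x) ^+ 2)%R; last by field; rewrite gt_eqF.
by have := sqr_ge0 (delta * g x - (f x - g x))%R; nra.
Qed.

Lemma le_of_small_perturb (x c Y b : R) : (0 <= c)%R -> (0 <= Y)%R -> (0 <= b)%R ->
  (forall delta, 0 < delta -> x <= (1 + delta) * (c * ((1 + delta) * Y + (delta ^+ 2 + delta))) +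
     b * (delta ^+ 2 + delta))%R -> (x <= c * Y)%R.
Proof.
move=> c0 Y0 b0 h; apply/ler_addgt0Pr => e e0.
(* For [delta <= 1] the error is at most [delta] times [3 c Y + 4 c + 2 b]; the final 1 makes [K]
   positive. *)
pose K := (3 * (c * Y) + 4 * c + 2 * b + 1)%R.
have cY : (0 <= c * Y)%R by rewrite mulr_ge0.
have K0 : (0 < K)%R by rewrite ltr_wpDl// !addr_ge0// mulr_ge0.
pose t := Num.min 1%R (e / K)%R.
have t0 : (0 < t)%R by rewrite lt_min ltr01 divr_gt0.
have t1 : (t <= 1)%R by rewrite ge_min lexx.
have tK : (t * K <= e)%R by rewrite -ler_pdivlMr// ge_min lexx orbT.
apply: le_trans (h _ t0) _.
have t2 : (0 <= t * (1 - t))%R by rewrite mulr_ge0 ?subr_ge0// ltW.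
have p1 : (0 <= c * Y * (t * (1 - t)))%R by exact: mulr_ge0.
have p2 : (0 <= c * (t * (1 - t)))%R by exact: mulr_ge0.
have p3 : (0 <= c * (t * (1 - t)) * t)%R by rewrite mulr_ge0// ltW.
have p4 : (0 <= b * (t * (1 - t)))%R by exact: mulr_ge0.
by rewrite /K in tK; nra.
Qed.

Lemma second_moment_limit : L2sq X < +oo ->
  L2sq X = q`!%:R%:E * iterint mu q (fun s => (F s ^+ 2)%:E).
Proof.
move=> Xoo; set x := L2sq X in Xoo *; set Y := iterint _ _ _.
have sqF : 0 <= Y by apply: iterint_ge0 => s; rewrite lee_fin sqr_ge0.
have sqX : 0 <= x by apply: integral_ge0 => w _; rewrite lee_fin sqr_ge0.
have Yf : Y \is a fin_num by rewrite ge0_fin_numE.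
have xf : x \is a fin_num by rewrite ge0_fin_numE.
have mk (k : simple_kernel mu q) : measurable_fun setT (fun t : q.-tuple Z => kfun k t).
  by apply/measurable_EFinP; exact: (mkfun k).
have mFt : measurable_fun setT (fun t : q.-tuple Z => F t) by apply/measurable_EFinP; exact: mF.
have iE (u : seq Z -> R) : seq_measurable (EFin \o u) ->
    iterint mu q (fun s => (u s ^+ 2)%:E) = \int[tuple_measure mu q]_t (u t ^+ 2)%:E.
  move=> mU; rewrite (@integral_tuple_measure _ _ _ mu q (fun s => (u s ^+ 2)%:E))//.
  - by move=> s; rewrite lee_fin sqr_ge0.
  - by move=> n; apply/measurable_EFinP; apply: measurable_funX; apply/measurable_EFinP; exact: mU.
have dE u v : seq_measurable (EFin \o u) -> seq_measurable (EFin \o v) ->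
    sqdist u v = \int[tuple_measure mu q]_t ((u t - v t) ^+ 2)%:E.
  move=> mU mV; apply: (iE (fun s => u s - v s)%R) => n; apply/measurable_EFinP.
  by apply: measurable_funB; apply/measurable_EFinP; [exact: mU|exact: mV].
have iso (k : simple_kernel mu q) : L2sq (kint eta k) =
    q`!%:R%:E * iterint mu q (fun s => (kfun k s ^+ 2)%:E).
  rewrite -(simple_isometry Zborel mu_atomless Peta (@measurable_cell _ _ _ _ _ k) (@cell_fin _ _ _ _ _ k)
    (@cell_disjoint _ _ _ _ _ k) (kernel_simple k)) expectE//.
  by apply: all_momentsX; exact: (all_moments_kint Peta k).
have e2 (delta : R) : (0 < delta)%R -> ((1 + delta^-1) * delta ^+ 2 = delta ^+ 2 + delta)%R.
  by move=> d0; field; rewrite gt_eqF.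
have Qf : (0 <= q`!%:R :> R)%R by [].
suff [h1 h2] : (fine x <= q`!%:R * fine Y)%R /\ (q`!%:R * fine Y <= 1 * fine x)%R.
  rewrite -(fineK xf) -(fineK Yf) -EFinM; congr EFin; apply/eqP.
  by rewrite eq_le h1 /=; rewrite mul1r in h2.
have absorb (A I D : \bar R) (delta : R) : (0 < delta)%R ->
    A <= (1 + delta)%:E * I + (1 + delta^-1)%:E * D -> D <= (delta ^+ 2)%:E ->
    A <= (1 + delta)%:E * I + (delta ^+ 2 + delta)%:E.
  move=> d0 h Dd; apply: le_trans h _; rewrite leeD2l// -(e2 _ d0) [leRHS]EFinM.
  by apply: lee_wpmul2l => //; rewrite lee_fin addr_ge0// invr_ge0 ltW.
have symX (k : simple_kernel mu q) : L2sq (fun w => X w - kint eta k w)%R =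
    L2sq (fun w => kint eta k w - X w)%R.
  by apply: eq_integral => w _; rewrite -opprB sqrrN.
(* [I] is the squared norm of a kernel within squared distance [delta^2]; it links [x] and [Y] in
   both directions through the exact isometry of that kernel. *)
have bounds (delta : R) : (0 < delta)%R -> exists I : R, [/\
    (fine x <= (1 + delta) * (q`!%:R * I) + (delta ^+ 2 + delta))%R,
    (I <= (1 + delta) * fine Y + (delta ^+ 2 + delta))%R,
    (fine Y <= (1 + delta) * I + (delta ^+ 2 + delta))%R &
    (q`!%:R * I <= (1 + delta) * fine x + (delta ^+ 2 + delta))%R].
  move=> d0; have [k [kF kX]] := approx (exprn_gt0 2 d0).
  have b1 := square_perturb P d0 mX (kint_measurable k).
  have b2 := square_perturb (tuple_measure mu q) d0 (mk k) mFt.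
  have b3 := square_perturb (tuple_measure mu q) d0 mFt (mk k).
  have b4 := square_perturb P d0 (kint_measurable k) mX.
  rewrite -(iE _ (mkfun k)) -(iE _ mF) -(dE _ _ (mkfun k) mF) in b2.
  rewrite -(iE _ (mkfun k)) -(iE _ mF) -(dE _ _ mF (mkfun k)) sqdistC in b3.
  rewrite symX in b1; rewrite !iso -/x -/Y in b1 b2 b3 b4.
  move: b1 b2 b3 b4 => /(absorb _ _ _ _ d0)/(_ kX) b1 /(absorb _ _ _ _ d0)/(_ kF) b2
    /(absorb _ _ _ _ d0)/(_ kF) b3 /(absorb _ _ _ _ d0)/(_ kX) b4.
  set I := iterint mu q _ in b1 b2 b3 b4.
  have I0 : 0 <= I by apply: iterint_ge0 => s; rewrite lee_fin sqr_ge0.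
  have If : I \is a fin_num.
    by rewrite ge0_fin_numE//; apply: le_lt_trans b2 _; rewrite -(fineK Yf) -EFinM -EFinD ltry.
  move: b1 b2 b3 b4; rewrite -(fineK Yf) -(fineK xf) -(fineK If) -!EFinM -!EFinD !lee_fin.
  by move=> *; exists (fine I); split.
split.
  apply: (@le_of_small_perturb _ _ _ 1%R); rewrite ?fine_ge0// => delta d0.
  have [I [b1 b2 _ _]] := bounds _ d0; apply: le_trans b1 _; rewrite mul1r lerD2r.
  by apply: ler_wpM2l; [rewrite addr_ge0// ltW|exact: ler_wpM2l].
apply: (@le_of_small_perturb _ _ _ q`!%:R); rewrite ?fine_ge0// => delta d0.
have [I [_ _ b3 b4]] := bounds _ d0.
apply: (@le_trans _ _ (q`!%:R * ((1 + delta) * I + (delta ^+ 2 + delta)))%R).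
  exact: ler_wpM2l.
rewrite mulrDr lerD2r mulrCA mul1r; apply: ler_wpM2l => //.
by rewrite addr_ge0// ltW.
Qed.

End fourth_moment_limit.

(** * Symmetrization and elementary integrands *)

Section symmetric_kernel.
Context {R : realType} {d : measure_display} {Z : measurableType d}.
Variable mu : {sigma_finite_measure set Z -> \bar R}.
Variables (q : nat) (f : q.-tuple Z -> R).
Hypothesis mf : measurable_fun setT f.
Hypothesis fsym : symmetric_ae mu f.
Hypothesis f0 : {ae tuple_measure mu q, forall x, (0 <= f x)%R}.

Definition permuted (T : Type) (x : q.-tuple T) (p : 'S_q) : q.-tuple T :=
  [tuple tnth x (p i) | i < q].

(** A representative of [f] that is symmetric and nonnegative at every point, as the permutations
    inside words require. *)
Definition symkernel : seq Z -> R := symmetrize (fun t => Num.max (f t) 0%R).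

(** The function [D] used to compare contractions: it is zero almost everywhere and its zeros force
    [f = symkernel f]. Summing over all permutations makes it symmetric itself. *)
Definition asymmetry (s : seq Z) : R :=
  if insub s is Some t then (\sum_(p : 'S_q) `|f (permuted t p) - symkernel t|)%R else 0%R.

Lemma asymmetry_tuple (t : q.-tuple Z) :
  asymmetry t = (\sum_(p : 'S_q) `|f (permuted t p) - symkernel t|)%R.
Proof. by rewrite /asymmetry valK. Qed.

Lemma symkernel_perm s s' : perm_eq s s' -> symkernel s = symkernel s'.
Proof. exact: symmetrize_perm. Qed.

Lemma symkernel_size s : size s <> q -> symkernel s = 0%R.
Proof. exact: symmetrize_size. Qed.

Lemma symkernel_ge0 s : (0 <= symkernel s)%R.
Proof.
rewrite /symkernel /symmetrize; case: insubP => // t _ _.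
by rewrite mulr_ge0 ?invr_ge0// sumr_ge0// => p _; rewrite le_max lexx orbT.
Qed.

Lemma asymmetry_ge0 s : (0 <= asymmetry s)%R.
Proof. by rewrite /asymmetry; case: insubP => // t _ _; apply: sumr_ge0. Qed.

Lemma asymmetry_perm s s' : perm_eq s s' -> asymmetry s = asymmetry s'.
Proof.
apply: (perm_eq_invariant (q := q)) => [{}s sq|t p].
  by rewrite /asymmetry insubN//; exact/eqP.
rewrite !asymmetry_tuple [RHS](reindex_inj (mulIg p))/=; apply: eq_bigr => p' _.
congr `|f _ - _|%R.
  by apply: eq_from_tnth => i; rewrite !tnth_mktuple permM.
by apply: symkernel_perm; apply/tuple_permP; exists p.
Qed.

Lemma measurable_permuted p : measurable_fun setT (fun x : q.-tuple Z => permuted x p).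
Proof.
apply/measurable_fun_tnthP => i.
rewrite (_ : _ \o _ = (@tnth q Z)^~ (p i)); first exact: measurable_tnth.
by apply/funext => x /=; rewrite tnth_mktuple.
Qed.

Lemma seq_measurable_tuple (u : seq Z -> R) : (forall s, size s <> q -> u s = 0%R) ->
  measurable_fun setT (fun x : q.-tuple Z => u x) -> seq_measurable (EFin \o u).
Proof.
move=> uq mU n; apply/measurable_EFinP; have [nq|nq] := eqVneq n q; first by subst n.
rewrite (_ : (fun _ => _) = cst 0%R)//; apply/funext => x /=; apply: uq.
by rewrite size_tuple; exact/eqP.
Qed.

Lemma symkernel_measurable : seq_measurable (EFin \o symkernel).
Proof.
apply: seq_measurable_tuple; first exact: symkernel_size.
rewrite (_ : (fun _ => _) = fun x : q.-tuple Z =>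
  ((q`!%:R)^-1 * \sum_(p : 'S_q) Num.max (f (permuted x p)) 0%R)%R); last first.
  by apply/funext => x; exact: symmetrize_tuple.
apply: measurable_funM => //; apply: measurable_sum => p.
by apply: measurable_maxr => //; apply: measurableT_comp => //; exact: measurable_permuted.
Qed.

Lemma asymmetry_measurable : seq_measurable (EFin \o asymmetry).
Proof.
apply: seq_measurable_tuple => [s sq|]; first by rewrite /asymmetry insubN//; exact/eqP.
rewrite (_ : (fun _ => _) = fun x : q.-tuple Z =>
  (\sum_(p : 'S_q) `|f (permuted x p) - symkernel x|)%R); last first.
  by apply/funext => x; exact: asymmetry_tuple.
apply: measurable_sum => p; apply: measurableT_comp => //; apply: measurable_funB.
  by apply: measurableT_comp => //; exact: measurable_permuted.
by apply/measurable_EFinP; exact: symkernel_measurable.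
Qed.

Lemma asymmetry_ae : {ae tuple_measure mu q, forall x : q.-tuple Z, asymmetry x = 0%R}.
Proof.
have fp : {ae tuple_measure mu q, forall x, forall p : 'S_q, f (permuted x p) = f x}.
  by apply: filter_forall => p; exact: fsym.
apply: filterS2 fp f0 => x xp x0; rewrite asymmetry_tuple.
have -> : symkernel x = f x.
  rewrite /symkernel symmetrize_tuple (eq_bigr (fun=> f x)); last first.
    by move=> p _; rewrite -/(permuted x p) xp max_l.
  rewrite sumr_const card_Sn -[X in (_ * X)%R]mulr_natl mulrA mulVf ?mul1r//.
by rewrite big1// => p _; rewrite xp subrr normr0.
Qed.

Lemma asymmetry_null : iterint mu q (EFin \o asymmetry) = 0.
Proof.
rewrite -integral_tuple_measure; last 2 first.
- by move=> s; rewrite lee_fin asymmetry_ge0.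
- exact: asymmetry_measurable.
rewrite (ae_eq_integral (cst 0)) ?integral0//; first exact: asymmetry_measurable.
by apply: filterS asymmetry_ae => x /= -> _.
Qed.

Lemma asymmetry0_eq (x : q.-tuple Z) : asymmetry x = 0%R -> f x = symkernel x.
Proof.
rewrite asymmetry_tuple => /eqP; rewrite psumr_eq0// => /allP /(_ 1%g (mem_index_enum _)).
rewrite normr_eq0 subr_eq0 => /eqP <-; congr f.
by apply: eq_from_tnth => i; rewrite tnth_mktuple perm1.
Qed.

Lemma symkernel_ae : {ae tuple_measure mu q, forall x : q.-tuple Z, f x = symkernel x}.
Proof. by apply: filterS asymmetry_ae => x; exact: asymmetry0_eq. Qed.

Section conversion.
Context {d' : measure_display} {Omega : measurableType d'}.
Variables (eta : R.-ker Omega ~> Z) (e : elementary mu q).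

Let A := el_set e.
Let mA : forall i, measurable (A i) := @el_measurable _ _ _ _ _ e.
Let Aoo : forall i, mu (A i) < +oo := @el_finite _ _ _ _ _ e.
Let tA : trivIset setT A := @el_disjoint _ _ _ _ _ e.

Definition cell_coef (t : q.-tuple (option 'I_(el_size e))) : R :=
  (\sum_(i : {ffun 'I_q -> 'I_(el_size e)})
    el_coef e i * [forall j, tnth t j == Some (i j)]%:R)%R.

Lemma elementary_funE (x : q.-tuple Z) :
  elementary_fun e x = cell_coef [tuple of map (index_of A) x].
Proof.
apply: eq_bigr => i _; congr (_ * _)%R.
have ind j : \1_(A (i j)) (tnth x j) = (tnth [tuple of map (index_of A) x] j == Some (i j))%:R :> R.
  rewrite tnth_map indicE; congr ((nat_of_bool _)%:R); apply/idP/eqP.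
    by move=> /set_mem Ax; exact/(index_ofP tA).
  by move=> /(index_ofP tA) Ax; exact: mem_set.
under eq_bigr do rewrite ind.
case: forallP => [h|/existsNP[j /negP jN]].
  by rewrite big1// => j _; rewrite h.
by rewrite (bigD1 j)//= (negbTE jN) mul0r.
Qed.

Lemma cell_coef_simple : simple_coef q (symmetrize cell_coef).
Proof.
split.
- by move=> s s'; exact: symmetrize_perm.
- move=> s sN; have [sq|/eqP sq] := eqVneq (size s) q; last exact: symmetrize_size.
  pose t := tcast sq (in_tuple s); have tE : tval t = s by rewrite val_tcast.
  rewrite -tE symmetrize_tuple big1 ?mulr0// => p _; rewrite /cell_coef big1// => i _.
  case: forallP => [h|_]; last by rewrite mulr0.
  move: sN; rewrite -tE => /tnthP[j tj]; have := h ((p^-1)%g j).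
  by rewrite tnth_mktuple permKV -tj.
- move=> s su; have [sq|/eqP sq] := eqVneq (size s) q; last exact: symmetrize_size.
  pose t := tcast sq (in_tuple s); have tE : tval t = s by rewrite val_tcast.
  rewrite -tE symmetrize_tuple big1 ?mulr0// => p _; rewrite /cell_coef big1// => i _.
  case: forallP => [h|_]; last by rewrite mulr0.
  rewrite el_diagonal ?mul0r// => inj_i; move: su; rewrite -tE => /negP; apply.
  apply/tuple_uniqP => j1 j2 j12; apply: (perm_inj (s := (p^-1)%g)); apply: inj_i.
  apply: Some_inj; rewrite -(eqP (h _)) -(eqP (h _)) !tnth_mktuple !permKV//.
- by move=> s; exact: symmetrize_size.
Qed.

Definition kernel_of : simple_kernel mu q := SimpleKernel mA Aoo tA cell_coef_simple.

Lemma symmetrize_map (T T' : eqType) (g : T -> T') (b : q.-tuple T' -> R) (t : q.-tuple T) :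
  symmetrize b (map g t) = symmetrize (fun t => b [tuple of map g t]) t.
Proof.
rewrite -[map g t]/(tval [tuple of map g t]) !symmetrize_tuple; congr (_ * _)%R.
apply: eq_bigr => p _; congr b; apply: eq_from_tnth => i.
by rewrite tnth_map !tnth_mktuple tnth_map.
Qed.

Lemma kfun_kernel_of (x : q.-tuple Z) : kfun kernel_of x = symmetrize (elementary_fun e) x.
Proof.
rewrite /kfun /simple_fun /= symmetrize_map !symmetrize_tuple; congr (_ * _)%R.
by apply: eq_bigr => p _; rewrite elementary_funE.
Qed.

(** The product of the centered counts is symmetric, so averaging the coefficients over permutations
    leaves the integral unchanged. *)
Lemma kint_kernel_of w : kint eta kernel_of w = elementary_integral eta e w.
Proof.
rewrite /kint /simple_integral wsumE /=.
under eq_bigr do rewrite symmetrize_map.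
rewrite (sum_symmetrize _ (c := fun s => \prod_(i <- s) centered mu eta (A i) w)%R); last first.
  by move=> s s'; exact: perm_big.
rewrite /elementary_integral.
rewrite (reindex (fun i : {ffun 'I_q -> 'I_(el_size e)} => [tuple i j | j < q]))/=; last first.
  exists (fun t : q.-tuple _ => [ffun j => tnth t j]) => [i _|t _].
    by apply/ffunP => j; rewrite ffunE tnth_mktuple.
  by apply: eq_from_tnth => j; rewrite tnth_mktuple ffunE.
apply: eq_bigr => i _; congr (_ * _)%R.
  rewrite /cell_coef (bigD1 i)//= big1 ?addr0.
    case: forallP => [_|]; first by rewrite mulr1.
    by move=> h; exfalso; apply: h => j; rewrite tnth_map tnth_mktuple.
  move=> i' i'i; case: forallP => [h|_]; last by rewrite mulr0.
  exfalso; move/eqP: i'i; apply; apply/ffunP => j.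
  by have := h j; rewrite tnth_map tnth_mktuple => /eqP[->].
by rewrite /= big_map big_enum.
Qed.

Lemma elementary_fun_measurable : measurable_fun setT (elementary_fun e).
Proof.
rewrite /elementary_fun; apply: measurable_sum => i; apply: measurable_funM => //.
apply: measurable_prod => j _.
exact: (measurableT_comp (measurable_indic (mA _)) (@measurable_tnth _ _ _ j)).
Qed.

(** Symmetrization is a contraction of L^2 that fixes [symkernel]: the squared mean over
    permutations is at most the mean of the squares, and the product measure is invariant under each
    permutation. *)
Lemma kernel_of_dist :
  iterint mu q (fun s => ((kfun kernel_of s - symkernel s) ^+ 2)%:E) <=
  \int[tuple_measure mu q]_x ((elementary_fun e x - f x) ^+ 2)%:E.
Proof.
pose g (x : q.-tuple Z) := ((elementary_fun e x - symkernel x) ^+ 2)%R.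
have mS : measurable_fun setT (fun x : q.-tuple Z => symkernel x).
  by apply/measurable_EFinP; exact: symkernel_measurable.
have mg : measurable_fun setT g.
  by apply: measurable_funX; apply: measurable_funB => //; exact: elementary_fun_measurable.
have g0 x : (0 <= g x)%R by exact: sqr_ge0.
pose G s := (eval_seq g s)%:E.
have G0 s : 0 <= G s by rewrite lee_fin /eval_seq; case: insubP => *; rewrite ?g0.
have mG : seq_measurable G by exact: (eval_seq_measurable mg).
have -> : \int[tuple_measure mu q]_x ((elementary_fun e x - f x) ^+ 2)%:E = iterint mu q G.
  rewrite -integral_tuple_measure//; apply: ae_eq_integral => //.
  - apply/measurable_EFinP; apply: measurable_funX; apply: measurable_funB => //.
    exact: elementary_fun_measurable.
  - exact: (mG q).
  by apply: filterS symkernel_ae => x xE _; rewrite /G eval_seq_tuple /g xE.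
pose z0 : Z := point.
pose plist (p : 'S_q) := [seq val (p i) | i <- enum 'I_q].
have plistP p : perm_eq (plist p) (iota 0 q).
  rewrite /plist map_comp -val_enum_ord; apply: perm_map; apply: uniq_perm.
  - by rewrite map_inj_uniq ?enum_uniq//; exact: perm_inj.
  - exact: enum_uniq.
  by move=> i; rewrite mem_enum inE; apply/mapP; exists ((p^-1)%g i); rewrite ?mem_enum ?permKV.
have Gp (x : q.-tuple Z) p : G [seq nth z0 x i | i <- plist p] = (g (permuted x p))%:E.
  rewrite /G -eval_seq_tuple; congr (eval_seq g _)%:E.
  rewrite /plist -map_comp /permuted /= ; apply: eq_map => i /=.
  by rewrite (tnth_nth z0).
have mGp p : seq_measurable (fun s => G [seq nth z0 s i | i <- plist p]).
  exact: seq_measurable_gather.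
have qf : (0 <= (q`!%:R)^-1 :> R)%R by rewrite invr_ge0.
apply: (@le_trans _ _ (iterint mu q (fun s => \sum_(p : 'S_q) ((q`!%:R)^-1)%:E *
    G [seq nth z0 s i | i <- plist p]))).
  apply: le_iterint_size.
  - by move=> s; rewrite lee_fin sqr_ge0.
  - apply: (sqdist_measurable (u := kfun kernel_of)); first exact: kfun_measurable.
    exact: symkernel_measurable.
  - move=> n; apply: emeasurable_sum => p; apply: emeasurable_funM => //; exact: (mGp p n).
  move=> s sq; pose x := tcast sq (in_tuple s); have xE : tval x = s by rewrite val_tcast.
  rewrite -xE; under eq_bigr do rewrite Gp -EFinM.
  rewrite sumEFin lee_fin kfun_kernel_of symmetrize_tuple -mulr_sumr.
  have := @sqr_mean_le R _ (fun p : 'S_q => elementary_fun e (permuted x p) - symkernel x)%R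
    q`! (card_Sn q) (fact_gt0 q).
  rewrite sumrB sumr_const card_Sn mulrBr -[(symkernel x *+ _)%R]mulr_natl mulrA mulVf ?mul1r//.
  move=> h; apply: le_trans h _; rewrite le_eqVlt; apply/orP; left; apply/eqP; congr (_ * _)%R.
  apply: eq_bigr => p _; rewrite /g; congr ((_ - _) ^+ 2)%R.
  by apply: symkernel_perm; rewrite perm_sym; apply/tuple_permP; exists p.
rewrite iterint_sum; last 2 first.
- by move=> p s; apply: mule_ge0.
- by move=> p n; apply: emeasurable_funM => //; exact: (mGp p n).
rewrite (eq_bigr (fun=> ((q`!%:R)^-1)%:E * iterint mu q G)); last first.
  by move=> p _; rewrite iterintZl// iterint_perm.
rewrite -ge0_sume_distrl; last by move=> p _; rewrite lee_fin.
have c1 : ((q`!%:R)^-1 *+ q`! = 1 :> R)%R.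
  by rewrite -[LHS]mulr_natl mulfV// pnatr_eq0 -lt0n fact_gt0.
by rewrite sumEFin sumr_const card_Sn c1 mul1e.
Qed.

End conversion.
End symmetric_kernel.

(** * The fourth cumulant *)

Section multiple_integral_moments.
Context {R : realType} {d d' : measure_display}.
Context {Z : measurableType d} {Omega : measurableType d'}.
Variables (P : probability Omega R) (mu : {sigma_finite_measure set Z -> \bar R})
  (eta : R.-ker Omega ~> Z).

Lemma Lnorm2_cvg0 d1 (T : measurableType d1) (m : {measure set T -> \bar R}) (h : nat -> T -> R)
    (eps : R) : (0 < eps)%R -> 'N[m]_2%:E[EFin \o h n] @[n --> \oo] --> 0 ->
  \forall n \near \oo, \int[m]_x (h n x ^+ 2)%:E <= eps%:E.
Proof.
move=> e0 cv.
have se : (0 < Num.sqrt eps)%R by rewrite sqrtr_gt0.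
have /cv : nbhs (0 : \bar R) [set y | y < (Num.sqrt eps)%:E].
  by apply: open_nbhs_nbhs; split; [exact: open_ereal_lt_ereal|rewrite /= lte_fin].
move=> cvn; have : \forall n \near \oo, 'N[m]_2%:E[EFin \o h n] < (Num.sqrt eps)%:E.
  exact: cvn.
apply: filterS => n /ltW; rewrite Lnorm2E.
rewrite (_ : (Num.sqrt eps)%:E = sqrte eps%:E)// lee_sqrt ?lee_fin ?(ltW e0)//.
move=> h1; apply: le_trans h1; rewrite le_eqVlt; apply/orP; left; apply/eqP.
apply: eq_integral => x _; by rewrite /= -EFinM -expr2 real_normK// num_real.
Qed.

Lemma measurable_Lfun d1 (T : measurableType d1) (m : {measure set T -> \bar R}) (h : T -> R) :
  h \in Lfun m 2%:E -> measurable_fun setT h.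
Proof. by move=> /sub_Lfun_mfun; rewrite inE. Qed.

Lemma Lfun2_finite d1 (T : measurableType d1) (m : {measure set T -> \bar R}) (h : T -> R) :
  h \in Lfun m 2%:E -> \int[m]_x (h x ^+ 2)%:E < +oo.
Proof.
move=> /Lfun2_integrable_sqr /integrableP[_]; apply: le_lt_trans.
rewrite le_eqVlt; apply/orP; left; apply/eqP; apply: eq_integral => x _.
by rewrite /= ger0_norm// sqr_ge0.
Qed.

Variables (q : nat) (f : q.-tuple Z -> R) (X : Omega -> R).
Hypothesis fL2 : f \in Lfun (tuple_measure mu q) 2%:E.
Hypothesis fsym : symmetric_ae mu f.
Hypothesis f0 : {ae tuple_measure mu q, forall x, (0 <= f x)%R}.
Hypothesis fX : is_multiple_integral mu P eta f X.

Local Notation F := (symkernel f).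

Let mf : measurable_fun setT f. Proof. exact: measurable_Lfun fL2. Qed.

Lemma kernel_approximation (eps : R) : (0 < eps)%R -> exists k : simple_kernel mu q,
  iterint mu q (fun s => ((kfun k s - F s) ^+ 2)%:E) <= eps%:E /\
  \int[P]_w ((kint eta k w - X w) ^+ 2)%:E <= eps%:E.
Proof.
move=> e0; have [_ [h [hf hX]]] := fX.
have [n [nf nX]] := filter_ex (filterI (Lnorm2_cvg0 e0 hf) (Lnorm2_cvg0 e0 hX)).
exists (kernel_of (h n)); split; first exact: le_trans (kernel_of_dist mf fsym f0 (h n)) nf.
apply: le_trans nX; rewrite le_eqVlt; apply/orP; left; apply/eqP.
by apply: eq_integral => w _; rewrite kint_kernel_of.
Qed.

Lemma iterint_symkernel (u : R -> R) : (forall x, 0 <= u x)%R -> measurable_fun setT u ->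
  iterint mu q (fun s => (u (F s))%:E) = \int[tuple_measure mu q]_x (u (f x))%:E.
Proof.
move=> u0 mU.
have mUF : seq_measurable (fun s => (u (F s))%:E).
  move=> n; apply/measurable_EFinP; apply: measurableT_comp => //.
  by apply/measurable_EFinP; exact: (symkernel_measurable mf).
rewrite -integral_tuple_measure//; last by move=> s; rewrite lee_fin.
apply: ae_eq_integral => //.
- exact: (mUF q).
- by apply/measurable_EFinP; apply: measurableT_comp.
by apply: filterS (symkernel_ae fsym f0) => x ->.
Qed.

Lemma Jword_full : Jword mu (fun=> F) (nseq q [set: 'I_4]%SET) =
  \int[tuple_measure mu q]_x (f x ^+ 4)%:E.
Proof.
rewrite -(iterint_symkernel (u := fun x => x ^+ 4)%R); last 2 first.
- by move=> x; rewrite exprn_even_ge0.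
- exact: measurable_funX.
rewrite /Jword /wordint size_nseq; apply: eq_iterint => s sq; congr EFin.
rewrite (eq_bigr (fun=> F s)); last first.
  by move=> i _; have := row_of_nseq i [set: 'I_4]%SET s; rewrite sq finset.in_setT => ->.
by rewrite prodr_const card_ord.
Qed.

Hypothesis Zborel : borel_space R Z.
Hypothesis mu_atomless : atomless mu.
Hypothesis Peta : is_poisson_measure P mu eta.

(** The isometry identifies the pairing terms with [3 sigma^4], which is finite, so it may be
    subtracted even when the fourth moment is infinite. *)
Lemma fourth_cumulant (sigma : R) : (0 < q)%N ->
  (sigma ^+ 2)%:E = 'E_P[fun w => (X w ^+ 2)%R] ->
  'E_P[fun w => (X w ^+ 4)%R] - (3 * sigma ^+ 4)%:E = excess mu q F.
Proof.
move=> q0; rewrite !unlock => s2; have XL2 := fX.1.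
have mX := measurable_Lfun XL2.
have mF := symkernel_measurable mf.
have Foo : iterint mu q (fun s => (F s ^+ 2)%:E) < +oo.
  rewrite (iterint_symkernel (u := fun x => x ^+ 2)%R).
  - exact: Lfun2_finite.
  - by move=> x; exact: sqr_ge0.
  - exact: measurable_funX.
have E2 := second_moment_limit Zborel mu_atomless Peta mF mX Foo kernel_approximation (Lfun2_finite XL2).
have E4 := fourth_moment_limit Zborel mu_atomless Peta (symkernel_ge0 f) mF
  (@symkernel_perm _ _ _ _ f) (@symkernel_size _ _ _ _ f) mX Foo kernel_approximation.
rewrite E4 (fourth_moment_decomposition mu (symkernel_ge0 f) mF
  (@symkernel_perm _ _ _ _ f) (@symkernel_size _ _ _ _ f) q0).
have sqE : square_int mu q F = iterint mu q (fun s => (F s ^+ 2)%:E) by [].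
have sqf : square_int mu q F \is a fin_num.
  by rewrite sqE ge0_fin_numE//; apply: iterint_ge0 => s; rewrite lee_fin sqr_ge0.
move: E2; rewrite -s2 -sqE -(fineK sqf) -!EFinM; set y := fine _ => -[sy].
rewrite (_ : 3 * sigma ^+ 4 = 3 * q`!%:R ^+ 2 * (y * y))%R; last first.
  rewrite (_ : sigma ^+ 4 = sigma ^+ 2 * sigma ^+ 2)%R; last by ring.
  by rewrite sy; ring.
by rewrite addeC addeA -EFinN -EFinD addNr add0e.
Qed.

End multiple_integral_moments.

(** * The two-sided bound *)

Lemma bigmaxe_nat_le (R : realType) m n (u : nat -> \bar R) x : 0 <= x ->
  (forall i, (m <= i < n)%N -> u i <= x) -> \big[maxe/0]_(m <= i < n) u i <= x.
Proof.
move=> x0 ux; rewrite big_nat; elim/big_ind : _ => //= y z yx zx.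
by rewrite ge_max yx zx.
Qed.

Lemma le_bigmaxe_nat (R : realType) m n (u : nat -> \bar R) i : (m <= i < n)%N ->
  u i <= \big[maxe/0]_(m <= i < n) u i.
Proof.
move=> mi; have : i \in index_iota m n by rewrite mem_index_iota.
elim: (index_iota m n) => [//|j r IH]; rewrite inE big_cons le_max => /predU1P[->|/IH ->].
  by rewrite lexx.
by rewrite orbT.
Qed.

Theorem proposition3p8 (R : realType) (q : nat) (hq : (1 <= q)%N) :
  exists c1 C1 : R, [/\ (0 < c1)%R, (c1 < C1)%R &
    forall (d : measure_display) (Z : measurableType d)
      (mu : {sigma_finite_measure set Z -> \bar R})
      (d' : measure_display) (Omega : measurableType d')
      (P : probability Omega R) (eta : R.-ker Omega ~> Z)
      (f : q.-tuple Z -> R) (F : Omega -> R) (sigma : R),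
    borel_space R Z ->
    atomless mu ->
    is_poisson_measure P mu eta ->
    f \in Lfun (tuple_measure mu q) 2%:E ->
    symmetric_ae mu f ->
    ~ {ae tuple_measure mu q, forall x, f x = 0%R} ->
    {ae tuple_measure mu q, forall x, (0 <= f x)%R} ->
    assumption_i mu f ->
    assumption_ii mu f ->
    assumption_iii mu f ->
    is_multiple_integral mu P eta f F ->
    (0 < sigma)%R ->
    (sigma ^+ 2)%:E = 'E_P[fun w => (F w ^+ 2)%R] ->
    c1%:E * sigma%:E * B3 mu f sigma
      <= sqrte ('E_P[fun w => (F w ^+ 4)%R] - (3 * sigma ^+ 4)%:E)
      <= C1%:E * sigma%:E * B3 mu f sigma].
Proof.
pose cf : R := (q`!%:R ^+ 4 / (2 * q)`!%:R)%R.
have cf0 : (0 < cf)%R by rewrite divr_gt0 ?exprn_gt0 ?ltr0n ?fact_gt0.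
pose W : R := Num.max (word_count q) 0%R.
have W0 : (0 <= W)%R by rewrite le_max lexx orbT.
pose a : R := Num.sqrt cf; have a0 : (0 < a)%R by rewrite sqrtr_gt0.
(* The maximum and the L^4 term are each at most [a^-1] times the root of the excess, and adding the
   two bounds costs the factor 2. The summand [a] in the upper constant makes the inequality between
   the constants strict. *)
exists (a / 2)%R, (Num.sqrt W + a)%R; split; first exact: divr_gt0.
  apply: (@lt_le_trans _ _ a); last by rewrite lerDr sqrtr_ge0.
  by rewrite ltr_pdivrMr// ltr_pMr// ltr1n.
move=> d Z mu d' Omega P eta f F sigma Zb muA Peta fL2 fs _ f0 _ _ _ fF s0 s2.
rewrite (fourth_cumulant fL2 fs f0 fF Zb muA Peta hq s2).
have mf : measurable_fun setT f := measurable_Lfun fL2.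
set G := symkernel f.
have G0 := symkernel_ge0 f; have mG := symkernel_measurable mf.
have GP := @symkernel_perm _ _ _ _ f; have Gq := @symkernel_size _ _ _ _ f.
have norm_star r l : (l <= r)%N -> (r <= q)%N ->
    L2_norm mu (star_contraction mu f f r l) = sqrte (Jword mu (fun=> G) (canword q r l)).
  move=> lr rq; apply: (L2_norm_star mf G0 mG GP (asymmetry_ge0 f) (asymmetry_measurable mf)
    (@asymmetry_perm _ _ _ _ f) (asymmetry_null mf fs f0) (@asymmetry0_eq _ _ _ _ f)) => //.
set y := Jword mu (fun=> G) (nseq q [set: 'I_4]%SET).
have yE : 'N[tuple_measure mu q]_4%:E[EFin \o f] ^+ 2 = sqrte y.
  by rewrite Lnorm4_sqr /y (Jword_full fL2 fs f0).
set M := \big[maxe/0]_(1 <= r < q.+1) \big[maxe/0]_(1 <= l < (minn r q.-1).+1)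
  L2_norm mu (star_contraction mu f f r l).
have J0 w : 0 <= Jword mu (fun=> G) w by apply: Jword_ge0 => _ s; exact: G0.
have M0 : 0 <= M.
  by rewrite /M; elim/big_ind : _ => // [u v u0 v0|r _]; [rewrite le_max u0|
    elim/big_ind : _ => // [u v u0 v0|l _]; [rewrite le_max u0|exact: Lnorm_ge0]].
have B3E (c : R) : c%:E * sigma%:E * B3 mu f sigma = c%:E * (M + sqrte y).
  rewrite /B3 yE -/M -muleA; congr (_ * _).
  by rewrite muleA -EFinM mulfV ?gt_eqF// mul1e.
rewrite !B3E.
have MB0 : 0 <= M + sqrte y by rewrite adde_ge0// sqrte_ge0.
have ex0 : 0 <= excess mu q G by exact: excess_ge0.
have root_le x : 0 <= x -> cf%:E * x <= excess mu q G -> a%:E * sqrte x <= sqrte (excess mu q G).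
  move=> x0 xe; rewrite (_ : a%:E = sqrte cf%:E)// -sqrteM ?lee_fin ?(ltW cf0)//.
  by rewrite lee_sqrt.
have norm_le r l : (1 <= r < q.+1)%N -> (1 <= l < (minn r q.-1).+1)%N ->
    [/\ (0 < l)%N, (l <= r <= q)%N & (l < q)%N].
  rewrite !ltnS leq_min => /andP[r1 rq] /andP[l1 /andP[lr lq]]; rewrite l1 lr rq; split=> //.
  by move: lq hq; case: (q) => // n; rewrite ltnS.
apply/andP; split.
  have aM : a%:E * M <= sqrte (excess mu q G).
    have ai : (a%:E * a^-1%:E = 1 :> \bar R) by rewrite -EFinM mulfV ?gt_eqF.
    have h x : a%:E * x <= sqrte (excess mu q G) -> x <= (a^-1)%:E * sqrte (excess mu q G).
      move=> h; have := lee_wpmul2l (_ : 0 <= (a^-1)%:E) h.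
      rewrite muleA [_ * a%:E]muleC ai mul1e; apply; by rewrite lee_fin invr_ge0 ltW.
    have e0' : 0 <= (a^-1)%:E * sqrte (excess mu q G).
      by rewrite mule_ge0 ?sqrte_ge0// lee_fin invr_ge0 ltW.
    apply: (@le_trans _ _ (a%:E * ((a^-1)%:E * sqrte (excess mu q G)))); last first.
      by rewrite muleA ai mul1e.
    apply: lee_wpmul2l; first by rewrite lee_fin ltW.
    apply: bigmaxe_nat_le => // r rq; apply: bigmaxe_nat_le => // l lr.
    have [l1 lrq lq] := norm_le _ _ rq lr; have /andP[lr' rq'] := lrq.
    apply: h; rewrite norm_star//; apply: root_le => //; exact: canword_le_excess.
  have aY : a%:E * sqrte y <= sqrte (excess mu q G).
    by apply: root_le; [exact: J0|exact: full_le_excess].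
  rewrite ge0_muleDr ?sqrte_ge0//.
  have half x : a%:E * x <= sqrte (excess mu q G) ->
      (a / 2)%:E * x <= (2^-1)%:E * sqrte (excess mu q G).
    by move=> h; rewrite mulrC EFinM -muleA; apply: lee_wpmul2l.
  apply: le_trans (leeD (half _ aM) (half _ aY)) _.
  rewrite -ge0_muleDl ?lee_fin// -EFinD (_ : 2^-1 + 2^-1 = 1)%R ?mul1e//.
  by field.
(* Every canonical word integral is the square of a norm bounded by [M] or equal to [sqrte y], so
   [(M + sqrte y) ^+ 2] is a common bound for all of them. *)
apply: (@le_trans _ _ (sqrte (W%:E * ((M + sqrte y) ^+ 2)))).
  rewrite lee_sqrt; last by rewrite mule_ge0// expe_ge0.
  have sq_le x : 0 <= x -> sqrte x <= M + sqrte y -> x <= (M + sqrte y) ^+ 2.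
    move=> x0 h; rewrite -(sqr_sqrte x0) !expe2.
    by apply: lee_pmul => //; exact: sqrte_ge0.
  apply: (@le_trans _ _ ((word_count q)%:E * ((M + sqrte y) ^+ 2))).
    apply: excess_le => //.
    - move=> r l l1 /andP[lr rq] lq; apply: sq_le => //.
      apply: (@le_trans _ _ M); last by rewrite leeDl// sqrte_ge0.
      rewrite -norm_star//; apply: (@le_trans _ _ (\big[maxe/0]_(1 <= l0 < (minn r q.-1).+1)
        L2_norm mu (star_contraction mu f f r l0))).
        apply: (le_bigmaxe_nat (fun l => L2_norm mu (star_contraction mu f f r l))).
        by rewrite l1 ltnS leq_min lr /= -ltnS prednK.
      apply: (le_bigmaxe_nat (fun r => \big[maxe/0]_(1 <= l0 < (minn r q.-1).+1)
        L2_norm mu (star_contraction mu f f r l0))).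
      by rewrite ltnS rq andbT; exact: leq_trans l1 lr.
    - by apply: sq_le; [exact: J0|rewrite leeDr].
    - exact: expe_ge0.
  by apply: lee_wpmul2r; [exact: expe_ge0|rewrite lee_fin le_max lexx].
rewrite sqrteM ?lee_fin// sqrte_sqr gee0_abs//; apply: lee_wpmul2r => //.
by rewrite lee_fin lerDl ltW.
Qed.
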